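(* Let $X\sim \mathrm{mPH}(\boldsymbol{\pi},\mathcal{T})$ with $\mathcal{T}=\{\boldsymbol{T}_1,\dots,\boldsymbol{T}_d\}$. Then its joint Laplace transform is given by $$\mathbb{E}\left(\exp\left(-\sum_{i=1}^d u_iX_i\right)\right)=\sum_{j=1}^p\pi_j\prod_{i=1}^d\boldsymbol{e}_j^{\mathsf{T}}(u_i\boldsymbol{I}-\boldsymbol{T}_i)^{-1}\boldsymbol{t}_i,\qquad u\in\mathbb{R}_+^d.$$ For all real $\theta_1,\dots,\theta_d>-1$, $$\mathbb{E}\left(X_1^{\theta_1}\cdots X_d^{\theta_d}\right)=\sum_{j=1}^p\pi_j\prod_{i=1}^d\Gamma(\theta_i+1)\,\boldsymbol{e}_j^{\mathsf{T}}(-\boldsymbol{T}_i)^{-\theta_i}\boldsymbol{e}.$$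
   Context: Notation: $\mathbb{R}_+=(0,\infty)$; $\boldsymbol{e}_j$ is the $j$-th canonical basis (column) vector of $\mathbb{R}^p$, $\boldsymbol{e}=\sum_{j=1}^p\boldsymbol{e}_j$, and $\boldsymbol{I}$ is the $p\times p$ identity matrix. For a square matrix $\boldsymbol{A}$ and a function $h$ analytic on a neighbourhood of its spectrum, $h(\boldsymbol{A})=\frac{1}{2\pi i}\oint_\Gamma h(w)(w\boldsymbol{I}-\boldsymbol{A})^{-1}dw$, with $\Gamma$ a simple closed path (in the domain of analyticity) enclosing the eigenvalues of $\boldsymbol{A}$; the power $(-\boldsymbol{T}_i)^{-\theta}$ is understood in this sense with $h(w)=w^{-\theta}$ the principal branch (the eigenvalues of $-\boldsymbol{T}_i$ have positive real part). mPH class. Let $\boldsymbol{\pi}=(\pi_1,\dots,\pi_p)$ be a probability row vector and let $\boldsymbol{T}_1,\dots,\boldsymbol{T}_d$ be real $p\times p$ sub-intensity matrices (nonnegative off-diagonal entries, strictly negative diagonal entries, nonpositive row sums) for which all states $1,\dots,p$ are transient (equivalently, each $\boldsymbol{T}_i$ is invertible). Let $\boldsymbol{t}_i=-\boldsymbol{T}_i\boldsymbol{e}$. For $i=1,\dots,d$ let $(J^{(i)}_t)_{t\ge 0}$ be a time-homogeneous Markov jump process on $\{1,\dots,p,p+1\}$ with $p+1$ absorbing, with transition intensities between the states $1,\dots,p$ given by $\boldsymbol{T}_i$ and intensities of jumping to $p+1$ given by $\boldsymbol{t}_i$. Assume that all the processes start in the same state, $J_0^{(1)}=\dots=J_0^{(d)}=:J_0$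 with $\mathbb{P}(J_0=j)=\pi_j$ for $j=1,\dots,p$, and that the $d$ processes are conditionally independent given $J_0$. Put $X_i=\inf\{t>0: J^{(i)}_t=p+1\}$. Then $X=(X_1,\dots,X_d)$ is said to be mPH (multivariate phase-type) distributed, written $X\sim \mathrm{mPH}(\boldsymbol{\pi},\mathcal{T})$ with $\mathcal{T}=\{\boldsymbol{T}_1,\dots,\boldsymbol{T}_d\}$ (indexed by $i=1,\dots,d$). *)

(* Defs.v *)
From HB Require Import structures.
From mathcomp Require Import all_boot all_order all_algebra.
From mathcomp Require Import all_classical all_reals all_analysis.
From mathcomp Require Import complex.

Set Implicit Arguments.
Unset Strict Implicit.
Unset Printing Implicit Defensive.

Import Order.TTheory GRing.Theory Num.Theory.
Import numFieldNormedType.Exports.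

Local Open Scope classical_set_scope.
Local Open Scope ring_scope.
Local Open Scope complex_scope.

Section GammaFunction.
Context {R : realType}.

Definition Gamma_fun (x : R) : R :=
  \int[lebesgue_measure]_(t in `]0, +oo[) (t `^ (x - 1) * expR (- t)).

End GammaFunction.

Section ComplexFunctions.
Context {R : realType}.
Implicit Types w z : R[i].

Definition cexp z : R[i] :=
  (expR (complex.Re z) * cos (complex.Im z)) +i*
  (expR (complex.Re z) * sin (complex.Im z)).

(* Principal argument, in ]-pi, pi] for w != 0. *)
Definition carg w : R :=
  let a := acos (complex.Re w / Normc.normc w) in
  if 0 <= complex.Im w then a else - a.

Definition clog w : R[i] := ln (Normc.normc w) +i* carg w.

Definition cpow (s : R) w : R[i] := cexp (s%:C * clog w).

(* The plane cut along ]-oo, 0], where the principal branches are analytic. *)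
Definition slit_plane : set R[i] :=
  [set w | ~ (complex.Im w = 0 /\ complex.Re w <= 0)].

End ComplexFunctions.

Section ContourIntegrals.
Context {R : realType}.
Implicit Types (g : R -> R[i]) (f : R[i] -> R[i]) (D : set R[i]).

Definition re_path g : R -> R := fun t => complex.Re (g t).
Definition im_path g : R -> R := fun t => complex.Im (g t).

Definition C1_path g : Prop :=
  [/\ forall t, derivable (re_path g) t 1,
      forall t, derivable (im_path g) t 1,
      continuous (derive1 (re_path g)) &
      continuous (derive1 (im_path g))].

(* Paths are parametrized by [0, 1]; on each piece, being C1 up to the ends is
   expressed by agreeing with a path that is C1 on the whole line. *)
Definition piecewise_C1 g : Prop :=
  exists (n : nat) (s : nat -> R) (q : nat -> R -> R[i]),
    [/\ s 0%N = 0, s n = 1 &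
        forall k, (k < n)%N ->
          [/\ s k < s k.+1, C1_path (q k) &
              forall t, s k <= t <= s k.+1 -> g t = q k t]].

Definition simple_closed_path g : Prop :=
  [/\ piecewise_C1 g, g 0 = g 1 &
      forall t u, 0 <= t < 1 -> 0 <= u < 1 -> g t = g u -> t = u].

Definition contour_integral g f : R[i] :=
  let F t := f (g t) *
    (derive1 (re_path g) t +i* derive1 (im_path g) t) in
  (\int[lebesgue_measure]_(t in `[0, 1]) complex.Re (F t)) +i*
  (\int[lebesgue_measure]_(t in `[0, 1]) complex.Im (F t)).

Definition two_pi_i : R[i] := 0 +i* (2 * pi).

Definition on_path g z : Prop := exists2 t, 0 <= t <= 1 & g t = z.

(* Index of z with respect to the closed path g, for z not on the path. For a
   simple closed path it is 0 outside, and 1 inside if the path is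
   counterclockwise. *)
Definition winding g z : R[i] :=
  contour_integral g (fun w => (w - z)^-1) / two_pi_i.

Definition encloses g z : Prop := ~ on_path g z /\ winding g z = 1.

(* The path and its interior lie in D. *)
Definition path_inside D g : Prop :=
  forall z, ~ D z -> ~ on_path g z /\ winding g z = 0.

End ContourIntegrals.

Section FunctionalCalculus.
Context {R : realType} {p : nat}.
Implicit Types (A M : 'M[R[i]]_p) (g : R -> R[i]) (h : R[i] -> R[i]).

Definition admissible_contour (D : set R[i]) A g : Prop :=
  [/\ simple_closed_path g, path_inside D g &
      forall z, eigenvalue A z -> encloses g z].

Definition contour_mx h A g : 'M[R[i]]_p :=
  \matrix_(j, k) (contour_integral g
     (fun w => h w * invmx (w%:M - A) j k) / two_pi_i).

(* For h analytic on the open set D, h(A) is the common value of contour_mx h A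
   over all admissible contours, of which there must be at least one; the
   default 0 is only taken if there is no such common value. *)
Definition matfun (D : set R[i]) h A : 'M[R[i]]_p :=
  xget 0 [set M | (exists g, admissible_contour D A g) /\
                  forall g, admissible_contour D A g -> contour_mx h A g = M].

Definition matpow (A : 'M[R]_p) (s : R) : 'M[R[i]]_p :=
  matfun slit_plane (cpow s) (map_mx (real_complex R) A).

End FunctionalCalculus.

Section PhaseTypeParameters.
Context {R : realType} {p : nat}.
Implicit Types (piv : 'rV[R]_p) (A : 'M[R]_p).

Definition probability_vector piv : Prop :=
  (forall j, 0 <= piv 0 j) /\ \sum_j piv 0 j = 1.

Definition subintensity A : Prop :=
  [/\ forall j k, j != k -> 0 <= A j k,
      forall j, A j j < 0 &
      forall j, \sum_k A j k <= 0].

Definition evec : 'cV[R]_p := const_mx 1.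

Definition exit_rates A : 'cV[R]_p := - (A *m evec).

(* The state space {1, ..., p, p + 1} is encoded as option 'I_p, with None the
   absorbing state p + 1. *)
Definition intensity A (x y : option 'I_p) : R :=
  match x, y with
  | Some j, Some k => A j k
  | Some j, None => exit_rates A j 0
  | None, _ => 0
  end.

End PhaseTypeParameters.

Section JumpProcesses.
Context {R : realType} {S : finType}.

Definition transition_function (Q : R -> S -> S -> R) : Prop :=
  [/\ forall t x y, 0 <= t -> 0 <= Q t x y,
      forall t x, 0 <= t -> \sum_y Q t x y = 1,
      forall x y, Q 0 x y = (x == y)%:R &
      forall s t x y, 0 <= s -> 0 <= t ->
        Q (s + t) x y = \sum_z Q s x z * Q t z y].

Definition has_intensities (Q : R -> S -> S -> R) (L : S -> S -> R) : Prop :=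
  forall x y, (Q h x y - (x == y)%:R) / h @[h --> 0^'+] --> L x y.

Context {dO : measure_display} {Om : measurableType dO}.
Variable P : probability Om R.
Implicit Types (J : R -> Om -> S).

(* Only the times t >= 0 matter. *)
Definition jump_paths J : Prop :=
  forall w,
    (forall t, 0 <= t -> \forall s \near t^'+, J s w = J t w) /\
    (forall t, 0 < t -> exists x, \forall s \near t^'-, J s w = x).

(* P(J_{t_{n+1}} = x_{n+1} | J_{t_0} = x_0, ..., J_{t_n} = x_n)
     = Q (t_{n+1} - t_n) x_n x_{n+1}, multiplied out so that conditioning
   events of probability zero need no separate treatment. *)
Definition markov_property J (Q : R -> S -> S -> R) : Prop :=
  forall (n : nat) (t : nat -> R) (x : nat -> S),
    0 <= t 0%N -> (forall k, (k <= n)%N -> t k < t k.+1) ->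
    fine (P [set w | forall k, (k <= n.+1)%N -> J (t k) w = x k]) =
    fine (P [set w | forall k, (k <= n)%N -> J (t k) w = x k]) *
      Q (t n.+1 - t n) (x n) (x n.+1).

Definition markov_jump_process J (L : S -> S -> R) : Prop :=
  [/\ forall t x, 0 <= t -> measurable [set w | J t w = x],
      jump_paths J &
      exists Q, [/\ transition_function Q, has_intensities Q L &
                    markov_property J Q]].

Definition process_sigma_algebra J : set (set Om) :=
  <<s [set A | exists t x, 0 <= t /\ A = [set w | J t w = x]] >>.

Definition cond_prob (A B : set Om) : R := fine (P (A `&` B)) / fine (P B).

Definition cond_independent (d : nat) (J : 'I_d -> R -> Om -> S)
    (J0 : Om -> S) : Prop :=
  forall (x : S) (A : 'I_d -> set Om),
    P [set w | J0 w = x] != 0%E ->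
    (forall i, process_sigma_algebra (J i) (A i)) ->
    cond_prob (\bigcap_i A i) [set w | J0 w = x] =
    \prod_(i < d) cond_prob (A i) [set w | J0 w = x].

End JumpProcesses.

Section MPH.
Context {R : realType} {dO : measure_display} {Om : measurableType dO}.
Context {d p : nat}.
Variable P : probability Om R.

(* As inf set0 = 0, the value is 0 when absorption never takes place. *)
Definition absorption_time (J : R -> Om -> option 'I_p) (w : Om) : R :=
  inf [set t | 0 < t /\ J t w = None].

(* All the states 1, ..., p are transient for T i iff T i is invertible. *)
Definition mPH (X : 'I_d -> Om -> R) (piv : 'rV[R]_p) (T : 'I_d -> 'M[R]_p)
    : Prop :=
  [/\ probability_vector piv,
      forall i, subintensity (T i),
      forall i, T i \in unitmx &
      exists (J0 : Om -> option 'I_p) (J : 'I_d -> R -> Om -> option 'I_p),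
        [/\ (forall x, measurable [set w | J0 w = x]) /\
              (forall j, P [set w | J0 w = Some j] = (piv 0 j)%:E),
            forall i, markov_jump_process P (J i) (intensity (T i)),
            forall i w, J i 0 w = J0 w,
            cond_independent P J J0 &
            forall i w, X i w = absorption_time (J i) w]].

End MPH.

(* Main.v *)
(** Set [A = - T i] and let [v j t = P(X i > t | J_0 = j)]. The Kolmogorov equation gives
    [v' = - A v], and [v] decreases to 0 as [T i] is invertible; integrating by parts,
    [E(X^n e^(- r X) | J_0 = j) = n! e_j^T A (A + r)^(- n - 1) e]. With [n = 0] this is the
    Laplace transform, and conditional independence turns joint expectations into mixtures of
    products (each factor is written as an integral of indicators of [Y > t]).

    For the moment of order [theta], put [a = theta + 1] and [n + 1 > a]. Then
    [X^theta Gamma(n + 1 - a) = int_0^oo r^(n - a) X^n e^(- r X) dr], so the moment is a multiple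
    of [int_0^oo r^(n - a) A (A + r)^(- n - 1) dr]. Stieltjes' formula
    [int_0^oo r^(n - a) (w + r)^(- n - 1) dr = Gamma(a) Gamma(n + 1 - a) / n! w^(- a)] on the
    cut plane, proved for [w > 0] and extended to [w e^(i phi)] by showing that
    [e^(i a phi) int_0^oo r^(n - a) (w e^(i phi) + r)^(- n - 1) dr] has derivative 0 in [phi],
    is then inserted in the contour integral defining [A^(- theta)]. After Fubini only rational
    contour integrals remain: expanding [(w - A)^(-1)] by Newton interpolation, those with all
    poles inside the contour and total degree at most -2 vanish, whence
    [int w (w + r)^(- n - 1) (w - A)^(-1) dw = 2 pi i A (A + r)^(- n - 1)]. An admissible contour
    is a large circle in the right half-plane, where the eigenvalues of [A] lie by Gershgorin. *)

Require Import Defs.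
From HB Require Import structures.
From mathcomp Require Import all_boot all_order all_algebra.
From mathcomp Require Import all_classical all_reals all_analysis.
From mathcomp Require Import complex measurable_realfun ring lra.

Set Implicit Arguments.
Unset Strict Implicit.
Unset Printing Implicit Defensive.

Import Order.TTheory GRing.Theory Num.Theory.
Import numFieldNormedType.Exports.
Local Open Scope classical_set_scope.
Local Open Scope ring_scope.
Local Open Scope complex_scope.

(** * Complex calculus along real parameters *)

(** [matfun] returns the value shared by all admissible contours, and 0 if there is none, so one
    contour must be exhibited and the integral computed for every other. No contour is deformed for
    this: an admissible contour is known only through its winding numbers, and these settle the
    integrals of rational functions. Stieltjes' formula makes the power a superposition of rational
    functions whose poles [- r] lie on the cut, hence outside the contour. The exponent [n - a]
    serves all orders at once: [r ^ (n - a)] is integrable at 0 because [n + 1 > a], and the kernel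
    decays like [r ^ (- a - 1)] because [a > 0]. For [theta] in []-1, 0]] the power [w ^ (- theta)]
    has no such representation, whence [w ^ (- theta) = w * w ^ (- a)]; the extra [w] becomes the
    factor [A] that integration by parts produces on the probabilistic side. The factor
    [e ^ (- r X)] keeps the functions of [X] bounded during integration by parts and signed Fubini;
    finiteness of the moments then comes out of Tonelli. *)

Section ComplexArith.
Context {R : realType}.
Implicit Types z w : R[i].

Lemma cReD z w : complex.Re (z + w) = complex.Re z + complex.Re w.
Proof. by case: z w => [? ?] [? ?]. Qed.
Lemma cImD z w : complex.Im (z + w) = complex.Im z + complex.Im w.
Proof. by case: z w => [? ?] [? ?]. Qed.
Lemma cReN z : complex.Re (- z) = - complex.Re z.
Proof. by case: z. Qed.
Lemma cImN z : complex.Im (- z) = - complex.Im z.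
Proof. by case: z. Qed.
Lemma cReB z w : complex.Re (z - w) = complex.Re z - complex.Re w.
Proof. by rewrite cReD cReN. Qed.
Lemma cImB z w : complex.Im (z - w) = complex.Im z - complex.Im w.
Proof. by rewrite cImD cImN. Qed.
Lemma cReM z w :
  complex.Re (z * w) = complex.Re z * complex.Re w - complex.Im z * complex.Im w.
Proof. by case: z w => [? ?] [? ?]. Qed.
Lemma cImM z w :
  complex.Im (z * w) = complex.Re z * complex.Im w + complex.Im z * complex.Re w.
Proof. by case: z w => [? ?] [? ?]. Qed.

Definition sqnorm z : R := complex.Re z ^+ 2 + complex.Im z ^+ 2.

Lemma cReV z : complex.Re z^-1 = complex.Re z / sqnorm z.
Proof. by case: z. Qed.
Lemma cImV z : complex.Im z^-1 = - complex.Im z / sqnorm z.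
Proof. by case: z => a b; rewrite mulNr. Qed.

Lemma complex_ext z w : complex.Re z = complex.Re w -> complex.Im z = complex.Im w -> z = w.
Proof. by case: z w => [? ?] [? ?] /= -> ->. Qed.

Lemma sqnorm_ge0 z : 0 <= sqnorm z.
Proof. by rewrite addr_ge0 ?sqr_ge0. Qed.

Lemma sqnorm_eq0 z : (sqnorm z == 0) = (z == 0).
Proof.
rewrite /sqnorm paddr_eq0 ?sqr_ge0// !sqrf_eq0.
by case: z => a b; rewrite eq_complex.
Qed.

Lemma sqnorm_gt0 z : (0 < sqnorm z) = (z != 0).
Proof. by rewrite lt_def sqnorm_ge0 sqnorm_eq0 andbT. Qed.

Lemma sqnormM z w : sqnorm (z * w) = sqnorm z * sqnorm w.
Proof. by rewrite /sqnorm cReM cImM; ring. Qed.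

Lemma normcE z : Normc.normc z = Num.sqrt (sqnorm z).
Proof. by case: z. Qed.

Lemma normc_ge0 z : 0 <= Normc.normc z.
Proof. by rewrite normcE sqrtr_ge0. Qed.

Lemma sqr_normc z : Normc.normc z ^+ 2 = sqnorm z.
Proof. by rewrite normcE sqr_sqrtr// sqnorm_ge0. Qed.

Lemma normc_gt0 z : (0 < Normc.normc z) = (z != 0).
Proof. by rewrite normcE sqrtr_gt0 sqnorm_gt0. Qed.

Lemma normcX z n : Normc.normc (z ^+ n) = Normc.normc z ^+ n.
Proof.
by elim: n => [|n ih]; rewrite ?expr0 ?Normc.normc1// !exprS Normc.normcM ih.
Qed.

Lemma abs_Re_le z : `|complex.Re z| <= Normc.normc z.
Proof.
rewrite normcE -sqrtr_sqr ler_sqrt ?sqnorm_ge0//.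
by rewrite lerDl sqr_ge0.
Qed.

Lemma abs_Im_le z : `|complex.Im z| <= Normc.normc z.
Proof.
rewrite normcE -sqrtr_sqr ler_sqrt ?sqnorm_ge0//.
by rewrite lerDr sqr_ge0.
Qed.

Lemma RecM (a : R) z : complex.Re (a%:C * z) = a * complex.Re z.
Proof. by rewrite cReM /= mul0r subr0. Qed.
Lemma ImcM (a : R) z : complex.Im (a%:C * z) = a * complex.Im z.
Proof. by rewrite cImM /= mul0r addr0. Qed.

Lemma cRe_sum (I : Type) (r : seq I) (F : I -> R[i]) :
  complex.Re (\sum_(i <- r) F i) = \sum_(i <- r) complex.Re (F i).
Proof. by elim/big_ind2: _ => // x1 x2 y1 y2 <- <-; rewrite cReD. Qed.
Lemma cIm_sum (I : Type) (r : seq I) (F : I -> R[i]) :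
  complex.Im (\sum_(i <- r) F i) = \sum_(i <- r) complex.Im (F i).
Proof. by elim/big_ind2: _ => // x1 x2 y1 y2 <- <-; rewrite cImD. Qed.

End ComplexArith.

Section ComplexContinuity.
Context {R : realType} {T : topologicalType}.
Implicit Types (f g : T -> R[i]) (t : T).

Lemma cont_add (f g : T -> R) t : continuous_at t f -> continuous_at t g ->
  continuous_at t (fun x => f x + g x).
Proof. exact: continuousD. Qed.
Lemma cont_mul (f g : T -> R) t : continuous_at t f -> continuous_at t g ->
  continuous_at t (fun x => f x * g x).
Proof. exact: continuousM. Qed.
Lemma cont_opp (f : T -> R) t : continuous_at t f -> continuous_at t (fun x => - f x).
Proof. exact: continuousN. Qed.
Lemma cont_inv (f : T -> R) t : f t != 0 -> continuous_at t f ->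
  continuous_at t (fun x => (f x)^-1).
Proof. exact: continuousV. Qed.

(** Integrals along paths are pairs of real integrals, so continuity is only needed coordinate by
    coordinate; no topology on [R[i]] enters. *)
Definition ccont f t : Prop :=
  continuous_at t (fun x => complex.Re (f x) : R) /\
  continuous_at t (fun x => complex.Im (f x) : R).

Lemma ccont_cst c t : ccont (fun=> c) t.
Proof. by split; apply: cst_continuous. Qed.

Lemma ccontD f g t : ccont f t -> ccont g t -> ccont (fun x => f x + g x) t.
Proof.
move=> [f1 f2] [g1 g2]; split.
- by under eq_fun do rewrite cReD; apply: cont_add.
- by under eq_fun do rewrite cImD; apply: cont_add.
Qed.

Lemma ccontN f t : ccont f t -> ccont (fun x => - f x) t.
Proof.
move=> [f1 f2]; split.
- by under eq_fun do rewrite cReN; apply: cont_opp.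
- by under eq_fun do rewrite cImN; apply: cont_opp.
Qed.

Lemma ccontB f g t : ccont f t -> ccont g t -> ccont (fun x => f x - g x) t.
Proof. by move=> cf cg; apply: ccontD => //; apply: ccontN. Qed.

Lemma ccontM f g t : ccont f t -> ccont g t -> ccont (fun x => f x * g x) t.
Proof.
move=> [f1 f2] [g1 g2]; split.
- under eq_fun do rewrite cReM.
  by apply: cont_add; [|apply: cont_opp]; apply: cont_mul.
- under eq_fun do rewrite cImM.
  by apply: cont_add; apply: cont_mul.
Qed.

Lemma ccontX f n t : ccont f t -> ccont (fun x => f x ^+ n) t.
Proof.
move=> cf; elim: n => [|n ih]; first exact: ccont_cst.
by under eq_fun do rewrite exprS; apply: ccontM.
Qed.

Lemma continuous_sqnorm f t :
  ccont f t -> continuous_at t (fun x => sqnorm (f x)).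
Proof.
move=> [f1 f2]; rewrite /sqnorm.
by under eq_fun do rewrite !expr2; apply: cont_add; apply: cont_mul.
Qed.

Lemma ccontV f t : ccont f t -> f t != 0 -> ccont (fun x => (f x)^-1) t.
Proof.
move=> cf ft0; have n0 : sqnorm (f t) != 0 by rewrite sqnorm_eq0.
have cn := cont_inv n0 (continuous_sqnorm cf).
case: cf => [f1 f2]; split.
- by under eq_fun do rewrite cReV; apply: cont_mul.
- under eq_fun do rewrite cImV.
  by apply: cont_mul => //; apply: cont_opp.
Qed.

Lemma ccont_real (f : T -> R) t : continuous_at t f -> ccont (fun x => (f x)%:C) t.
Proof. by move=> cf; split => //; apply: cst_continuous. Qed.

Lemma ccont_sum (I : Type) (r : seq I) (F : I -> T -> R[i]) t :
  (forall i, ccont (F i) t) -> ccont (fun x => \sum_(i <- r) F i x) t.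
Proof.
move=> cF; elim: r => [|i r ih].
  by under eq_fun do rewrite big_nil; apply: ccont_cst.
by under eq_fun do rewrite big_cons; apply: ccontD.
Qed.

Lemma continuous_normc f t :
  ccont f t -> continuous_at t (fun x => Normc.normc (f x)).
Proof.
move=> cf; under eq_fun do rewrite normcE.
apply: continuous_comp; first exact: continuous_sqnorm.
exact: sqrt_continuous.
Qed.

End ComplexContinuity.

Section ComplexDerivative.
Context {R : realType}.
Implicit Types (f g : R -> R[i]) (t : R).

Lemma der_eq (f : R -> R) (t a b : R) : is_derive t 1 f a -> a = b -> is_derive t 1 f b.
Proof. by move=> ? <-. Qed.
Lemma der_add (f g : R -> R) t a b : is_derive t 1 f a -> is_derive t 1 g b ->
  is_derive t 1 (fun x => f x + g x) (a + b).
Proof. exact: is_deriveD. Qed.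
Lemma der_opp (f : R -> R) t a : is_derive t 1 f a ->
  is_derive t 1 (fun x => - f x) (- a).
Proof. exact: is_deriveN. Qed.
Lemma der_mul (f g : R -> R) t a b : is_derive t 1 f a -> is_derive t 1 g b ->
  is_derive t 1 (fun x => f x * g x) (a * g t + f t * b).
Proof.
move=> df dg; have -> : a * g t + f t * b = f t *: (b : R^o) + g t *: (a : R^o).
  by rewrite /GRing.scale/= addrC [g t * a]mulrC.
exact: (is_deriveM df dg).
Qed.
Lemma der_inv (f : R -> R) t a : f t != 0 -> is_derive t 1 f a ->
  is_derive t 1 (fun x => (f x)^-1) (- a / f t ^+ 2).
Proof.
move=> ft0 df; have -> : - a / f t ^+ 2 = - f t ^- 2 *: (a : R^o).
  by rewrite /GRing.scale/= !mulNr mulrC.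
exact: (is_deriveV ft0 df).
Qed.

(** All differentiation is along a real parameter: a primitive on a piece of contour is a primitive
    in the parameter, so complex differentiability never enters. *)
Definition cder f t (l : R[i]) : Prop :=
  is_derive t 1 (fun x => complex.Re (f x)) (complex.Re l) /\
  is_derive t 1 (fun x => complex.Im (f x)) (complex.Im l).

Lemma cder_cst c t : cder (fun=> c) t 0.
Proof. by split; apply: is_derive_cst. Qed.

Lemma cder_real (f : R -> R) t l : is_derive t 1 f l -> cder (fun x => (f x)%:C) t l%:C.
Proof. by move=> df; split => //; apply: is_derive_cst. Qed.

Lemma cderD f g t l m : cder f t l -> cder g t m -> cder (fun x => f x + g x) t (l + m).
Proof.
move=> [f1 f2] [g1 g2]; split.
- rewrite cReD; under eq_fun do rewrite cReD; exact: der_add.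
- rewrite cImD; under eq_fun do rewrite cImD; exact: der_add.
Qed.

Lemma cderN f t l : cder f t l -> cder (fun x => - f x) t (- l).
Proof.
move=> [f1 f2]; split.
- rewrite cReN; under eq_fun do rewrite cReN; exact: der_opp.
- rewrite cImN; under eq_fun do rewrite cImN; exact: der_opp.
Qed.

Lemma cderB f g t l m : cder f t l -> cder g t m -> cder (fun x => f x - g x) t (l - m).
Proof. by move=> df dg; apply: cderD => //; apply: cderN. Qed.

Lemma cderM f g t l m :
  cder f t l -> cder g t m -> cder (fun x => f x * g x) t (l * g t + f t * m).
Proof.
move=> [f1 f2] [g1 g2]; split.
- under eq_fun do rewrite cReM.
  apply: (der_eq (der_add (der_mul f1 g1) (der_opp (der_mul f2 g2)))).
  by rewrite cReD !cReM /GRing.scale/=; ring.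
- under eq_fun do rewrite cImM.
  apply: (der_eq (der_add (der_mul f1 g2) (der_mul f2 g1))).
  by rewrite cImD !cImM /GRing.scale/=; ring.
Qed.

Lemma cder_eq f t l m : cder f t l -> l = m -> cder f t m.
Proof. by move=> ? <-. Qed.

Lemma cderX f n t l : cder f t l ->
  cder (fun x => f x ^+ n.+1) t (n.+1%:R * f t ^+ n * l).
Proof.
move=> df; elim: n => [|n ih].
  by rewrite expr0 mul1r mul1r; under eq_fun do rewrite expr1.
under eq_fun do rewrite exprS.
apply: cder_eq; first exact: cderM df ih.
by rewrite -(natr1 n.+1) !exprS; ring.
Qed.

Lemma cder_sqnorm f t l : cder f t l ->
  is_derive t 1 (fun x => sqnorm (f x))
    (2 * (complex.Re (f t) * complex.Re l + complex.Im (f t) * complex.Im l)).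
Proof.
move=> [f1 f2]; rewrite /sqnorm; under eq_fun do rewrite !expr2.
apply: (der_eq (der_add (der_mul f1 f1) (der_mul f2 f2))).
by rewrite /GRing.scale/=; ring.
Qed.

Lemma cderV f t l : cder f t l -> f t != 0 ->
  cder (fun x => (f x)^-1) t (- l / f t ^+ 2).
Proof.
move=> df ft0; have n0 : sqnorm (f t) != 0 by rewrite sqnorm_eq0.
have dn := @der_inv (fun x => sqnorm (f x)) _ _ n0 (cder_sqnorm df).
case: df => [f1 f2]; split.
- under eq_fun do rewrite cReV.
  apply: (der_eq (der_mul f1 dn)).
  rewrite cReM cReN cImN cReV cImV expr2 sqnormM cReM cImM /GRing.scale/=.
  by move: n0; rewrite /sqnorm => n0; field; exact: n0.
- under eq_fun do rewrite cImV.
  apply: (der_eq (der_mul (der_opp f2) dn)).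
  rewrite cImM cReN cImN cReV cImV expr2 sqnormM cReM cImM /GRing.scale/=.
  by move: n0; rewrite /sqnorm => n0; field; exact: n0.
Qed.

Lemma cder_ccont f t l : cder f t l -> ccont f t.
Proof.
move=> [f1 f2]; split.
- by apply: differentiable_continuous; apply/derivable1_diffP; apply: ex_derive.
- by apply: differentiable_continuous; apply/derivable1_diffP; apply: ex_derive.
Qed.

End ComplexDerivative.

(** * The fundamental theorem of calculus on segments and on the half-line *)

Section RealIntegrals.
Context {R : realType}.
Notation mu := (@lebesgue_measure R).
Notation Rp := (`]0, +oo[%classic : set R).

Lemma integrable_setU d (T : measurableType d) (nu : {measure set T -> \bar R})
    (A B : set T) (f : T -> \bar R) :
  measurable A -> measurable B -> [disjoint A & B] ->
  nu.-integrable A f -> nu.-integrable B f -> nu.-integrable (A `|` B) f.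
Proof.
move=> mA mB AB /integrableP[mfA ifA] /integrableP[mfB ifB].
have mf : measurable_fun (A `|` B) f by apply/measurable_funU.
apply/integrableP; split => //.
rewrite ge0_integral_setU//; first by rewrite lte_add_pinfty.
exact: measurableT_comp.
Qed.

Lemma cont_within (f : R -> R) (D : set R) :
  (forall x, D x -> continuous_at x f) -> {within D, continuous f}.
Proof.
by move=> cf; apply: continuous_in_subspaceT => x /set_mem; apply: cf.
Qed.

Lemma cont_integrable (f : R -> R) (a b : R) :
  (forall x, a <= x <= b -> continuous_at x f) ->
  mu.-integrable `[a, b] (EFin \o f).
Proof.
move=> cf; apply: continuous_compact_integrable; first exact: segment_compact.
by apply: cont_within => x /=; rewrite in_itv/=; apply: cf.
Qed.

Lemma integrable_cc_oo (f : R -> R) (a b : R) :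
  mu.-integrable `[a, b] (EFin \o f) -> mu.-integrable `]a, b[ (EFin \o f).
Proof.
by apply: integrableS => //; apply: subset_itv_oo_cc.
Qed.

Lemma integrable_oo_cc (f : R -> R) (a b : R) : a < b ->
  mu.-integrable `]a, b[ (EFin \o f) -> mu.-integrable `[a, b] (EFin \o f).
Proof.
move=> ab /integrableP[/measurable_EFinP mf].
have mf' := measurable_fun_itv_cc mf.
have me : measurable_fun `]a, b[ (fun x => `|(EFin \o f) x|)%E.
  by apply: measurableT_comp => //; apply/measurable_EFinP.
rewrite -(integral_itv_bndoo true false me) => fi.
by apply/integrableP; split => //; apply/measurable_EFinP.
Qed.

Lemma integrable_cc_of_eq (f g : R -> R) (a b : R) : a < b ->
  (forall x, a < x < b -> f x = g x) -> mu.-integrable `[a, b] (EFin \o g) ->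
  mu.-integrable `[a, b] (EFin \o f).
Proof.
move=> ab fg /integrable_cc_oo ig; apply: integrable_oo_cc => //.
apply: eq_integrable ig => // x /set_mem/=; rewrite in_itv/= => xab.
by rewrite fg.
Qed.

Lemma Rintegral_cc_eq (f g : R -> R) (a b : R) : a < b ->
  (forall x, a < x < b -> f x = g x) -> mu.-integrable `[a, b] (EFin \o g) ->
  \int[mu]_(x in `[a, b]) f x = \int[mu]_(x in `[a, b]) g x.
Proof.
move=> ab fg ig; rewrite /Rintegral; congr fine.
apply: eq_integral_itv_bounded => [||x].
- have /measurable_int/measurable_EFinP := integrable_cc_oo (integrable_cc_of_eq ab fg ig).
  exact.
- by have /measurable_int/measurable_EFinP := integrable_cc_oo ig.
- by rewrite in_itv/=; apply: fg.
Qed.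

Lemma FTC_cc (F f : R -> R) (a b : R) : a < b ->
  (forall x, a <= x <= b -> is_derive x 1 F (f x)) ->
  (forall x, a <= x <= b -> continuous_at x f) ->
  \int[mu]_(x in `[a, b]) f x = F b - F a.
Proof.
move=> ab dF cf.
have cF x : a <= x <= b -> continuous_at x F.
  move=> xab; apply: differentiable_continuous; apply/derivable1_diffP.
  by have := dF x xab => -[].
rewrite /Rintegral (@continuous_FTC2 _ f F)//.
- by apply: cont_within => x /=; rewrite in_itv/=; apply: cf.
- split => [x||].
  + by rewrite in_itv/= => /andP[ax xb]; have [] := dF x; rewrite ?(ltW ax) ?(ltW xb).
  + by apply/cvg_at_right_filter; apply: cF; rewrite lexx ltW.
  + by apply/cvg_at_left_filter; apply: cF; rewrite lexx ltW.
- move=> x; rewrite in_itv/= => /andP[ax xb]; rewrite derive1E.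
  by have [] := dF x; rewrite ?(ltW ax) ?(ltW xb).
Qed.

(** Agreement is only asked on the open pieces: at the breakpoints of a piecewise C1 path the
    derivative has arbitrary values, which a null set absorbs. *)
Lemma Rintegral_pieces (H : R -> R) (Hk : nat -> R -> R) (s : nat -> R) (n : nat) :
  (forall k, (k < n)%N -> s k < s k.+1) ->
  (forall k, (k < n)%N -> mu.-integrable `[s k, s k.+1] (EFin \o Hk k)) ->
  (forall k t, (k < n)%N -> s k < t < s k.+1 -> H t = Hk k t) ->
  \int[mu]_(x in `[s 0%N, s n]) H x =
    \sum_(k < n) \int[mu]_(x in `[s k, s k.+1]) Hk k x.
Proof.
move=> ss iH eH.
(* Integrability of [H] on the union so far is carried along, since additivity over the next piece
   requires it. *)
suff H0 m : (m <= n)%N -> [/\ s 0%N <= s m,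
    mu.-integrable `[s 0%N, s m] (EFin \o H) &
  \int[mu]_(x in `[s 0%N, s m]) H x =
    \sum_(k < m) \int[mu]_(x in `[s k, s k.+1]) Hk k x].
  by have [] := H0 n (leqnn n).
elim: m => [|m ih] mn.
  split => //; rewrite set_itv1; last by rewrite Rintegral_set1 big_ord0.
  by apply/integrableP; split; [exact: measurable_fun_set1|rewrite integral_set1].
have [s0m i1 e1] := ih (ltnW mn).
have sm : s m < s m.+1 by apply: ss.
have i2' : mu.-integrable `[s m, s m.+1] (EFin \o Hk m).
  exact: iH.
have e : forall x, s m < x < s m.+1 -> H x = Hk m x by move=> x; apply: eH.
have i2 : mu.-integrable `[s m, s m.+1] (EFin \o H) by exact: integrable_cc_of_eq i2'.
have i3 : mu.-integrable `]s m, s m.+1] (EFin \o H).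
  by apply: integrableS i2 => // y /=; rewrite !in_itv/= => /andP[ya ->]; rewrite ltW.
have dj : [disjoint `[s 0%N, s m] & `]s m, s m.+1]].
  by apply/disj_setPS => y [/=]; rewrite 2!in_itv/= => /andP[_ yx] /andP[/(le_lt_trans yx)]; rewrite ltxx.
have eU : `[s 0%N, s m.+1]%classic = `[s 0%N, s m] `|` `]s m, s m.+1].
  by apply: itv_bndbnd_setU; rewrite bnd_simp // ltW.
have i4 : mu.-integrable `[s 0%N, s m.+1] (EFin \o H).
  by rewrite eU; apply: integrable_setU.
split => //; first by rewrite (le_trans s0m)// ltW.
rewrite big_ord_recr/= -e1 eU Rintegral_setU// -?eU//.
by rewrite Rintegral_itv_obnd_cbnd// (Rintegral_cc_eq sm e).
Qed.

(** A compact exhaustion of the open half-line; the shift by 2 keeps even the first segment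
    nondegenerate, as [FTC_cc] asks. *)
Let seg n : set R := `[n.+2%:R^-1, n.+2%:R].

Let seg_lt n : n.+2%:R^-1 < n.+2%:R :> R.
Proof.
by rewrite (@lt_trans _ _ 1)// ?ltr1n// invf_lt1// ltr1n.
Qed.

Let seg_pos n : seg n `<=` `]0, +oo[.
Proof.
move=> x; rewrite /seg/= !in_itv/= andbT => /andP[+ _].
by apply: lt_le_trans; rewrite invr_gt0.
Qed.

Let seg_homo m n : (m <= n)%N -> seg m `<=` seg n.
Proof.
move=> mn x; rewrite /seg/= !in_itv/= => /andP[a b]; apply/andP; split.
  by rewrite (le_trans _ a)// lef_pV2 ?posrE// ler_nat.
by rewrite (le_trans b)// ler_nat.
Qed.

Let seg_mem (x : R) : 0 < x -> exists m, forall n, (m <= n)%N -> seg n x.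
Proof.
move=> x0; exists (Num.bound (x + x^-1)) => n mn.
have xp : 0 < x^-1 by rewrite invr_gt0.
have h : x + x^-1 <= n.+2%:R.
  have /ltW h := archi_boundP (ltW (addr_gt0 x0 xp)).
  by rewrite (le_trans h)// ler_nat (leq_trans mn)// ltnW.
rewrite /seg/= in_itv/=; apply/andP; split.
  rewrite -[leRHS]invrK lef_pV2 ?posrE// (le_trans _ h)// lerDr ltW//.
by rewrite (le_trans _ h)// lerDl ltW.
Qed.

Let ms n : measurable (seg n). Proof. exact: measurable_itv. Qed.

Let cvg_seg_r (F : R -> R) (l : R) : F x @[x --> +oo] --> l -> F n.+2%:R @[n --> \oo] --> l.
Proof.
move=> /cvg_pinftyP; apply.
apply/cvgryPge => A; near=> n.
have : n.+2%:R >= n%:R :> R by rewrite ler_nat ltnW.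
by apply: le_trans; near: n; exact: nbhs_infty_ger.
Unshelve. all: by end_near. Qed.

Let cvg_seg_l (F : R -> R) (l : R) : F x @[x --> 0^'+] --> l -> F n.+2%:R^-1 @[n --> \oo] --> l.
Proof.
move=> /cvg_at_rightP; apply; split => [n|]; first by rewrite invr_gt0.
apply/cvgrPdist_lt => e e0; near=> n.
rewrite sub0r normrN ger0_norm ?invr_ge0//.
rewrite -[ltRHS]invrK ltf_pV2 ?posrE ?invr_gt0//.
have : n.+2%:R > n%:R :> R by rewrite ltr_nat.
by apply: le_lt_trans; near: n; exact: nbhs_infty_ger.
Unshelve. all: by end_near. Qed.

Let cvg_restrict_seg (f : R -> R) (x : R) : 0 < x ->
  (f \_ (seg n)) x @[n --> \oo] --> f x.
Proof.
move=> x0; have [m xm] := seg_mem x0.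
apply: cvg_near_cst; exists m => // n /= mn.
by rewrite patchE mem_set//; apply: xm.
Qed.

Section improper.
Variables (F f : R -> R) (a b : R).
Hypothesis dF : forall x : R, 0 < x -> is_derive x 1 F (f x).
Hypothesis cf : forall x : R, 0 < x -> continuous_at x f.
Hypothesis Fa : F x @[x --> 0^'+] --> a.
Hypothesis Fb : F x @[x --> +oo] --> b.

Let seg_gt0 n (x : R) : n.+2%:R^-1 <= x <= n.+2%:R -> 0 < x.
Proof.
by move=> xn; have := @seg_pos n x; rewrite /seg/= !in_itv/= andbT; apply.
Qed.

Let mf : measurable_fun Rp f.
Proof.
apply: open_continuous_measurable_fun; first exact: interval_open.
by move=> x /set_mem/=; rewrite in_itv/= andbT; apply: cf.
Qed.

Let int_seg n : mu.-integrable (seg n) (EFin \o f).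
Proof. by apply: cont_integrable => x xn; apply: cf; apply: seg_gt0 xn. Qed.

Let FTC_seg n : \int[mu]_(x in seg n) f x = F n.+2%:R - F n.+2%:R^-1.
Proof. by apply: FTC_cc => // x /seg_gt0; [exact: dF|exact: cf]. Qed.

Let cvgF : F n.+2%:R - F n.+2%:R^-1 @[n --> \oo] --> b - a.
Proof. by apply: cvgB; [exact: cvg_seg_r|exact: cvg_seg_l]. Qed.

Let mseg n : measurable_fun Rp (EFin \o f \_ (seg n)).
Proof.
apply/measurable_EFinP; apply/measurable_restrict => //.
by apply: (measurable_funS _ _ mf) => //; apply: subIsetl.
Qed.

Let intE n : (\int[mu]_(x in Rp) ((f \_ (seg n)) x)%:E
   = (F n.+2%:R - F n.+2%:R^-1)%:E)%E.
Proof.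
rewrite -FTC_seg /Rintegral fineK; last first.
  by apply: integrable_fin_num; [exact: ms|exact: int_seg].
transitivity (\int[mu]_(x in Rp) ((EFin \o f) \_ (seg n)) x)%E.
  by rewrite restrict_EFin.
by rewrite -integral_mkcondr setIidr//; exact: seg_pos.
Qed.

Lemma FTC_0y_integrable : mu.-integrable Rp (EFin \o f) ->
  \int[mu]_(x in Rp) f x = b - a.
Proof.
move=> fi.
have h1 : {ae mu, forall x, Rp x ->
    (EFin \o f \_ (seg n)) x @[n --> \oo] --> (EFin \o f) x}.
  apply/aeW => x /=; rewrite in_itv/= andbT => x0.
  by apply: cvg_EFin; [exact: nearW|exact: cvg_restrict_seg].
have h2 : {ae mu, forall x n, Rp x ->
    (`|(EFin \o f \_ (seg n)) x| <= (abse \o (EFin \o f)) x)%E}.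
  by apply/aeW => x n _; rewrite /= lee_fin patchE; case: ifP => _ //; rewrite normr0.
have [_ _ h] := @dominated_convergence _ _ _ mu Rp (measurable_itv _)
  (fun n => EFin \o f \_ (seg n)) (EFin \o f) _ mseg
  (measurable_int _ fi) h1 (integrable_abse fi) h2.
have {}h : (F n.+2%:R - F n.+2%:R^-1)%:E @[n --> \oo] -->
    (\int[mu]_(x in Rp) (f x)%:E)%E.
  by move: h; rewrite [X in X @ _ --> _](_ : _ = fun n => (F n.+2%:R - F n.+2%:R^-1)%:E)//;
    apply/funext => n; rewrite -intE.
have /cvg_unique := h; move=> /(_ _ (b - a)%:E).
rewrite /Rintegral => -> //.
by apply: cvg_EFin; [exact: nearW|exact: cvgF].
Qed.

(** Monotone convergence takes the place of dominated convergence: integrability is a conclusion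
    here, which is how the Gamma integrand gets an integrable majorant. *)
Lemma FTC_0y_ge0 : (forall x : R, 0 < x -> 0 <= f x) ->
  (\int[mu]_(x in Rp) (f x)%:E = (b - a)%:E)%E.
Proof.
move=> f0.
have h0 n x : Rp x -> (0 <= (EFin \o f \_ (seg n)) x)%E.
  rewrite /= in_itv/= andbT => x0; rewrite lee_fin patchE.
  by case: ifP => // _; apply: f0.
have h1 x : Rp x -> {homo (fun n => (EFin \o f \_ (seg n)) x) : m n / (m <= n)%N >-> (m <= n)%E}.
  rewrite /= in_itv/= andbT => x0 m n mn; rewrite lee_fin !patchE.
  case: ifPn => [/set_mem xm|_]; first by rewrite mem_set//; apply: seg_homo xm.
  by case: ifP => // _; apply: f0.
have h := @cvg_monotone_convergence _ _ _ mu Rp (measurable_itv _)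
  (fun n => EFin \o f \_ (seg n)) mseg h0 h1.
have e : (\int[mu]_(x in Rp) (limn (fun n => (EFin \o f \_ (seg n)) x)) =
  \int[mu]_(x in Rp) (f x)%:E)%E.
  apply: eq_integral => x; rewrite inE/= in_itv/= andbT => x0.
  by apply/cvg_lim => //; apply: cvg_EFin; [exact: nearW|exact: cvg_restrict_seg].
have {}h : (F n.+2%:R - F n.+2%:R^-1)%:E @[n --> \oo] -->
    (\int[mu]_(x in Rp) (f x)%:E)%E.
  by rewrite -e; under eq_fun do rewrite -intE; exact: h.
apply: (cvg_unique _ h) => //.
by apply: cvg_EFin; [exact: nearW|exact: cvgF].
Qed.

End improper.

End RealIntegrals.

Section ComplexIntegral.
Context d (T : measurableType d) (R : realType) (mu : {measure set T -> \bar R}).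
Implicit Types (D : set T) (f g : T -> R[i]).

Definition cintegrable D f : Prop :=
  mu.-integrable D (EFin \o (fun x => complex.Re (f x))) /\
  mu.-integrable D (EFin \o (fun x => complex.Im (f x))).

Definition cint D f : R[i] :=
  (\int[mu]_(x in D) complex.Re (f x)) +i* (\int[mu]_(x in D) complex.Im (f x)).

Lemma eq_cint D f g : (forall x, D x -> f x = g x) -> cint D f = cint D g.
Proof.
by move=> fg; congr Complex; apply: eq_Rintegral => x /set_mem Dx; rewrite fg.
Qed.

Lemma eq_cintegrable D f g : measurable D -> (forall x, D x -> f x = g x) ->
  cintegrable D f -> cintegrable D g.
Proof.
move=> mD fg [f1 f2]; split.
- by apply: eq_integrable f1 => // x /set_mem Dx; rewrite /= fg.
- by apply: eq_integrable f2 => // x /set_mem Dx; rewrite /= fg.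
Qed.

Section linear.
Variables (D : set T) (mD : measurable D).

Let intD (u v : T -> R) : mu.-integrable D (EFin \o u) -> mu.-integrable D (EFin \o v) ->
  mu.-integrable D (EFin \o (fun x => u x + v x)).
Proof. by move=> iu iv; exact: (integrableD mD iu iv). Qed.

Let intZ (a : R) (u : T -> R) : mu.-integrable D (EFin \o u) ->
  mu.-integrable D (EFin \o (fun x => a * u x)).
Proof. by move=> iu; exact: (integrableZl mD a iu). Qed.

Lemma cintegrableD f g : cintegrable D f -> cintegrable D g ->
  cintegrable D (fun x => f x + g x).
Proof.
move=> [f1 f2] [g1 g2]; split.
- by under eq_fun do rewrite cReD; exact: intD.
- by under eq_fun do rewrite cImD; exact: intD.
Qed.

Lemma cintD f g : cintegrable D f -> cintegrable D g ->
  cint D (fun x => f x + g x) = cint D f + cint D g.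
Proof.
move=> [f1 f2] [g1 g2]; apply: complex_ext; rewrite ?cReD ?cImD /=.
- by rewrite -RintegralD//; apply: eq_Rintegral => x _; rewrite cReD.
- by rewrite -RintegralD//; apply: eq_Rintegral => x _; rewrite cImD.
Qed.

Lemma cintegrableZ (c : R[i]) f : cintegrable D f -> cintegrable D (fun x => c * f x).
Proof.
move=> [f1 f2]; split.
- under eq_fun do rewrite cReM -mulNr.
  by apply: intD; apply: intZ.
- under eq_fun do rewrite cImM.
  by apply: intD; apply: intZ.
Qed.

Lemma cintZ (c : R[i]) f : cintegrable D f -> cint D (fun x => c * f x) = c * cint D f.
Proof.
move=> [f1 f2]; apply: complex_ext; rewrite ?cReM ?cImM /=.
- rewrite -mulNr -!RintegralZl// -RintegralD//; try exact: intZ.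
  by apply: eq_Rintegral => x _; rewrite cReM mulNr.
- rewrite -!RintegralZl// -RintegralD//; try exact: intZ.
  by apply: eq_Rintegral => x _; rewrite cImM.
Qed.

Lemma cintegrable_sum (I : Type) (r : seq I) (F : I -> T -> R[i]) :
  (forall i, cintegrable D (F i)) -> cintegrable D (fun x => \sum_(i <- r) F i x).
Proof.
move=> iF; elim: r => [|i r ih].
  under eq_fun do rewrite big_nil.
  by split; rewrite (_ : EFin \o _ = cst 0%E)//; apply: integrable0.
by under eq_fun do rewrite big_cons; apply: cintegrableD.
Qed.

Lemma cint0 : cint D (fun=> 0) = 0.
Proof. by congr Complex => /=; rewrite /Rintegral integral0. Qed.

Lemma cint_sum (I : Type) (r : seq I) (F : I -> T -> R[i]) :
  (forall i, cintegrable D (F i)) ->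
  cint D (fun x => \sum_(i <- r) F i x) = \sum_(i <- r) cint D (F i).
Proof.
move=> iF; elim: r => [|i r ih].
  rewrite big_nil; transitivity (cint D (fun=> 0)); last exact: cint0.
  by apply: eq_cint => x _; rewrite big_nil.
rewrite big_cons -ih -cintD//; last exact: cintegrable_sum.
by apply: eq_cint => x _; rewrite big_cons.
Qed.

End linear.
End ComplexIntegral.

(** * Contour integrals of rational functions *)

Section ContourTheory.
Context {R : realType}.
Notation mu := (@lebesgue_measure R).
Implicit Types (g : R -> R[i]) (f : R[i] -> R[i]).

Lemma ccont_integrable (f : R -> R[i]) (a b : R) :
  (forall t, a <= t <= b -> ccont f t) -> cintegrable mu `[a, b] f.
Proof.
by move=> cf; split; apply: cont_integrable => t /cf [].
Qed.

Lemma cFTC (F f : R -> R[i]) (a b : R) : a < b ->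
  (forall t, a <= t <= b -> cder F t (f t)) ->
  (forall t, a <= t <= b -> ccont f t) ->
  cint mu `[a, b] f = F b - F a.
Proof.
move=> ab dF cf; apply: complex_ext; rewrite ?cReB ?cImB /=.
- by apply: (FTC_cc (F := fun x => complex.Re (F x))) => // t tab;
    [have [] := dF t tab|have [] := cf t tab].
- by apply: (FTC_cc (F := fun x => complex.Im (F x))) => // t tab;
    [have [] := dF t tab|have [] := cf t tab].
Qed.

Definition dpath (q : R -> R[i]) (t : R) : R[i] := derive1 (re_path q) t +i* derive1 (im_path q) t.

Lemma C1_cder (q : R -> R[i]) t : C1_path q -> cder q t (dpath q t).
Proof.
by move=> [d1 d2 _ _]; split => /=; rewrite derive1E; apply: derivableP.
Qed.

Lemma C1_ccont (q : R -> R[i]) t : C1_path q -> ccont (dpath q) t.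
Proof. by move=> [_ _ c1 c2]; split; [exact: c1|exact: c2]. Qed.

Lemma C1_cont (q : R -> R[i]) t : C1_path q -> ccont q t.
Proof. by move=> qC; apply: cder_ccont (C1_cder t qC). Qed.

Record decomposition g (n : nat) (s : nat -> R) (q : nat -> R -> R[i]) : Prop := {
  decomp0 : s 0%N = 0;
  decomp1 : s n = 1;
  decomp_lt : forall k, (k < n)%N -> s k < s k.+1;
  decomp_C1 : forall k, (k < n)%N -> C1_path (q k);
  decompE : forall k t, (k < n)%N -> s k <= t <= s k.+1 -> g t = q k t }.

Lemma piecewise_decomposition g : piecewise_C1 g ->
  exists n s q, decomposition g n s q.
Proof.
move=> [n [s [q [s0 s1 h]]]]; exists n, s, q; split => //.
- by move=> k /h[].
- by move=> k /h[].
- by move=> k t /h[_ _]; apply.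
Qed.

Section pieces.
Variables (g : R -> R[i]) (n : nat) (s : nat -> R) (q : nat -> R -> R[i]).
Hypothesis dec : decomposition g n s q.

Lemma decomp_itv k t : (k < n)%N -> s k <= t <= s k.+1 -> 0 <= t <= 1.
Proof.
have hom i j : (i <= j)%N -> (j <= n)%N -> s i <= s j.
  elim: j => [|j ih]; first by rewrite leqn0 => /eqP->.
  rewrite leq_eqVlt => /predU1P[-> //|ij] jn.
  by rewrite (le_trans (ih _ (ltnW jn)))// ltW// (decomp_lt dec).
move=> kn /andP[a b]; rewrite -(decomp0 dec) -(decomp1 dec).
by rewrite (le_trans (hom 0%N k _ _) a)// ?(ltnW kn)// (le_trans b)// hom.
Qed.

Lemma decomp_on_path k t : (k < n)%N -> s k <= t <= s k.+1 -> on_path g (q k t).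
Proof.
move=> kn tk; exists t; first exact: decomp_itv tk.
exact: (decompE dec).
Qed.

Definition path_cont f := forall k t, (k < n)%N -> s k <= t <= s k.+1 ->
  ccont (fun t => f (q k t)) t.

Definition path_integrable f := forall k, (k < n)%N ->
  cintegrable mu `[s k, s k.+1] (fun t => f (q k t) * dpath (q k) t).

Lemma path_cont_integrable f : path_cont f -> path_integrable f.
Proof.
move=> cf k kn; apply: ccont_integrable => t tk.
apply: ccontM; first exact: cf.
by apply: C1_ccont; apply: (decomp_C1 dec).
Qed.

Lemma dpath_decomp k t : (k < n)%N -> s k < t < s k.+1 -> dpath g t = dpath (q k) t.
Proof.
move=> kn tk.
have e : \forall x \near t, g x = q k x.
  have /near_in_itvoo : t \in `]s k, s k.+1[ by rewrite in_itv.
  apply: filterS => x; rewrite in_itv/= => /andP[a b].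
  by apply: (decompE dec) => //; rewrite !ltW.
rewrite /dpath !derive1E; congr Complex; apply: near_eq_derive.
- by apply: filterS e => x; rewrite /re_path => ->.
- by apply: filterS e => x; rewrite /im_path => ->.
Qed.

Lemma contour_sum f : path_integrable f -> contour_integral g f =
  \sum_(k < n) cint mu `[s k, s k.+1] (fun t => f (q k t) * dpath (q k) t).
Proof.
move=> fi.
have pieces (pr : R[i] -> R) :
    (forall k, (k < n)%N -> mu.-integrable `[s k, s k.+1]
       (EFin \o (fun t => pr (f (q k t) * dpath (q k) t)))) ->
    \int[mu]_(t in `[0, 1]) pr (f (g t) * dpath g t) = \sum_(k < n)
      \int[mu]_(t in `[s k, s k.+1]) pr (f (q k t) * dpath (q k) t).
  move=> pi; have := @Rintegral_pieces R (fun t => pr (f (g t) * dpath g t))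
    (fun k t => pr (f (q k t) * dpath (q k) t)) s n.
  rewrite (decomp0 dec) (decomp1 dec); apply => //; first exact: decomp_lt dec.
  move=> k t kn tk; rewrite (dpath_decomp kn tk) (decompE dec kn)//.
  by case/andP: tk => a b; rewrite !ltW.
apply: complex_ext; rewrite ?cRe_sum ?cIm_sum.
- by apply: (pieces (@complex.Re R)) => k /fi[].
- by apply: (pieces (@complex.Im R)) => k /fi[].
Qed.

Lemma path_integrableD f h : path_integrable f -> path_integrable h ->
  path_integrable (fun w => f w + h w).
Proof.
move=> fi hi k kn.
apply: eq_cintegrable (cintegrableD _ (fi k kn) (hi k kn)) => // t _.
by rewrite mulrDl.
Qed.

Lemma path_integrableZ (c : R[i]) f : path_integrable f ->
  path_integrable (fun w => c * f w).
Proof.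
move=> fi k kn.
by apply: eq_cintegrable (cintegrableZ _ c (fi k kn)) => // t _; rewrite mulrA.
Qed.

Lemma path_integrable_sum (I : Type) (r : seq I) (F : I -> R[i] -> R[i]) :
  (forall i, path_integrable (F i)) -> path_integrable (fun w => \sum_(i <- r) F i w).
Proof.
move=> iF k kn.
apply: eq_cintegrable (@cintegrable_sum _ _ _ mu _ _ I r
  (fun i t => F i (q k t) * dpath (q k) t) _) => //; last by move=> i; exact: iF.
by move=> t _; rewrite mulr_suml.
Qed.

Lemma contourD f h : path_integrable f -> path_integrable h ->
  contour_integral g (fun w => f w + h w) = contour_integral g f + contour_integral g h.
Proof.
move=> fi hi; rewrite !contour_sum//; last exact: path_integrableD.
rewrite -big_split; apply: eq_bigr => k _ /=.
rewrite -cintD//; [|exact: fi|exact: hi].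
by apply: eq_cint => t _; rewrite mulrDl.
Qed.

Lemma contourZ (c : R[i]) f : path_integrable f ->
  contour_integral g (fun w => c * f w) = c * contour_integral g f.
Proof.
move=> fi; rewrite !contour_sum//; last exact: path_integrableZ.
rewrite mulr_sumr; apply: eq_bigr => k _ /=.
rewrite -cintZ//; last exact: fi.
by apply: eq_cint => t _; rewrite mulrA.
Qed.

Lemma contour_bigsum (I : Type) (r : seq I) (F : I -> R[i] -> R[i]) :
  (forall i, path_integrable (F i)) ->
  contour_integral g (fun w => \sum_(i <- r) F i w) =
  \sum_(i <- r) contour_integral g (F i).
Proof.
move=> iF; rewrite contour_sum; last exact: path_integrable_sum.
transitivity (\sum_(i <- r) \sum_(k < n)
    cint mu `[s k, s k.+1] (fun t => F i (q k t) * dpath (q k) t)).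
  rewrite exchange_big/=; apply: eq_bigr => k _.
  rewrite -cint_sum//; last by move=> i; exact: iF.
  by apply: eq_cint => t _; rewrite mulr_suml.
by apply: eq_bigr => i _; rewrite contour_sum.
Qed.

Lemma eq_contour f h : (forall z, on_path g z -> f z = h z) ->
  contour_integral g f = contour_integral g h.
Proof.
move=> fh; apply: complex_ext => /=; apply: eq_Rintegral => t /set_mem/=;
  rewrite in_itv/= => tk; rewrite fh//; by exists t.
Qed.

Lemma eq_path_cont f h : (forall z, f z = h z) -> path_cont f -> path_cont h.
Proof. by move=> /funext->. Qed.

(** The primitive only has to exist along the pieces, so its domain is irrelevant; the boundary
    terms telescope and cancel because the path is closed. *)
Lemma contour_primitive (F f : R[i] -> R[i]) : path_cont f ->
  (forall k t, (k < n)%N -> s k <= t <= s k.+1 ->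
    cder (fun t => F (q k t)) t (f (q k t) * dpath (q k) t)) ->
  g 0 = g 1 -> contour_integral g f = 0.
Proof.
move=> cf dF g01; rewrite contour_sum; last exact: path_cont_integrable.
transitivity (\sum_(k < n) (F (g (s k.+1)) - F (g (s k)))).
  apply: eq_bigr => -[k kn] _ /=; rewrite (@cFTC (fun t => F (q k t))).
  - have skk : s k <= s k.+1 by rewrite ltW// (decomp_lt dec).
    by rewrite !(decompE dec kn)// lexx skk.
  - exact: (decomp_lt dec).
  - by move=> t; apply: dF.
  - move=> t tk; apply: ccontM; first exact: cf.
    by apply: C1_ccont; apply: (decomp_C1 dec).
rewrite -(big_mkord predT (fun k => F (g (s k.+1)) - F (g (s k)))) telescope_sumr//.
by rewrite (decomp0 dec) (decomp1 dec) g01 subrr.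
Qed.

Lemma path_contM f h : path_cont f -> path_cont h -> path_cont (fun w => f w * h w).
Proof. by move=> cf ch k t kn tk; apply: ccontM; [exact: cf|exact: ch]. Qed.

Lemma path_contX f m : path_cont f -> path_cont (fun w => f w ^+ m).
Proof. by move=> cf k t kn tk; apply: ccontX; exact: cf. Qed.

Lemma path_cont_cst (c : R[i]) : path_cont (fun=> c).
Proof. by move=> k t kn tk; apply: ccont_cst. Qed.

Lemma path_cont_id : path_cont id.
Proof. by move=> k t kn tk; apply: C1_cont; apply: (decomp_C1 dec). Qed.

Lemma path_contB f h : path_cont f -> path_cont h -> path_cont (fun w => f w - h w).
Proof. by move=> cf ch k t kn tk; apply: ccontB; [exact: cf|exact: ch]. Qed.

Lemma path_contV z : ~ on_path g z -> path_cont (fun w => (w - z)^-1).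
Proof.
move=> gz k t kn tk; apply: ccontV.
  exact: (@path_contB id (fun=> z) path_cont_id (@path_cont_cst z) k t kn tk).
by rewrite subr_eq0; apply/eqP => e; apply: gz; rewrite -e; apply: decomp_on_path.
Qed.

(* Higher order poles have a single-valued primitive. *)
Lemma contour_pole z m : ~ on_path g z -> g 0 = g 1 ->
  contour_integral g (fun w => (w - z)^-1 ^+ m.+2) = 0.
Proof.
move=> gz g01.
apply: (@contour_primitive (fun w => - m.+1%:R^-1 * (w - z)^-1 ^+ m.+1)) => //.
  by apply: path_contX; apply: path_contV.
move=> k t kn tk.
have qz : q k t - z != 0.
  by rewrite subr_eq0; apply/eqP => e; apply: gz; rewrite -e; apply: decomp_on_path.
have dq : cder (fun t => q k t - z) t (dpath (q k) t).
  rewrite -[dpath _ _]subr0; apply: cderB; last exact: cder_cst.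
  by apply: C1_cder; apply: (decomp_C1 dec).
apply: (cder_eq (cderM (cder_cst _ _) (cderX m (cderV dq qz)))).
have m0 : (m.+1%:R : R[i]) != 0 by rewrite pnatr_eq0.
rewrite mul0r add0r !exprS.
by field; rewrite qz addrC natr1 m0.
Qed.

End pieces.
End ContourTheory.

Section RationalContours.
Context {R : realType}.
Variables (g : R -> R[i]) (n : nat) (s : nat -> R) (q : nat -> R -> R[i]).
Hypothesis dec : decomposition g n s q.
Hypothesis g01 : g 0 = g 1.

(** This is [two_pi_i] times the winding number. *)
Definition pole_int z : R[i] := contour_integral g (fun w => (w - z)^-1).

Definition poles (zs : seq R[i]) (w : R[i]) : R[i] := \prod_(z <- zs) (w - z)^-1.

Lemma path_cont_poles zs : (forall z, z \in zs -> ~ on_path g z) ->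
  path_cont n s q (poles zs).
Proof.
elim: zs => [|z zs ih] gz.
  apply: (@eq_path_cont _ _ _ _ (fun=> 1)); last exact: path_cont_cst.
  by move=> w; rewrite /poles big_nil.
apply: (@eq_path_cont _ _ _ _ (fun w => (w - z)^-1 * poles zs w)).
  by move=> w; rewrite /poles big_cons.
apply: path_contM; last by apply: ih => x xz; apply: gz; rewrite inE xz orbT.
by apply: (path_contV dec); apply: gz; rewrite inE eqxx.
Qed.

Lemma poles_perm zs ys : perm_eq zs ys -> poles zs = poles ys.
Proof. by move=> zy; apply/funext => w; apply: perm_big. Qed.

(** Partial fractions replace residues. If all the poles coincide, the integrand is a pole of higher
    order. Otherwise two distinct poles [x] and [y] are split by [1 / ((w - x) (w - y)) = (1 / (w -
    x) - 1 / (w - y)) / (x - y)], which lowers the degree by one. *)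
Lemma contour_poles0 c zs : (forall z, z \in zs -> ~ on_path g z /\ pole_int z = c) ->
  (1 < size zs)%N -> contour_integral g (poles zs) = 0.
Proof.
have [m] := ubnP (size zs); elim: m zs => // m ih [//|x zs] /= szs gz s1.
have [/allP alx|/allPn[y yzs yx]] := boolP (all (pred1 x) zs).
  have -> : poles (x :: zs) = (fun w => (w - x)^-1 ^+ (size zs).-1.+2).
    apply/funext => w; rewrite prednK// exprS /poles big_cons; congr (_ * _).
    rewrite big_seq (eq_bigr (fun=> (w - x)^-1)); last by move=> z /alx /eqP ->.
    by rewrite -big_seq big_const_seq count_predT iter_mulr_1.
  apply: (contour_pole dec) => //.
  by have [] := gz x; rewrite ?inE ?eqxx.
have py := perm_to_rem yzs.
have gy z : z \in y :: rem y zs -> ~ on_path g z /\ pole_int z = c.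
  by rewrite -(perm_mem py) => h; apply: gz; rewrite inE h orbT.
have [gx Wx] : ~ on_path g x /\ pole_int x = c by apply: gz; rewrite inE eqxx.
have [gy0 Wy] : ~ on_path g y /\ pole_int y = c by apply: gy; rewrite inE eqxx.
set r := rem y zs in py gy *.
have -> : poles (x :: zs) = poles [:: x, y & r].
  by apply: poles_perm; rewrite perm_cons.
have xy : x - y != 0 by rewrite subr_eq0 eq_sym.
have cx : path_cont n s q (poles (x :: r)).
  apply: path_cont_poles => z; rewrite inE => /predU1P[->//|zr].
  by have [] := gy z; rewrite // inE zr orbT.
have cy : path_cont n s q (poles (y :: r)).
  by apply: path_cont_poles => z /gy[].
have -> : contour_integral g (poles [:: x, y & r]) =
    contour_integral g (fun w => (x - y)^-1 * poles (x :: r) w +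
                                 (- (x - y)^-1) * poles (y :: r) w).
  apply: eq_contour => w gw; rewrite /poles !big_cons.
  have wx : w - x != 0 by rewrite subr_eq0; apply/eqP => e; apply: gx; rewrite -e.
  have wy : w - y != 0 by rewrite subr_eq0; apply/eqP => e; apply: gy0; rewrite -e.
  by field; rewrite wx wy xy.
rewrite (contourD dec); do ?[by apply: path_integrableZ; apply: (path_cont_integrable dec)].
rewrite !(contourZ dec); do ?[by apply: (path_cont_integrable dec)].
(* In degree 2 two simple poles are left, and their contributions cancel because the path winds
   equally around both; this is where the common value [c] enters. *)
case: (posnP (size r)) => [/size0nil r0|r0].
  rewrite r0 mulNr -mulrBr.
  have W1 z : contour_integral g (poles [:: z]) = pole_int z.
    by apply: eq_contour => w _; rewrite /poles big_seq1.
  by rewrite !W1 Wx Wy subrr mulr0.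
have sr : (size r < m)%N /\ ((size r).+1 < m)%N.
  have := perm_size py; rewrite /= => e; move: szs; rewrite e !ltnS => h.
  by split => //; apply: ltnW.
rewrite !ih ?mulr0 ?addr0//.
- by move: sr => [].
- by case: sr.
- by move=> z; rewrite inE => /predU1P[->//|zr]; apply: gy; rewrite inE zr orbT.
Qed.

Section resolvent.
Variables (p : nat) (A : 'M[R[i]]_p.+1) (rs : seq R[i]).
Hypothesis charA : char_poly A = \prod_(z <- rs) ('X - z%:P).
Hypothesis in_path : forall z, z \in rs -> ~ on_path g z /\ pole_int z = two_pi_i.

Definition newton_poly l : {poly R[i]} := \prod_(z <- take l rs) ('X - z%:P).

(* Newton interpolation of w |-> (w - A)^-1 at the eigenvalues. *)
Definition resolvent w : 'M[R[i]]_p.+1 :=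
  \sum_(l < size rs) poles (take l.+1 rs) w *: horner_mx A (newton_poly l).

Lemma size_roots : size rs = p.+1.
Proof.
have := size_char_poly A; rewrite charA size_prod_XsubC => /eqP.
by rewrite eqSS => /eqP.
Qed.

Let newtonS l : (l < size rs)%N ->
  newton_poly l.+1 = newton_poly l * ('X - (nth 0 rs l)%:P).
Proof. by move=> lr; rewrite /newton_poly (take_nth 0)// -cats1 big_cat big_seq1. Qed.

Let polesS w l : (l < size rs)%N ->
  poles (take l.+1 rs) w = poles (take l rs) w * (w - nth 0 rs l)^-1.
Proof. by move=> lr; rewrite /poles (take_nth 0)// -cats1 big_cat big_seq1. Qed.

(** Multiplying by [w - A] makes the Newton sum telescope: with [u l] the product of the first [l]
    poles and of [newton_poly l] at [A], each term becomes [u l - u l.+1]. The sum starts at 1 and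
    ends at the characteristic polynomial at [A], which is 0 by Cayley-Hamilton. *)
Lemma resolvent_mul w : w \notin rs -> (w%:M - A) * resolvent w = 1.
Proof.
move=> wrs; rewrite /resolvent mulr_sumr.
pose u l := poles (take l rs) w *: horner_mx A (newton_poly l).
transitivity (\sum_(l < size rs) (u l - u l.+1)).
  apply: eq_bigr => -[l lr] _ /=; rewrite /u newtonS// polesS//.
  set z := nth 0 rs l; set N := newton_poly l; set P := poles _ w.
  have wz : w - z != 0.
    by rewrite subr_eq0; apply: contraNneq wrs => ->; exact: mem_nth.
  have E : (w%:M - A) * horner_mx A N = horner_mx A ((w%:P - 'X) * N).
    by rewrite rmorphM rmorphB /= horner_mx_X horner_mx_C.
  rewrite -scalerAr E.
  have -> : (w%:P - 'X) * N = (w - z) *: N - N * ('X - z%:P).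
    by rewrite -mul_polyC polyCB; ring.
  rewrite rmorphB/= linearZ/= scalerBr scalerA; congr (_ *: _ - _).
  by rewrite -mulrA mulVf// mulr1.
rewrite -(big_mkord predT (fun l => u l - u l.+1)) -[LHS]opprK -sumrN.
under eq_bigr do rewrite opprB.
rewrite telescope_sumr// opprB /u take0 take_size.
rewrite /newton_poly take_size take0 -charA Cayley_Hamilton scaler0 subr0.
by rewrite /poles !big_nil rmorph1 scale1r.
Qed.

Lemma on_path_notin w : on_path g w -> w \notin rs.
Proof. by move=> gw; apply/negP => /in_path[]. Qed.

Lemma invmx_resolvent w : on_path g w -> invmx (w%:M - A) = resolvent w.
Proof.
move=> /on_path_notin/resolvent_mul h.
have hu : (w%:M - A) \in unitmx by case: (mulmx1_unit h).
by rewrite -[RHS]mul1mx -(mulVmx hu) -mulmxA [X in _ *m X]h mulmx1.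
Qed.

Let in_take l z : z \in take l rs -> ~ on_path g z /\ pole_int z = two_pi_i.
Proof. by move=> /mem_take; exact: in_path. Qed.

Lemma resolventE w j k : resolvent w j k =
  \sum_(l < size rs) horner_mx A (newton_poly l) j k * poles (take l.+1 rs) w.
Proof. by rewrite summxE; apply: eq_bigr => l _; rewrite mxE mulrC. Qed.

Lemma path_cont_resolvent j k : path_cont n s q (fun w => resolvent w j k).
Proof.
move=> m t mn tk.
have -> : (fun t => resolvent (q m t) j k) = (fun t => \sum_(l < size rs)
    horner_mx A (newton_poly l) j k * poles (take l.+1 rs) (q m t)).
  by apply/funext => x; rewrite resolventE.
apply: ccont_sum => l; apply: ccontM; first exact: ccont_cst.
by apply: (@path_cont_poles (take l.+1 rs)) tk => // z /in_take[].
Qed.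

(** Only the Newton term of index 0 has a single pole, and it contributes [two_pi_i]; all the others
    have at least two poles, all inside, and vanish by [contour_poles0]. *)
Lemma contour_resolvent j k :
  contour_integral g (fun w => resolvent w j k) = two_pi_i * (1 : 'M[R[i]]_p.+1) j k.
Proof.
transitivity (contour_integral g (fun w => \sum_(l < size rs)
    horner_mx A (newton_poly l) j k * poles (take l.+1 rs) w)).
  by apply: eq_contour => w _; rewrite resolventE.
have ci l : path_integrable n s q (poles (take l rs)).
  by apply: (path_cont_integrable dec); apply: path_cont_poles => z /in_take[].
rewrite (contour_bigsum dec); last by move=> l; apply: path_integrableZ.
rewrite size_roots big_ord_recl big1 ?addr0 => [|l _]; last first.
  rewrite (contourZ dec)// (@contour_poles0 two_pi_i) ?mulr0//; first exact: in_take.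
  by rewrite size_takel ?size_roots//= ltnS ltn_ord.
rewrite (contourZ dec)// /newton_poly take0 big_nil rmorph1 mulrC; congr (_ * _).
case: rs size_roots in_path => [//|z r] _ ip.
rewrite /= take0.
have [_ <-] := ip z (mem_head _ _).
by apply: eq_contour => w _; rewrite /poles big_seq1.
Qed.

Variables (b : R[i]) (B : 'M[R[i]]_p.+1).
Hypothesis gb : ~ on_path g b /\ pole_int b = 0.
Hypothesis AB : B * (A - b%:M) = 1.

Let polb m : path_cont n s q (fun w => (w - b)^-1 ^+ m).
Proof. by apply: path_contX; apply: (path_contV dec); case: gb. Qed.

Let polb0 m : contour_integral g (fun w => (w - b)^-1 ^+ m.+1) = 0.
Proof.
case: m => [|m]; last by apply: (contour_pole dec) => //; case: gb.
by have [_ <-] := gb; apply: eq_contour => w _; rewrite expr1.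
Qed.

Let polbR m j k : path_integrable n s q (fun w => (w - b)^-1 ^+ m * resolvent w j k).
Proof.
by apply: (path_cont_integrable dec); apply: path_contM => //; exact: path_cont_resolvent.
Qed.

(** As [A - b = (w - b) - (w - A)], the resolvent [W] satisfies [W / (w - b) = B (W - 1 / (w - b))].
    Each factor [1 / (w - b)] thus becomes a factor [B], up to a pure power of [1 / (w - b)], which
    integrates to 0 because [b] is outside. *)
Lemma contour_pole_resolvent m j k :
  contour_integral g (fun w => (w - b)^-1 ^+ m * resolvent w j k) =
  two_pi_i * (B ^+ m) j k.
Proof.
elim: m j k => [|m ih] j k.
  by rewrite -contour_resolvent; apply: eq_contour => w _; rewrite mul1r.
transitivity (contour_integral g (fun w => \sum_(l < p.+1)
   (B j l * ((w - b)^-1 ^+ m * resolvent w l k) +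
    (- (B j l * (1 : 'M[R[i]]_p.+1) l k)) * (w - b)^-1 ^+ m.+1))).
  apply: eq_contour => w gw.
  have wb : w - b != 0.
    by rewrite subr_eq0; apply/eqP => e; case: gb => + _; rewrite -e.
  have e : (w - b)^-1 *: resolvent w = B * (resolvent w - (w - b)^-1 *: 1).
    have e2 : (A - b%:M) * resolvent w = (w - b) *: resolvent w - 1.
      rewrite -(resolvent_mul (on_path_notin gw)) -mul_scalar_mx.
      have -> : A - b%:M = (w - b)%:M - (w%:M - A).
        by apply/matrixP => x y; rewrite !mxE mulrnBl; ring.
      by rewrite [LHS]mulrBl.
    move: (resolvent w) e2 => W e2.
    have e3 : W = B * ((w - b) *: W - 1) by rewrite -e2 mulrA AB mul1r.
    rewrite [in LHS]e3 scalerAr; congr (B * _).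
    by rewrite scalerBr scalerA mulVf// scale1r.
  have := congr1 (fun M : 'M[R[i]]_p.+1 => (w - b)^-1 ^+ m * M j k) e.
  rewrite [X in _ * X = _]mxE mulrA -exprSr => ->; rewrite [X in _ * X]mxE mulr_sumr; apply: eq_bigr => l _.
  by rewrite !mxE exprS; ring.
have polZ l : path_integrable n s q (fun w => B j l * ((w - b)^-1 ^+ m * resolvent w l k)).
  exact: path_integrableZ.
have polZ' c : path_integrable n s q (fun w => c * (w - b)^-1 ^+ m.+1).
  by apply: path_integrableZ; exact: (path_cont_integrable dec).
rewrite (contour_bigsum dec); last by move=> l; apply: path_integrableD.
rewrite exprS !mxE mulr_sumr; apply: eq_bigr => l _.
rewrite (contourD dec)// !(contourZ dec)//; last exact: (path_cont_integrable dec).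
by rewrite ih polb0 mulr0 addr0; ring.
Qed.

(** From [w W = A W + 1] for the resolvent [W]. The exponent is [m.+1] so that the summand 1 meets
    at least one pole at [b] and integrates to 0. *)
Lemma contour_id_pole_resolvent m j k :
  contour_integral g (fun w => w * (w - b)^-1 ^+ m.+1 * resolvent w j k) =
  two_pi_i * (A * B ^+ m.+1) j k.
Proof.
transitivity (contour_integral g (fun w => \sum_(l < p.+1)
   (A j l * ((w - b)^-1 ^+ m.+1 * resolvent w l k)) +
    ((1 : 'M[R[i]]_p.+1) j k) * (w - b)^-1 ^+ m.+1)).
  apply: eq_contour => w gw.
  have e : w *: resolvent w = A * resolvent w + 1.
    have := resolvent_mul (on_path_notin gw).
    move: (resolvent w) => W <-.
    by rewrite mulrBl addrC subrK -mul_scalar_mx.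
  have := congr1 (fun M : 'M[R[i]]_p.+1 => M j k) e.
  rewrite [LHS]mxE [RHS]mxE [X in X + _]mxE mulrAC => ->.
  rewrite mulrDl mulr_suml; congr (_ + _).
  by apply: eq_bigr => l _; ring.
have polZ l : path_integrable n s q (fun w => A j l * ((w - b)^-1 ^+ m.+1 * resolvent w l k)).
  exact: path_integrableZ.
have polZ' c : path_integrable n s q (fun w => c * (w - b)^-1 ^+ m.+1).
  by apply: path_integrableZ; exact: (path_cont_integrable dec).
rewrite (contourD dec)//; last by apply: path_integrable_sum.
rewrite (contour_bigsum dec)// (contourZ dec); last exact: (path_cont_integrable dec).
rewrite polb0 mulr0 addr0 mxE mulr_sumr; apply: eq_bigr => l _.
by rewrite (contourZ dec)// contour_pole_resolvent; ring.
Qed.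

End resolvent.
End RationalContours.

(** * Stieltjes' formula on the cut plane *)

Section FubiniOnRectangles.
Context d1 d2 (T1 : measurableType d1) (T2 : measurableType d2) (R : realType).
Variable m1 : {sigma_finite_measure set T1 -> \bar R}.
Variable m2 : {sigma_finite_measure set T2 -> \bar R}.
Variables (D1 : set T1) (D2 : set T2).
Hypotheses (mD1 : measurable D1) (mD2 : measurable D2).

(** Extension by zero reduces the statements on a rectangle to Fubini and Tonelli on the whole
    product. *)
Let patchX (f : T1 * T2 -> \bar R) := f \_ (D1 `*` D2).

Let iterated12 f : (\int[m1]_(x in D1) \int[m2]_(y in D2) f (x, y) =
  \int[m1]_x \int[m2]_y patchX f (x, y))%E.
Proof.
rewrite [LHS]integral_mkcond; apply: eq_integral => x _; rewrite patchE.
case: ifPn => [/set_mem D1x|/negP D1x]; last first.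
  rewrite integral0_eq// => y _; rewrite /patchX patchE.
  by case: ifPn => // /set_mem[/= /mem_set D1x']; move: D1x; rewrite D1x'.
rewrite integral_mkcond; apply: eq_integral => y _; rewrite /patchX !patchE.
case: ifPn => [/set_mem D2y|/negP D2y]; first by rewrite mem_set.
by case: ifPn => // /set_mem[_ /= /mem_set D2y']; move: D2y; rewrite D2y'.
Qed.

Let iterated21 f : (\int[m2]_(y in D2) \int[m1]_(x in D1) f (x, y) =
  \int[m2]_y \int[m1]_x patchX f (x, y))%E.
Proof.
rewrite [LHS]integral_mkcond; apply: eq_integral => y _; rewrite patchE.
case: ifPn => [/set_mem D2y|/negP D2y]; last first.
  rewrite integral0_eq// => x _; rewrite /patchX patchE.
  by case: ifPn => // /set_mem[_ /= /mem_set D2y']; move: D2y; rewrite D2y'.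
rewrite integral_mkcond; apply: eq_integral => x _; rewrite /patchX !patchE.
case: ifPn => [/set_mem D1x|/negP D1x]; first by rewrite mem_set.
by case: ifPn => // /set_mem[/= /mem_set D1x']; move: D1x; rewrite D1x'.
Qed.

Let mpatchX f : measurable_fun setT f -> measurable_fun setT (patchX f).
Proof.
move=> mf; apply/(measurable_restrictT _ (measurableX mD1 mD2)).
exact: measurable_funTS.
Qed.

Lemma tonelli_on (f : T1 * T2 -> \bar R) : measurable_fun setT f ->
  (forall x y, D1 x -> D2 y -> (0 <= f (x, y))%E) ->
  (\int[m1]_(x in D1) \int[m2]_(y in D2) f (x, y) =
   \int[m2]_(y in D2) \int[m1]_(x in D1) f (x, y))%E.
Proof.
move=> mf f0; rewrite iterated12 iterated21; apply: fubini_tonelli.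
  exact: mpatchX.
move=> [x y]; rewrite /patchX patchE; case: ifPn => // /set_mem[/= D1x D2y].
exact: f0.
Qed.

Variable f : T1 * T2 -> R.
Hypothesis mf : measurable_fun setT f.
Hypothesis f1 : forall x, D1 x -> m2.-integrable D2 (fun y => (f (x, y))%:E).
Hypothesis f2 : forall y, D2 y -> m1.-integrable D1 (fun x => (f (x, y))%:E).
Hypothesis f12 : (\int[m1]_(x in D1) \int[m2]_(y in D2) `|f (x, y)|%:E < +oo)%E.

Let F := patchX (EFin \o f).

Let iF : (m1 \x m2)%E.-integrable setT F.
Proof.
have mF : measurable_fun setT F by apply: mpatchX; apply/measurable_EFinP.
apply/(integrable12ltyP _ _ mF).
rewrite [ltLHS](_ : _ = \int[m1]_x \int[m2]_y patchX (fun z => `|f z|%:E) (x, y))%E.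
  by rewrite -iterated12.
apply: eq_integral => x _; apply: eq_integral => y _; rewrite /F /patchX !patchE.
by case: ifPn => //= _; rewrite normr0.
Qed.

Lemma fubini_on_integrable :
  m1.-integrable D1 (fun x => (\int[m2]_(y in D2) f (x, y))%:E).
Proof.
have := integrable_fubini_F iF.
move/(integrableS measurableT mD1 (@subsetT _ _)); apply: eq_integrable => //.
move=> x /set_mem D1x; rewrite /fubini_F /Rintegral fineK; last first.
  by apply: integrable_fin_num => //; exact: f1.
rewrite [RHS]integral_mkcond; apply: eq_integral => y _; rewrite /F /patchX !patchE.
case: ifPn => [/set_mem[_ /= D2y]|/negP h]; first by rewrite mem_set.
by case: ifPn => // /set_mem D2y; case: h; rewrite mem_set.
Qed.

Lemma fubini_on :
  \int[m1]_(x in D1) (\int[m2]_(y in D2) f (x, y)) =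
  \int[m2]_(y in D2) (\int[m1]_(x in D1) f (x, y)).
Proof.
rewrite /Rintegral; congr fine.
transitivity (\int[m1]_(x in D1) \int[m2]_(y in D2) (f (x, y))%:E)%E.
  apply: eq_integral => x /set_mem D1x; rewrite fineK//.
  by apply: integrable_fin_num => //; exact: f1.
transitivity (\int[m2]_(y in D2) \int[m1]_(x in D1) (f (x, y))%:E)%E; last first.
  apply: eq_integral => y /set_mem D2y; rewrite fineK//.
  by apply: integrable_fin_num => //; exact: f2.
rewrite (iterated12 (EFin \o f)) (iterated21 (EFin \o f)).
exact: Fubini.
Qed.

End FubiniOnRectangles.

Section Scaling.
Context {R : realType}.
Notation mu := (@lebesgue_measure R).
Notation Rp := (`]0, +oo[%classic : set R).

(** The image of Lebesgue measure under multiplication by [r], rescaled by [r], agrees with it on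
    the intervals []a, b]], hence equals it. *)
Lemma lebesgue_scale (r : R) (f : R -> \bar R) : 0 < r ->
  measurable_fun setT f -> (forall x, 0 <= f x)%E ->
  (\int[mu]_x f x = r%:E * \int[mu]_x f (r * x)%R)%E.
Proof.
move=> r0 mf f0.
pose phi (x : measurableTypeR R) : measurableTypeR R := r * x.
have mr : measurable_fun setT phi by exact: measurable_funM.
pose k : {nonneg R} := NngNum (ltW r0).
pose nu : {measure set (measurableTypeR R) -> \bar R} := mscale k
  (measure_function_pushforward__canonical__measure_function_Measure mu mr).
transitivity (\int[nu]_x f x)%E; last first.
  by rewrite ge0_integral_mscale// ge0_integral_pushforward.
refine (@eq_measure_integral _ (measurableTypeR R) R setT nu mu f _) => A mA _.
apply: (@lebesgue_measure_unique _ nu) => //.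
move=> _ [[a b] /= ab <-].
rewrite /nu /mscale/= /pushforward.
have -> : phi @^-1` `]a, b] = `]a / r, b / r]%classic.
  apply/seteqP; split => x /=; rewrite !in_itv/= ltr_pdivrMr// ler_pdivlMr// mulrC//.
rewrite !lebesgue_measure_itv/= !lte_fin ltr_pM2r ?invr_gt0//.
case: ifPn => _; last by rewrite mule0.
by rewrite -!EFinB -EFinM; congr EFin; field; rewrite gt_eqF.
Qed.

Lemma lebesgue_scale_pos (r : R) (f : R -> R) : 0 < r ->
  measurable_fun setT f -> (forall x, 0 < x -> 0 <= f x) ->
  (\int[mu]_(x in Rp) (f x)%:E = r%:E * \int[mu]_(x in Rp) (f (r * x)%R)%:E)%E.
Proof.
move=> r0 mf f0; rewrite [LHS]integral_mkcond [in RHS]integral_mkcond.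
rewrite (lebesgue_scale r0).
- congr (_ * _)%E; apply: eq_integral => x _; rewrite !patchE.
  have e : (r * x \in Rp) = (x \in Rp).
    by apply/idP/idP => /set_mem; rewrite /= in_itv/= andbT => h; apply/mem_set;
      rewrite /= in_itv/= andbT ?pmulr_rgt0// in h *.
  by rewrite e.
- have mEf : measurable_fun setT (EFin \o f) by apply/measurable_EFinP.
  have mRp : measurable Rp by exact: measurable_itv.
  by apply/(measurable_restrictT _ mRp); exact: measurable_funTS.
- move=> x; rewrite patchE; case: ifPn => // /set_mem.
  by rewrite /= in_itv/= andbT lee_fin; apply: f0.
Qed.

End Scaling.

(** * The Gamma function and Stieltjes' formula on the positive axis *)

Section GammaTheory.
Context {R : realType}.
Notation mu := (@lebesgue_measure R).
Notation Rp := (`]0, +oo[%classic : set R).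
Implicit Types (b c r t x : R) (n : nat).

Lemma Rp_gt0 x : Rp x = (0 < x) :> Prop.
Proof. by rewrite /= in_itv/= andbT. Qed.

Lemma measurable_Rp : measurable (Rp : set (measurableTypeR R)).
Proof. exact: measurable_itv. Qed.

(** For an integer [m] at least [c] and at least 1, [1 + t <= m (1 + t / m) <= m e ^ (t / m)];
    raising to the power [m] gives the constant [m ^ m]. *)
Lemma pow_exp_bound c : exists2 C, 0 < C &
  forall t, 0 <= t -> (1 + t) `^ c * expR (- t) <= C.
Proof.
pose m := (Num.bound `|c|).+1.
have cm : c <= m%:R.
  have := archi_boundP (normr_ge0 c); rewrite /m => /ltW h.
  by rewrite (le_trans (ler_norm c))// (le_trans h)// ler_nat.
have m0 : 0 < m%:R :> R by rewrite ltr0n.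
exists (m%:R ^+ m); first exact: exprn_gt0.
move=> t t0; rewrite expRN ler_pdivrMr ?expR_gt0//.
have t1 : 1 <= 1 + t by rewrite lerDl.
rewrite (le_trans (ler_powR t1 cm))// powR_mulrn ?addr_ge0//.
have -> : m%:R ^+ m * expR t = (m%:R * expR (t / m%:R)) ^+ m.
  by rewrite exprMn -expRM_natl mulrCA divff ?mulr1// gt_eqF.
apply: lerXn2r; rewrite ?nnegrE ?addr_ge0// ?mulr_ge0 ?expR_ge0 ?(ltW m0)//.
apply: le_trans (ler_wpM2l (ltW m0) (expR_ge1Dx (t / m%:R))).
rewrite mulrDr mulr1 [m%:R * (t / _)]mulrC divfK ?gt_eqF// lerD2r.
by rewrite ler1n.
Qed.

Lemma cvg_inv1D : (1 + t)^-1 @[t --> +oo] --> (0 : R).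
Proof.
apply/cvgrPdist_lt => e e0; near=> t.
have t0 : 0 < 1 + t by near: t; exists (-1); split; [by rewrite num_real|move=> x; rewrite -subr_gt0 opprK addrC].
rewrite sub0r normrN gtr0_norm ?invr_gt0// -[ltRHS]invrK ltf_pV2 ?posrE ?invr_gt0//.
have : e^-1 < t by near: t; exists (e^-1); split; [by rewrite num_real|].
by move=> /lt_trans; apply; rewrite ltrDr.
Unshelve. all: by end_near. Qed.

Let u t : R := 1 - (1 + t)^-1.

Let uE t : 0 < t -> u t = t / (1 + t).
Proof.
by move=> t0; rewrite /u; field; rewrite gt_eqF// addr_gt0.
Qed.

Let du t : 0 < t -> is_derive t 1 u ((1 + t)^-1 ^+ 2).
Proof.
move=> t0; have t1 : 1 + t != 0 by rewrite gt_eqF// addr_gt0.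
have d1 : is_derive t 1 (fun t : R => 1 + t) (0 + 1).
  exact: der_add.
apply: (der_eq (der_add (is_derive_cst _ _ _) (der_opp (der_inv t1 d1)))).
by rewrite !add0r mulNr opprK mul1r exprVn.
Qed.

Let u_gt0 t : 0 < t -> 0 < u t.
Proof. by move=> t0; rewrite uE// divr_gt0// addr_gt0. Qed.

Lemma is_derive_powR_comp (f : R -> R) (t c l : R) : 0 < f t -> is_derive t 1 f l ->
  is_derive t 1 (fun t => f t `^ c) (c * f t `^ (c - 1) * l).
Proof.
move=> f0 df; apply: (@is_derive1_comp _ (fun x => x `^ c) f t).
exact: is_derive1_powR.
Qed.

Lemma cont_powR_comp (f : R -> R) (t c : R) : 0 < f t -> continuous_at t f ->
  continuous_at t (fun t => f t `^ c).
Proof.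
move=> f0 cf; apply: (@continuous_comp _ _ _ f (fun x => x `^ c)) => //.
apply: differentiable_continuous; apply/derivable1_diffP.
by have [] := is_derive1_powR c f0.
Qed.

Lemma der_cont (f : R -> R) t l : is_derive t 1 f l -> continuous_at t f.
Proof.
move=> df; apply: differentiable_continuous; apply/derivable1_diffP.
by have [] := df.
Qed.

Definition gamma_integrand b t : R := t `^ (b - 1) * expR (- t).

Lemma gamma_integrand_ge0 b t : 0 <= gamma_integrand b t.
Proof. by rewrite mulr_ge0 ?powR_ge0 ?expR_ge0. Qed.

Lemma measurable_gamma_integrand b : measurable_fun setT (gamma_integrand b).
Proof.
apply: measurable_funM; first exact: measurable_powR.
by apply: measurableT_comp => //; exact: measurable_funN.
Qed.

(* The integrand is dominated by the derivative of [(t / (1 + t)) ^ b / b]. *)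
Lemma gamma_integrable b : 0 < b -> mu.-integrable Rp (EFin \o gamma_integrand b).
Proof.
move=> b0.
pose psi t := b * u t `^ (b - 1) * (1 + t)^-1 ^+ 2.
have dF t : 0 < t -> is_derive t 1 (fun t => u t `^ b) (psi t).
  by move=> t0; apply: is_derive_powR_comp; [exact: u_gt0|exact: du].
have cV t : 0 < t -> continuous_at t (fun t : R => (1 + t)^-1).
  move=> t0; apply: cont_inv; first by rewrite gt_eqF// addr_gt0.
  by apply: cont_add; [exact: cst_continuous|exact: cvg_id].
have cpsi t : 0 < t -> continuous_at t psi.
  move=> t0; apply: cont_mul; last by apply: cont_mul; exact: cV.
  apply: cont_mul; first exact: cst_continuous.
  by apply: cont_powR_comp; [exact: u_gt0|apply: der_cont; exact: du].
have psi0 t : 0 < t -> 0 <= psi t.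
  move=> t0; apply: mulr_ge0; last exact: sqr_ge0.
  by apply: mulr_ge0; [exact: ltW|exact: powR_ge0].
have F0 : u t `^ b @[t --> 0^'+] --> 0.
  apply: (@squeeze_cvgr _ _ _ _ (fun=> 0) (fun t => t `^ b)); [|exact: cvg_cst|exact: powR_cvg0].
  near=> t; have t0 : 0 < t by near: t; exact: nbhs_right_gt.
  rewrite powR_ge0/= ge0_ler_powR ?nnegrE ?(ltW b0) ?(ltW t0) ?(ltW (u_gt0 t0))//.
  by rewrite uE// ler_pdivrMr ?addr_gt0// mulrDr mulr1 lerDl mulr_ge0 ?(ltW t0).
have F1 : u t `^ b @[t --> +oo] --> (1 : R).
  have u1 : u t @[t --> +oo] --> (1 - 0 : R) by apply: cvgB; [exact: cvg_cst|exact: cvg_inv1D].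
  rewrite subr0 in u1; have : continuous_at (1 : R) (fun x : R => x `^ b).
    by apply: der_cont (is_derive1_powR b ltr01).
  by rewrite /continuous_at powR1; apply: cvg_comp u1.
have /= ipsi := FTC_0y_ge0 dF cpsi F0 F1 psi0.
(* Since [psi t = b t ^ (b - 1) (1 + t) ^ (- (b + 1))], the quotient of the integrand by [psi] is
   [(1 + t) ^ (b + 1) e ^ (- t) / b], hence at most [C / b]. *)
have [C C0 hC] := pow_exp_bound (b + 1).
have mpsi : measurable_fun Rp psi.
  apply: open_continuous_measurable_fun; first exact: interval_open.
  by move=> x /set_mem; rewrite Rp_gt0; exact: cpsi.
apply: (@le_integrable _ _ _ _ _ measurable_Rp _ (fun t => ((C / b) * psi t)%:E)).
- by apply/measurable_EFinP; apply: measurable_funTS; exact: measurable_gamma_integrand.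
- move=> t; rewrite Rp_gt0 => t0.
  rewrite /= lee_fin ger0_norm ?gamma_integrand_ge0//.
  have h0 : 0 <= C / b * psi t.
    by apply: mulr_ge0; [apply: divr_ge0; exact: ltW|exact: psi0].
  rewrite (ger0_norm h0).
  have t1 : 0 < 1 + t by rewrite addr_gt0.
  have -> : C / b * psi t = t `^ (b - 1) * ((1 + t) `^ (- (b + 1)) * C).
    rewrite /psi uE// powRM ?(ltW t0) ?invr_ge0 ?(ltW t1)//.
    rewrite -[(1 + t)^-1]powR_inv1 ?(ltW t1)// -powRrM -[_ ^+ 2]powR_mulrn ?powR_ge0// -powRrM.
    have -> : - (b + 1) = -1 * (b - 1) + -1 * 2 by ring.
    rewrite [(1 + t) `^ (_ + _)]powRD; last by rewrite (gt_eqF t1) implybT.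
    by field; rewrite gt_eqF.
  rewrite /gamma_integrand ler_wpM2l ?powR_ge0// powRN mulrC ler_pdivlMr ?powR_gt0//.
  by rewrite mulrC hC// ltW.
- apply: (@integrableZl _ _ _ _ _ measurable_Rp (C / b) (EFin \o psi)).
  apply/integrableP; split; first by apply/measurable_EFinP.
  rewrite [ltLHS](_ : _ = \int[mu]_(t in Rp) (psi t)%:E)%E; first by rewrite ipsi ltry.
  apply: eq_integral => t /set_mem; rewrite Rp_gt0 => t0.
  by rewrite /= ger0_norm ?psi0.
Unshelve. all: by end_near. Qed.

Lemma gamma_integralE b : 0 < b ->
  (\int[mu]_(t in Rp) (gamma_integrand b t)%:E = (Gamma_fun b)%:E)%E.
Proof.
move=> b0; rewrite /Gamma_fun /Rintegral fineK//.
by apply: integrable_fin_num; [exact: measurable_Rp|exact: (gamma_integrable b0)].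
Qed.

Lemma Gamma_fun_gt0 b : 0 < b -> 0 < Gamma_fun b.
Proof.
move=> b0; rewrite -lte_fin -gamma_integralE//.
(* A lower bound of the integrand on [[1, 2]], whatever the sign of [b - 1]. *)
pose c := (2 `^ `|b - 1|)^-1 * expR (-2) : R.
have c0 : 0 < c by rewrite mulr_gt0 ?expR_gt0// invr_gt0 powR_gt0.
have mI : measurable (`[1, 2]%classic : set R) by exact: measurable_itv.
have mg (D : set R) : measurable_fun D (EFin \o gamma_integrand b).
  by apply/measurable_EFinP; apply: measurable_funTS; exact: measurable_gamma_integrand.
have h1 : (\int[mu]_(t in `[1%R, 2%R]) c%:E = c%:E)%E.
  rewrite integral_cst//= lebesgue_measure_itv/= lte_fin ltr1n/= -EFinB.
  by rewrite (_ : 2 - 1 = 1 :> R) ?mule1//; ring.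
apply: (@lt_le_trans _ _ (\int[mu]_(t in `[1%R, 2%R]) c%:E)%E); first by rewrite h1 lte_fin.
apply: (@le_trans _ _ (\int[mu]_(t in `[1%R, 2%R]) (gamma_integrand b t)%:E)%E).
  apply: ge0_le_integral => //.
  - by move=> t _; rewrite lee_fin ltW.
  - exact: mg.
  - move=> t /=; rewrite in_itv/= => /andP[t1 t2]; rewrite lee_fin /c.
    have t0 : 0 < t by rewrite (lt_le_trans _ t1).
    apply: ler_pM; rewrite ?invr_ge0 ?powR_ge0 ?expR_ge0//; last by rewrite ler_expR lerN2.
    rewrite -powRN (@le_trans _ _ (t `^ (- `|b - 1|)))//.
      by rewrite !powRN lef_pV2 ?posrE ?powR_gt0// ge0_ler_powR ?nnegrE ?(ltW t0).
    by apply: ler_powR => //; rewrite lerNl -normrN ler_norm.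
apply: ge0_subset_integral => //.
- exact: mg.
- by move=> t _; rewrite lee_fin gamma_integrand_ge0.
- by move=> t; rewrite Rp_gt0 /= in_itv/= => /andP[+ _]; apply: lt_le_trans.
Qed.

Lemma gamma_scale b r : 0 < b -> 0 < r ->
  (\int[mu]_(t in Rp) (t `^ (b - 1) * expR (- (r * t)))%:E =
   (Gamma_fun b * r `^ (- b))%:E)%E.
Proof.
move=> b0 r0; set I := (X in X = _).
have e : ((Gamma_fun b)%:E = (r `^ b)%:E * I)%E.
  rewrite -gamma_integralE// (lebesgue_scale_pos r0); last 2 first.
  - exact: measurable_gamma_integrand.
  - by move=> *; exact: gamma_integrand_ge0.
  have -> : r `^ b = r * r `^ (b - 1) by rewrite mulr_powRB1 ?ltW.
  rewrite EFinM -muleA; congr (_ * _)%E.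
  rewrite /I -ge0_integralZl_EFin ?powR_ge0//.
  - apply: eq_integral => t /set_mem; rewrite Rp_gt0 => t0.
    by rewrite -EFinM /gamma_integrand powRM ?(ltW t0) ?(ltW r0)// mulrA.
  - by move=> t _; rewrite lee_fin mulr_ge0 ?powR_ge0 ?expR_ge0.
  - apply/measurable_EFinP; apply: measurable_funTS; apply: measurable_funM.
      exact: measurable_powR.
    by apply: measurableT_comp => //; apply: measurable_funN; exact: measurable_funM.
rewrite EFinM e muleC muleA -EFinM powRN mulVf ?mul1e//.
by rewrite gt_eqF// powR_gt0.
Qed.

Lemma Gamma_funS b : 0 < b -> Gamma_fun (b + 1) = b * Gamma_fun b.
Proof.
move=> b0.
pose F t := t `^ b * expR (- t).
pose f t := b * gamma_integrand b t - gamma_integrand (b + 1) t.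
have dexp t : is_derive t 1 (fun t : R => expR (- t)) (- expR (- t)).
  apply: (der_eq (is_derive1_comp (is_derive_expR _) (is_deriveNid _ _))).
  by rewrite mulrN1.
have dF t : 0 < t -> is_derive t 1 F (f t).
  move=> t0; apply: (der_eq (der_mul (is_derive1_powR b t0) (dexp t))).
  by rewrite /f /gamma_integrand addrK; ring.
have cg c t : 0 < t -> continuous_at t (gamma_integrand c).
  move=> t0; apply: cont_mul; first by apply: der_cont (is_derive1_powR _ t0).
  exact: der_cont (dexp t).
have cf t : 0 < t -> continuous_at t f.
  move=> t0; apply: cont_add; last by apply: cont_opp; exact: cg.
  by apply: cont_mul; [exact: cst_continuous|exact: cg].
have F0 : F t @[t --> 0^'+] --> 0.
  apply: (@squeeze_cvgr _ _ _ _ (fun=> 0) (fun t => t `^ b)); [|exact: cvg_cst|exact: powR_cvg0].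
  near=> t; have t0 : 0 < t by near: t; exact: nbhs_right_gt.
  by rewrite /F mulr_ge0 ?powR_ge0 ?expR_ge0//= ler_piMr ?powR_ge0// -expR0 ler_expR lerNl oppr0 ltW.
(* The exponent [b + 1] instead of [b] leaves a spare factor [1 / (1 + t)], which gives the limit at
   infinity. *)
have [C C0 hC] := pow_exp_bound (b + 1).
have Fy : F t @[t --> +oo] --> 0.
  have h : C * (1 + t)^-1 @[t --> +oo] --> 0.
    by rewrite -(mulr0 C); apply: cvgM; [exact: cvg_cst|exact: cvg_inv1D].
  apply: (@squeeze_cvgr _ _ _ _ (fun=> 0) (fun t => C * (1 + t)^-1)); [|exact: cvg_cst|exact: h].
  near=> t; have t0 : 0 < t by near: t; exists 0; split => //; rewrite real0.
  have t1 : 0 < 1 + t by rewrite addr_gt0.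
  rewrite /F mulr_ge0 ?powR_ge0 ?expR_ge0//= ler_pdivlMr//.
  apply: le_trans (hC t (ltW t0)).
  rewrite powRD ?(gt_eqF t1) ?implybT// powRr1 ?(ltW t1)// mulrAC ler_wpM2r ?expR_ge0//.
  rewrite ler_wpM2r ?(ltW t1)// ge0_ler_powR ?nnegrE ?(ltW b0) ?(ltW t0) ?(ltW t1)//.
  by rewrite lerDr.
have b1 : 0 < b + 1 by rewrite addr_gt0.
have i1 := gamma_integrable b0; have i2 := gamma_integrable b1.
have i3 : mu.-integrable Rp (EFin \o (fun t => b * gamma_integrand b t)).
  exact: (integrableZl measurable_Rp b i1).
have i4 : mu.-integrable Rp (EFin \o f).
  exact: (integrableB measurable_Rp i3 i2).
have := FTC_0y_integrable dF cf F0 Fy i4.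
rewrite subr0 /f RintegralB//.
rewrite RintegralZl//.
by move/eqP; rewrite subr_eq0 => /eqP ->.
Unshelve. all: by end_near. Qed.

Lemma Gamma_fun1 : Gamma_fun 1 = 1 :> R.
Proof.
have dexp t : is_derive t 1 (fun t : R => - expR (- t)) (expR (- t)).
  apply: (der_eq (der_opp (is_derive1_comp (is_derive_expR _) (is_deriveNid _ _)))).
  by rewrite mulrN1 opprK.
have cexpN : continuous (fun t : R => - expR (- t)) by move=> t; exact: der_cont (dexp t).
have -> : Gamma_fun 1 = \int[mu]_(t in Rp) expR (- t).
  by apply: eq_Rintegral => t _; rewrite subrr powRr0 mul1r.
rewrite (@FTC_0y_integrable _ (fun t => - expR (- t)) _ (-1) 0) ?sub0r ?opprK//.
- move=> t _; have := cont_opp (cexpN t).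
  by under eq_fun do rewrite opprK.
- by have := cvg_at_right_filter (cexpN 0); rewrite oppr0 expR0.
- by rewrite -oppr0; apply: cvgN; exact: cvgr_expR.
- apply: eq_integrable (gamma_integrable ltr01); first exact: measurable_Rp.
  by move=> t _; rewrite /= /gamma_integrand subrr powRr0 mul1r.
Qed.

Lemma Gamma_fun_fact n : Gamma_fun n.+1%:R = n`!%:R :> R.
Proof.
elim: n => [|n ih]; first exact: Gamma_fun1.
by rewrite -natr1 Gamma_funS ?ltr0n// ih factS natrM.
Qed.

Lemma exp_moment n r : 0 < r ->
  (\int[mu]_(t in Rp) (t ^+ n * expR (- (r * t)))%:E = (n`!%:R * r^-1 ^+ n.+1)%:E)%E.
Proof.
move=> r0; have n0 : 0 < n.+1%:R :> R by rewrite ltr0n.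
have := gamma_scale n0 r0; rewrite Gamma_fun_fact powRN powR_mulrn ?ltW// -exprVn => <-.
apply: eq_integral => t /set_mem; rewrite Rp_gt0 => t0.
by rewrite -natr1 addrK powR_mulrn ?ltW.
Qed.

Lemma measurable_gamma_scaled c r (D : set (measurableTypeR R)) :
  measurable_fun D (fun t => (t `^ c * expR (- (r * t)))%:E).
Proof.
apply: measurable_funTS; apply/measurable_EFinP; apply: measurable_funM.
  exact: measurable_powR.
by apply: measurableT_comp => //; apply: measurable_funN; exact: measurable_funM.
Qed.

Lemma measurable_moment n r (D : set (measurableTypeR R)) :
  measurable_fun D (fun t => (t ^+ n * expR (- (r * t)))%:E).
Proof.
apply: measurable_funTS; apply/measurable_EFinP; apply: measurable_funM.
  exact: measurable_funX.
by apply: measurableT_comp => //; apply: measurable_funN; exact: measurable_funM.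
Qed.

Lemma measurable_inv : measurable_fun setT (fun x : R => x^-1).
Proof.
have m0 : measurable ([set 0] : set R) by exact: measurable_set1.
rewrite -(setUv [set 0]); apply/measurable_funU => //; first exact: measurableC.
split; first exact: measurable_fun_set1.
apply: open_continuous_measurable_fun; first by apply: closed_openC; apply: accessible_closed_set1; apply: hausdorff_accessible; exact: Rhausdorff.
move=> x /set_mem/= /eqP x0; apply: cont_inv => //; exact: cvg_id.
Qed.

Lemma measurable_stieltjes c n r (D : set (measurableTypeR R)) :
  measurable_fun D (fun x => (x `^ c * (r + x)^-1 ^+ n)%:E).
Proof.
apply: measurable_funTS; apply/measurable_EFinP; apply: measurable_funM.
  exact: measurable_powR.
apply: measurable_funX; apply: measurableT_comp; first exact: measurable_inv.
exact: measurable_funD.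
Qed.

(** The Beta value [B(a, n + 1 - a)]. *)
Definition stieltjes_const a n : R := Gamma_fun a * Gamma_fun (n.+1%:R - a) / n`!%:R.

Lemma stieltjes_const_gt0 a n : 0 < a -> a < n.+1%:R -> 0 < stieltjes_const a n.
Proof.
move=> a0 an; rewrite /stieltjes_const mulr_gt0 ?invr_gt0 ?ltr0n ?fact_gt0//.
by rewrite mulr_gt0 ?Gamma_fun_gt0 ?subr_gt0.
Qed.

(** Tonelli for [x ^ (n - a) y ^ n e ^ (- (r + x) y)]: integrating in [y] first gives [n!] times the
    left-hand integrand, integrating in [x] first gives [Gamma(n + 1 - a) y ^ (a - 1) e ^ (- r y)],
    a Gamma integral again. *)
Lemma stieltjes_real a n r : 0 < a -> a < n.+1%:R -> 0 < r ->
  (\int[mu]_(x in Rp) (x `^ (n%:R - a) * (r + x)^-1 ^+ n.+1)%:E =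
   (stieltjes_const a n * r `^ (- a))%:E)%E.
Proof.
move=> a0 an r0.
pose f (z : R * R) := z.1 `^ (n%:R - a) * (z.2 ^+ n * expR (- ((r + z.1) * z.2))).
have mf : measurable_fun setT (EFin \o f).
  apply/measurable_EFinP; apply: measurable_funM.
    exact: (measurableT_comp (measurable_powR _) measurable_fst).
  apply: measurable_funM; first by apply: measurable_funX; exact: measurable_snd.
  apply: (measurableT_comp (@measurable_expR _)); apply: measurable_funN.
  apply: measurable_funM; last exact: measurable_snd.
  by apply: measurable_funD => //; exact: measurable_fst.
have f0 x y : Rp x -> Rp y -> (0 <= (EFin \o f) (x, y))%E.
  rewrite !Rp_gt0 => x0 y0; rewrite lee_fin !mulr_ge0 ?powR_ge0 ?expR_ge0//.
  by rewrite exprn_ge0 ?ltW.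
have H := tonelli_on mu mu measurable_Rp measurable_Rp mf f0.
have nf0 : n`!%:R != 0 :> R by rewrite pnatr_eq0 -lt0n fact_gt0.
have E1 : (\int[mu]_(x in Rp) \int[mu]_(y in Rp) (EFin \o f) (x, y) =
    n`!%:R%:E * \int[mu]_(x in Rp) (x `^ (n%:R - a) * (r + x)^-1 ^+ n.+1)%:E)%E.
  have e x : Rp x -> (\int[mu]_(y in Rp) (EFin \o f) (x, y) =
      n`!%:R%:E * (x `^ (n%:R - a) * (r + x)^-1 ^+ n.+1)%:E)%E.
    rewrite Rp_gt0 => x0.
    have -> : (n`!%:R%:E * (x `^ (n%:R - a) * (r + x)^-1 ^+ n.+1)%:E =
        (x `^ (n%:R - a))%:E * (n`!%:R * (r + x)^-1 ^+ n.+1)%:E)%E.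
      by rewrite -!EFinM mulrCA.
    rewrite -(exp_moment n (addr_gt0 r0 x0)).
    rewrite -(@ge0_integralZl_EFin _ _ _ mu Rp measurable_Rp _ _ _ _ (powR_ge0 _ _)).
    - by apply: eq_integral => y _; rewrite -EFinM.
    - move=> y; rewrite Rp_gt0 => y0; rewrite lee_fin; apply: mulr_ge0.
        exact/exprn_ge0/ltW.
      exact: expR_ge0.
    - exact: measurable_moment.
  rewrite -(@ge0_integralZl_EFin _ _ _ mu Rp measurable_Rp _ _ _ _ (ler0n _ _)).
  - by apply: eq_integral => x /set_mem; exact: e.
  - move=> x; rewrite Rp_gt0 => x0; rewrite lee_fin; apply: mulr_ge0.
      exact: powR_ge0.
    by apply: exprn_ge0; rewrite invr_ge0; exact/ltW/addr_gt0.
  - exact: measurable_stieltjes.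
have E2 : (\int[mu]_(y in Rp) \int[mu]_(x in Rp) (EFin \o f) (x, y) =
    (Gamma_fun (n.+1%:R - a))%:E * \int[mu]_(y in Rp) (y `^ (a - 1) * expR (- (r * y)))%:E)%E.
  have an' : 0 < n.+1%:R - a by rewrite subr_gt0.
  have e y : Rp y -> (\int[mu]_(x in Rp) (EFin \o f) (x, y) =
      (Gamma_fun (n.+1%:R - a))%:E * (y `^ (a - 1) * expR (- (r * y)))%:E)%E.
    rewrite Rp_gt0 => y0.
    have -> : ((Gamma_fun (n.+1%:R - a))%:E * (y `^ (a - 1) * expR (- (r * y)))%:E =
        (y ^+ n * expR (- (r * y)))%:E *
        (Gamma_fun (n.+1%:R - a) * y `^ (- (n.+1%:R - a)))%:E)%E.
      rewrite -!EFinM; congr EFin.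
      have -> : y `^ (a - 1) = y ^+ n * y `^ (- (n.+1%:R - a)).
        rewrite -[y ^+ n](powR_mulrn n (ltW y0)) -powRD; last by rewrite (gt_eqF y0) implybT.
        by congr (_ `^ _); rewrite -natr1; ring.
      by ring.
    rewrite -[X in (_ * X)%E](gamma_scale an' y0).
    have c0 : 0 <= y ^+ n * expR (- (r * y)).
      by apply: mulr_ge0; [exact/exprn_ge0/ltW|exact: expR_ge0].
    rewrite -(@ge0_integralZl_EFin _ _ _ mu Rp measurable_Rp _ _ _ _ c0).
    - apply: eq_integral => x _; rewrite -EFinM /f/=; congr EFin.
      have -> : n.+1%:R - a - 1 = n%:R - a by rewrite -natr1; ring.
      by rewrite mulrDl opprD expRD [x * y]mulrC; ring.
    - by move=> x _; rewrite lee_fin; apply: mulr_ge0; [exact: powR_ge0|exact: expR_ge0].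
    - exact: measurable_gamma_scaled.
  rewrite -(@ge0_integralZl_EFin _ _ _ mu Rp measurable_Rp _ _ _ _ (ltW (Gamma_fun_gt0 an'))).
  - by apply: eq_integral => y /set_mem; exact: e.
  - by move=> y _; rewrite lee_fin; apply: mulr_ge0; [exact: powR_ge0|exact: expR_ge0].
  - exact: measurable_gamma_scaled.
have := etrans (esym E1) (etrans H E2).
rewrite (gamma_scale a0 r0); move: (\int[mu]_(x in Rp) _)%E => I EI.
rewrite /stieltjes_const; move: (n`!%:R : R) nf0 EI => N N0 EI.
have -> : I = (N^-1%:E * (N%:E * I))%E.
  by rewrite muleA -EFinM (mulVf N0) mul1e.
rewrite EI -!EFinM; congr EFin; ring.
Qed.

Lemma stieltjes_integrable a n r : 0 < a -> a < n.+1%:R -> 0 < r ->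
  mu.-integrable Rp (fun x => (x `^ (n%:R - a) * (r + x)^-1 ^+ n.+1)%:E).
Proof.
move=> a0 an r0; apply/integrableP; split; first exact: measurable_stieltjes.
rewrite [ltLHS](_ : _ = (stieltjes_const a n * r `^ (- a))%:E) ?ltry//.
rewrite -stieltjes_real//; apply: eq_integral => x /set_mem; rewrite Rp_gt0 => x0.
by rewrite /= ger0_norm// mulr_ge0 ?powR_ge0// exprn_ge0// invr_ge0 addr_ge0// ltW.
Qed.

End GammaTheory.

Section ComplexMeasurability.
Context d (T : measurableType d) (R : realType).
Implicit Types f g : T -> R[i].

Definition cmeas f : Prop := measurable_fun setT (fun x => complex.Re (f x)) /\
  measurable_fun setT (fun x => complex.Im (f x)).

Lemma cmeas_real (u : T -> R) : measurable_fun setT u -> cmeas (fun x => (u x)%:C).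
Proof. by move=> mu; split => //=; exact: measurable_cst. Qed.

Lemma cmeas_cst (c : R[i]) : cmeas (fun=> c).
Proof. by split => /=; exact: measurable_cst. Qed.

Lemma cmeasD f g : cmeas f -> cmeas g -> cmeas (fun x => f x + g x).
Proof.
move=> [f1 f2] [g1 g2]; split.
- by under eq_fun do rewrite cReD; exact: measurable_funD.
- by under eq_fun do rewrite cImD; exact: measurable_funD.
Qed.

Lemma cmeasM f g : cmeas f -> cmeas g -> cmeas (fun x => f x * g x).
Proof.
move=> [f1 f2] [g1 g2]; split.
- under eq_fun do rewrite cReM.
  by apply: measurable_funB; exact: measurable_funM.
- under eq_fun do rewrite cImM.
  by apply: measurable_funD; exact: measurable_funM.
Qed.

Lemma cmeasX f n : cmeas f -> cmeas (fun x => f x ^+ n).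
Proof.
move=> mf; elim: n => [|n ih]; first exact: cmeas_cst.
by under eq_fun do rewrite exprS; exact: cmeasM.
Qed.

Lemma cmeasV f : cmeas f -> cmeas (fun x => (f x)^-1).
Proof.
move=> [f1 f2].
have mn : measurable_fun setT (fun x => (sqnorm (f x))^-1).
  apply: (measurableT_comp (@measurable_inv R)).
  by apply: measurable_funD; exact: measurable_funX.
split.
- by under eq_fun do rewrite cReV; exact: measurable_funM.
- under eq_fun do rewrite cImV.
  by apply: measurable_funM => //; exact: measurable_funN.
Qed.

Lemma cmeas_prod (I : Type) (r : seq I) (F : I -> T -> R[i]) :
  (forall i, cmeas (F i)) -> cmeas (fun x => \prod_(i <- r) F i x).
Proof.
move=> cF; elim: r => [|i r ih].
  by under eq_fun do rewrite big_nil; exact: cmeas_cst.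
by under eq_fun do rewrite big_cons; exact: cmeasM.
Qed.

Lemma cintegrable_le (mu : {measure set T -> \bar R}) (D : set T) f (h : T -> R) :
  measurable D -> cmeas f -> (forall x, D x -> Normc.normc (f x) <= h x) ->
  mu.-integrable D (EFin \o h) -> cintegrable mu D f.
Proof.
move=> mD [f1 f2] fh ih; split.
- apply: le_integrable ih => //.
    by apply/measurable_EFinP; exact: measurable_funTS.
  move=> x Dx; rewrite /= lee_fin (le_trans (abs_Re_le _))//.
  by rewrite (le_trans (fh x Dx))// ler_norm.
- apply: le_integrable ih => //.
    by apply/measurable_EFinP; exact: measurable_funTS.
  move=> x Dx; rewrite /= lee_fin (le_trans (abs_Im_le _))//.
  by rewrite (le_trans (fh x Dx))// ler_norm.
Qed.

End ComplexMeasurability.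

(** * Bounds for Stieltjes' kernel off the cut *)

Section StieltjesKernel.
Context {R : realType}.
Notation mu := (@lebesgue_measure R).
Notation Rp := (`]0, +oo[%classic : set R).
Implicit Types (w : R[i]) (a r x m M : R) (n : nat).

Lemma normc_real r : Normc.normc (r%:C) = `|r|.
Proof. by rewrite normcE /sqnorm /= expr0n/= addr0 sqrtr_sqr. Qed.

(** [|w| + Re w] is never negative and vanishes exactly on the cut. A positive lower bound [m] for
    it and an upper bound [M] for [|w|] are the two data from which all uniform estimates below are
    made. *)
Lemma slit_gap_gt0 w : slit_plane w -> 0 < Normc.normc w + complex.Re w.
Proof.
case: w => x y; rewrite /slit_plane /= => h.
have [y0|y0] := eqVneq y 0.
  have x0 : 0 < x by rewrite ltNge; apply/negP => x0; apply: h.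
  by rewrite ltr_wpDl ?sqrtr_ge0.
have : `|x| < Num.sqrt (x ^+ 2 + y ^+ 2).
  rewrite -sqrtr_sqr ltr_sqrt ?ltrDl ?exprn_even_gt0//.
  by rewrite ltr_wpDl ?sqr_ge0// exprn_even_gt0.
by rewrite -subr_gt0 => h1; rewrite (lt_le_trans h1)// lerD2l lerNl -normrN ler_norm.
Qed.

(** With [N = |w|], the squared modulus of [w + r] is at least [(N + Re w) / (2 N) (N + r) ^ 2], and
    the first factor is at least [m / (2 M)]: this is the root. As [N >= m / 2], also
    [N + r >= min (m / 2, 1) (1 + r)]: this is the minimum. *)
Definition gap_const m M : R := Num.sqrt (m / (2 * M)) * Num.min (m / 2) 1.

Lemma gap_const_gt0 m M : 0 < m -> 0 < M -> 0 < gap_const m M.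
Proof.
move=> m0 M0; rewrite mulr_gt0//.
  by rewrite sqrtr_gt0 divr_gt0// mulr_gt0.
by rewrite lt_min ltr01 divr_gt0.
Qed.

Lemma slit_lower m M w r : 0 < m -> m <= Normc.normc w + complex.Re w ->
  Normc.normc w <= M -> 0 <= r ->
  gap_const m M * (1 + r) <= Normc.normc (w + r%:C).
Proof.
move=> m0 mw wM r0; set N := Normc.normc w in mw wM *.
have mN : m <= 2 * N.
  rewrite (le_trans mw)// mulr_natl mulr2n lerD2l.
  by rewrite (le_trans (ler_norm _))// abs_Re_le.
have N0 : 0 < N by rewrite -(pmulr_rgt0 _ (@ltr0n R 2)) (lt_le_trans m0).
have M0 : 0 < M by exact: lt_le_trans wM.
have q0 : 0 <= m / (2 * M) by rewrite divr_ge0 ?ltW// mulr_gt0.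
have h1 : m / (2 * M) * (N + r) ^+ 2 <= sqnorm (w + r%:C).
  have -> : sqnorm (w + r%:C) = N ^+ 2 + r ^+ 2 + 2 * r * complex.Re w.
    by rewrite /N sqr_normc /sqnorm cReD cImD /=; ring.
  have h2 : (N + complex.Re w) / (2 * N) * (N + r) ^+ 2 <=
      N ^+ 2 + r ^+ 2 + 2 * r * complex.Re w.
    rewrite -subr_ge0.
    have -> : N ^+ 2 + r ^+ 2 + 2 * r * complex.Re w -
      (N + complex.Re w) / (2 * N) * (N + r) ^+ 2 =
      (N - complex.Re w) / (2 * N) * (N - r) ^+ 2 by field; rewrite gt_eqF.
    rewrite mulr_ge0 ?sqr_ge0// divr_ge0 ?mulr_ge0 ?(ltW N0)// subr_ge0.
    by rewrite (le_trans (ler_norm _))// abs_Re_le.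
  apply: le_trans h2; rewrite ler_wpM2r ?sqr_ge0//.
  by apply: ler_pM; rewrite ?(ltW m0) ?invr_ge0 ?mulr_ge0 ?(ltW M0)// lef_pV2 ?posrE ?mulr_gt0// ler_pM2l.
have h3 : Num.min (m / 2) 1 * (1 + r) <= N + r.
  have mn : Num.min (m / 2) 1 <= N.
    by rewrite ge_min ler_pdivrMr// mulrC mN.
  rewrite mulrDr mulr1 lerD// ler_piMl//.
  by rewrite ge_min lexx orbT.
have min0 : 0 <= Num.min (m / 2) 1 by rewrite le_min ler01 divr_ge0// ltW.
have G0 : 0 <= gap_const m M * (1 + r).
  by rewrite mulr_ge0 ?addr_ge0// ltW// gap_const_gt0.
rewrite normcE -[leLHS](ger0_norm G0) -sqrtr_sqr ler_sqrt ?sqnorm_ge0//.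
apply: le_trans h1; rewrite /gap_const -[X in X ^+ 2]mulrA exprMn sqr_sqrtr//.
rewrite ler_wpM2l// lerXn2r ?nnegrE// ?mulr_ge0 ?addr_ge0// ltW//.
Qed.

Definition kern a n w r : R[i] := (r `^ (n%:R - a))%:C * (w + r%:C)^-1 ^+ n.+1.

Lemma slit_add_neq0 m M w r : 0 < m -> m <= Normc.normc w + complex.Re w ->
  Normc.normc w <= M -> 0 <= r -> w + r%:C != 0.
Proof.
move=> m0 mw wM r0; have M0 : 0 < M.
  have : m <= 2 * Normc.normc w.
    rewrite (le_trans mw)// mulr_natl mulr2n lerD2l.
    by rewrite (le_trans (ler_norm _))// abs_Re_le.
  by move=> /(lt_le_trans m0); rewrite pmulr_rgt0// => h; exact: lt_le_trans wM.
rewrite -normc_gt0; apply: lt_le_trans (slit_lower m0 mw wM r0).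
by rewrite mulr_gt0 ?gap_const_gt0// ltr_pwDl.
Qed.

Lemma inv_slit_le m M w r : 0 < m -> 0 < M -> m <= Normc.normc w + complex.Re w ->
  Normc.normc w <= M -> 0 <= r ->
  Normc.normc (w + r%:C)^-1 <= (gap_const m M)^-1 * (1 + r)^-1.
Proof.
move=> m0 M0 mw wM r0; rewrite Normc.normcV -invfM.
have g0 := gap_const_gt0 m0 M0.
have wr0 := slit_add_neq0 m0 mw wM r0.
have r1 : 0 < 1 + r by rewrite ltr_pwDl.
by rewrite lef_pV2 ?posrE ?normc_gt0 ?(mulr_gt0 g0 r1)//; exact: slit_lower.
Qed.

(** The bound depends on [w] only through [m] and [M], and on [r] as the kernel at [w = 1], which is
    integrable: a majorant for whole arcs and whole pieces of contour. *)
Lemma kern_le a n m M w r : 0 < m -> 0 < M -> m <= Normc.normc w + complex.Re w ->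
  Normc.normc w <= M -> 0 <= r ->
  Normc.normc (kern a n w r) <=
    (gap_const m M)^-1 ^+ n.+1 * (r `^ (n%:R - a) * (1 + r)^-1 ^+ n.+1).
Proof.
move=> m0 M0 mw wM r0; rewrite Normc.normcM normc_real normcX.
rewrite ger0_norm ?powR_ge0// mulrCA ler_wpM2l ?powR_ge0// -exprMn.
apply: lerXn2r; rewrite ?nnegrE ?normc_ge0//; last exact: inv_slit_le.
by rewrite mulr_ge0 ?invr_ge0 ?addr_ge0// ltW// gap_const_gt0.
Qed.

Lemma cmeas_kern d (T : measurableType d) a n (u : T -> R) (f : T -> R[i]) :
  measurable_fun setT u -> cmeas f -> cmeas (fun y : T => kern a n (f y) (u y)).
Proof.
move=> mu mf; apply: cmeasM.
  by apply: cmeas_real; exact: (measurableT_comp (measurable_powR _) mu).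
by apply: cmeasX; apply: cmeasV; apply: cmeasD => //; exact: cmeas_real.
Qed.

Lemma kern_bound_integrable a n (c : R) : 0 < a -> a < n.+1%:R ->
  mu.-integrable Rp (EFin \o (fun r => c * (r `^ (n%:R - a) * (1 + r)^-1 ^+ n.+1))).
Proof.
move=> a0 an.
exact: (integrableZl measurable_Rp c (stieltjes_integrable a0 an ltr01)).
Qed.

Lemma kern_integrable a n w : 0 < a -> a < n.+1%:R -> slit_plane w ->
  cintegrable mu Rp (kern a n w).
Proof.
move=> a0 an sw; have m0 := slit_gap_gt0 sw.
have w0 : 0 < Normc.normc w.
  rewrite normc_gt0; apply/eqP => w0; move: m0.
  by rewrite w0 Normc.normc0 /= addr0 ltxx.
apply: (cintegrable_le measurable_Rp _ _
  (kern_bound_integrable ((gap_const (Normc.normc w + complex.Re w) (Normc.normc w))^-1 ^+ n.+1) a0 an)).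
  by apply: (@cmeas_kern _ _ a n (fun r => r)) => //; exact: cmeas_cst.
by move=> r; rewrite Rp_gt0 => r0; apply: kern_le => //; exact: ltW.
Qed.

Lemma cFTC_0y (F f : R -> R[i]) (h : R -> R) :
  (forall x, 0 < x -> cder F x (f x)) -> (forall x, 0 < x -> ccont f x) ->
  cintegrable mu Rp f -> (forall x, 0 < x -> Normc.normc (F x) <= h x) ->
  h x @[x --> 0^'+] --> (0 : R) -> h x @[x --> +oo] --> (0 : R) ->
  cint mu Rp f = 0.
Proof.
move=> dF cf [i1 i2] Fh h0 hy.
have lim0 (pr : R[i] -> R) (G : set_system R) : ProperFilter G ->
    (forall z, `|pr z| <= Normc.normc z) -> (\forall x \near G, 0 < x) ->
    h x @[x --> G] --> (0 : R) -> pr (F x) @[x --> G] --> (0 : R).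
  move=> PG prz G0 hG; apply: norm_cvg0.
  apply: (@squeeze_cvgr _ _ _ _ (fun=> 0) h); [|exact: cvg_cst|exact: hG].
  by apply: filterS G0 => x x0; rewrite normr_ge0 /= (le_trans (prz _))// Fh.
have n0 : \forall x \near (0:R)^'+, 0 < x by exact: nbhs_right_gt.
have ny : \forall x \near +oo, (0 : R) < x by exact: nbhs_pinfty_gt.
apply: complex_ext => /=.
- rewrite -[RHS](subrr (0 : R)).
  apply: (@FTC_0y_integrable _ (fun x => complex.Re (F x))) => //.
  + by move=> x x0; have [] := dF x x0.
  + by move=> x x0; have [] := cf x x0.
  + by apply: lim0 => // z; exact: abs_Re_le.
  + by apply: lim0 => // z; exact: abs_Re_le.
- rewrite -[RHS](subrr (0 : R)).
  apply: (@FTC_0y_integrable _ (fun x => complex.Im (F x))) => //.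
  + by move=> x x0; have [] := dF x x0.
  + by move=> x x0; have [] := cf x x0.
  + by apply: lim0 => // z; exact: abs_Im_le.
  + by apply: lim0 => // z; exact: abs_Im_le.
Qed.

End StieltjesKernel.

Section PolarForm.
Context {R : realType}.
Implicit Types (w : R[i]) (a b phi : R).

Definition expi phi : R[i] := cos phi +i* sin phi.

Lemma expi0 : expi 0 = 1.
Proof. by rewrite /expi cos0 sin0. Qed.

Lemma expiD a b : expi (a + b) = expi a * expi b.
Proof.
by apply: complex_ext; rewrite ?cReM ?cImM /= ?cosD ?sinD; ring.
Qed.

Lemma sqnorm_expi phi : sqnorm (expi phi) = 1.
Proof. exact: cos2Dsin2. Qed.

Lemma normc_expi phi : Normc.normc (expi phi) = 1.
Proof. by rewrite normcE sqnorm_expi sqrtr1. Qed.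

Lemma normc_i : Normc.normc (0 +i* 1 : R[i]) = 1.
Proof. by rewrite /= expr0n/= expr1n add0r sqrtr1. Qed.

Lemma cder_expi (f : R -> R) (t l : R) : is_derive t 1 f l ->
  cder (fun x => expi (f x)) t ((0 +i* 1) * l%:C * expi (f t)).
Proof.
move=> df; split.
- apply: (der_eq (is_derive1_comp (is_derive_cos (f t)) df)).
  by rewrite !(cReM, cImM) /=; ring.
- apply: (der_eq (is_derive1_comp (is_derive_sin (f t)) df)).
  by rewrite !(cReM, cImM) /=; ring.
Qed.

Lemma slit_normc_gt0 w : slit_plane w -> 0 < Normc.normc w.
Proof.
move=> /slit_gap_gt0 h; rewrite normc_gt0; apply/eqP => w0; move: h.
by rewrite w0 Normc.normc0 /= addr0 ltxx.
Qed.

Lemma carg_polar w : slit_plane w ->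
  - pi < carg w < pi /\ w = (Normc.normc w)%:C * expi (carg w).
Proof.
move=> sw; have N0 := slit_normc_gt0 sw; have gap := slit_gap_gt0 sw.
set N := Normc.normc w in N0 gap *.
pose x := complex.Re w / N.
have x1 : -1 < x by rewrite /x ltr_pdivlMr// mulN1r -subr_gt0 opprK addrC.
have x2 : x <= 1.
  by rewrite /x ler_pdivrMr// mul1r (le_trans (ler_norm _))// abs_Re_le.
have x12 : -1 <= x <= 1 by rewrite (ltW x1).
have [/andP[ac0 _] ca] := acos_def x12.
have acp : acos x < pi by apply: acos_ltpi; rewrite x1.
have sa : sin (acos x) = `|complex.Im w| / N.
  rewrite sin_acos// -[RHS](@ger0_norm _ (_ / N)) ?divr_ge0 ?(ltW N0)//.
  rewrite -sqrtr_sqr; congr Num.sqrt; rewrite /x !expr_div_n real_normK ?num_real//.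
  have := sqr_normc w; rewrite -/N /sqnorm => e.
  rewrite (_ : complex.Im w ^+ 2 = N ^+ 2 - complex.Re w ^+ 2); last by rewrite e; ring.
  by field; rewrite gt_eqF.
have NN : N * x = complex.Re w by rewrite /x mulrC divfK// gt_eqF.
have NS : N * (`|complex.Im w| / N) = `|complex.Im w| by rewrite mulrC divfK// gt_eqF.
rewrite /carg -/N -/x; have [im0|im0] := lerP 0 (complex.Im w); split.
- by rewrite acp andbT (lt_le_trans _ ac0)// oppr_lt0 pi_gt0.
- by apply: complex_ext; rewrite ?cReM ?cImM /= ?ca ?sa; rewrite ?NN ?NS ?ger0_norm//; ring.
- by rewrite ltrN2 acp /= (le_lt_trans _ (pi_gt0 R))// oppr_le0.
- apply: complex_ext; rewrite ?cReM ?cImM /= ?cosN ?sinN ?ca ?sa.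
  + by rewrite NN; ring.
  + by rewrite mulrN NS ltr0_norm// opprK; ring.
Qed.

Lemma cpow_polar a w : slit_plane w ->
  cpow a w = (Normc.normc w `^ a)%:C * expi (a * carg w).
Proof.
move=> sw; have N0 := slit_normc_gt0 sw.
rewrite /cpow /cexp RecM ImcM /= /powR gt_eqF//.
by apply: complex_ext; rewrite ?cReM ?cImM /=; ring.
Qed.

End PolarForm.

(** * Invariance of Stieltjes' integral under rotation *)

Section StieltjesIdentity.
Context {R : realType}.
Notation mu := (@lebesgue_measure R).
Notation Rp := (`]0, +oo[%classic : set R).
Implicit Types (phi psi r : R).

Lemma cvg_powRN1D (c : R) : 0 < c -> (1 + t) `^ (- c) @[t --> +oo] --> (0 : R).
Proof.
move=> c0; apply/cvgrPdist_lt => e e0; near=> t.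
have t0 : e `^ (- c^-1) < t by near: t; exact: nbhs_pinfty_gt.
have e1 : 0 < e `^ (- c^-1) by exact: powR_gt0.
have t1 : 0 < 1 + t by rewrite addr_gt0// (lt_trans e1).
rewrite sub0r normrN ger0_norm ?powR_ge0// powRN -[ltRHS]invrK.
rewrite ltf_pV2 ?posrE ?invr_gt0 ?powR_gt0//.
have -> : e^-1 = (e `^ (- c^-1)) `^ c.
  by rewrite -powRrM mulNr mulVf ?gt_eqF// powR_inv1 ?ltW.
apply: gt0_ltr_powR; rewrite ?nnegrE ?(ltW e1) ?(ltW t1)//.
by rewrite (lt_trans t0)// ltrDr.
Unshelve. all: by end_near. Qed.

Variables (a : R) (n : nat) (rho : R).
Hypotheses (a0 : 0 < a) (an : a < n.+1%:R) (rho0 : 0 < rho).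

Let w phi : R[i] := rho%:C * expi phi.
Let G phi r : R[i] := expi (a * phi) * kern a n (w phi) r.
Let dG phi r : R[i] := (0 +i* 1) * expi (a * phi) * kern a n (w phi) r *
  (a%:C - n.+1%:R * w phi * (w phi + r%:C)^-1).

Let normw phi : Normc.normc (w phi) = rho.
Proof. by rewrite Normc.normcM normc_expi normc_real mulr1 gtr0_norm. Qed.

Let gapw phi : Normc.normc (w phi) + complex.Re (w phi) = rho * (1 + cos phi).
Proof. by rewrite normw /w RecM /=; ring. Qed.

Let cder_w phi : cder w phi ((0 +i* 1) * w phi).
Proof.
apply: (cder_eq (cderM (cder_cst _ _) (cder_expi (is_derive_id phi (1 : R))))).
by rewrite /w; apply: complex_ext; rewrite ?cReD ?cImD !(cReM, cImM) /=; ring.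
Qed.

Let cder_G phi r : w phi + r%:C != 0 -> cder (fun x => G x r) phi (dG phi r).
Proof.
move=> wr; have d1 : is_derive phi 1 (fun x : R => a * x) a.
  by apply: (der_eq (der_mul (is_derive_cst a phi (1:R)) (is_derive_id phi (1:R)))); rewrite mul0r add0r mulr1.
have dV := cderV (cderD (cder_w phi) (cder_cst r%:C phi)) wr.
apply: (cder_eq (cderM (cder_expi d1) (cderM (cder_cst _ _) (cderX n dV)))).
rewrite /dG /kern !exprS; move: (_ ^+ n) => P.
by field; exact: wr.
Qed.

Variable m : R.
Hypothesis m0 : 0 < m.

Let K := (gap_const m rho)^-1.

Let K0 : 0 < K. Proof. by rewrite invr_gt0 gap_const_gt0. Qed.

(** A majorant of [dG phi] that does not depend on the angle, as differentiation under the integral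
    sign requires: [K ^ n.+1] comes from the kernel, and the bracket in [dG] is at most
    [a + n.+1 rho K] in modulus. *)
Let bnd r : R := K ^+ n.+1 * (a + n.+1%:R * rho * K) *
  (r `^ (n%:R - a) * (1 + r)^-1 ^+ n.+1).

Let bnd_int : mu.-integrable Rp (EFin \o bnd).
Proof. exact: kern_bound_integrable. Qed.

Section at_angle.
Variable phi : R.
Hypothesis mphi : m <= rho * (1 + cos phi).

Let mw : m <= Normc.normc (w phi) + complex.Re (w phi).
Proof. by rewrite gapw. Qed.

Let wM : Normc.normc (w phi) <= rho. Proof. by rewrite normw. Qed.

Let wr r : 0 <= r -> w phi + r%:C != 0.
Proof. exact: slit_add_neq0 m0 mw wM. Qed.

Let Vle r : 0 <= r -> Normc.normc (w phi + r%:C)^-1 <= K * (1 + r)^-1.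
Proof. exact: inv_slit_le m0 rho0 mw wM. Qed.

Let kernle r : 0 <= r -> Normc.normc (kern a n (w phi) r) <=
  K ^+ n.+1 * (r `^ (n%:R - a) * (1 + r)^-1 ^+ n.+1).
Proof. exact: kern_le m0 rho0 mw wM. Qed.

Let inv1D_le1 r : 0 <= r -> (1 + r)^-1 <= 1.
Proof. by move=> r0; rewrite invf_le1 ?lerDl// ltr_pwDl. Qed.

Lemma rotation_derivative_le r : 0 <= r -> Normc.normc (dG phi r) <= bnd r.
Proof.
move=> r0; have kl := kernle r0; rewrite /dG /bnd.
move: (_ * (1 + r)^-1 ^+ n.+1) (kern _ _ _ _) kl => u k kl.
have -> : K ^+ n.+1 * (a + n.+1%:R * rho * K) * u =
    K ^+ n.+1 * u * (a + n.+1%:R * rho * K) by rewrite mulrAC.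
rewrite 3!Normc.normcM normc_expi normc_i !mul1r.
apply: ler_pM; rewrite ?normc_ge0//.
rewrite (le_trans (le_normcD _ _))// lerD//.
  by rewrite normc_real gtr0_norm.
rewrite normcN Normc.normcM [X in X * _]Normc.normcM normw.
have -> : Normc.normc (n.+1%:R : R[i]) = n.+1%:R.
  by rewrite -(rmorph_nat (real_complex R)) normc_real ger0_norm.
rewrite ler_wpM2l ?mulr_ge0 ?(ltW rho0)//.
rewrite (le_trans (Vle r0))// ler_piMr ?(ltW K0)//.
exact: inv1D_le1.
Qed.

Let cmeas_G : cmeas (G phi : measurableTypeR R -> R[i]).
Proof.
by apply: cmeasM; [exact: cmeas_cst|apply: (@cmeas_kern _ _ _ a n (fun r => r))].
Qed.

Let cmeas_dG : cmeas (dG phi : measurableTypeR R -> R[i]).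
Proof.
apply: cmeasM.
  by apply: cmeasM; [exact: cmeas_cst|apply: (@cmeas_kern _ _ _ a n (fun r => r))].
under eq_fun do rewrite -mulNr.
apply: cmeasD; first exact: cmeas_cst.
apply: cmeasM; first exact: cmeas_cst.
by apply: cmeasV; apply: cmeasD; [exact: cmeas_cst|exact: cmeas_real].
Qed.

Lemma rotation_integrable : cintegrable mu Rp (G phi).
Proof.
apply: (cintegrable_le measurable_Rp cmeas_G _
  (kern_bound_integrable (K ^+ n.+1) a0 an)).
move=> r; rewrite Rp_gt0 => r0; rewrite Normc.normcM normc_expi mul1r.
by apply: kernle; exact: ltW.
Qed.

Let dG_integrable : cintegrable mu Rp (dG phi).
Proof.
apply: (cintegrable_le measurable_Rp cmeas_dG _ bnd_int).
by move=> r; rewrite Rp_gt0 => r0; apply: rotation_derivative_le; exact: ltW.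
Qed.

Let ccont_rC r : ccont (fun r : R => w phi + r%:C) r.
Proof.
by apply: ccontD; [exact: ccont_cst|apply: ccont_real; exact: cvg_id].
Qed.

(* [dG phi] is the [r]-derivative of [- i expi (a phi) r ^ (n + 1 - a) / (w + r) ^ (n + 1)],
   which vanishes at both ends. *)
Lemma rotation_derivative_integral0 : cint mu Rp (dG phi) = 0.
Proof.
pose B r : R[i] := - (0 +i* 1) * expi (a * phi) *
  ((r `^ (n.+1%:R - a))%:C * (w phi + r%:C)^-1 ^+ n.+1).
have n1a : 0 < n.+1%:R - a by rewrite subr_gt0.
apply: (@cFTC_0y _ B _ (fun r => K ^+ n.+1 * (r `^ (n.+1%:R - a) * (1 + r)^-1 ^+ n.+1))).
- move=> r r0; have wr0 := wr (ltW r0).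
  have dV := cderV (cderD (cder_cst (w phi) r) (cder_real (is_derive_id r (1:R)))) wr0.
  have dP := cder_real (is_derive1_powR (n.+1%:R - a) r0).
  apply: (cder_eq (cderM (cder_cst _ _) (cderM dP (cderX n dV)))).
  have -> : n.+1%:R - a - 1 = n%:R - a by rewrite -natr1; ring.
  have -> : r `^ (n.+1%:R - a) = r * r `^ (n%:R - a).
    by rewrite (_ : n%:R - a = n.+1%:R - a - 1) ?mulr_powRB1 ?(ltW r0)// -natr1; ring.
  rewrite /dG /kern !exprS; move: (_ ^+ n) => P.
  rewrite !rmorphM rmorphB/= rmorph_nat.
  by field; exact: wr0.
- move=> r r0; have wr0 := wr (ltW r0).
  have cV : ccont (fun r : R => (w phi + r%:C)^-1) r by apply: ccontV.
  apply: ccontM.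
    apply: ccontM; first exact: ccont_cst.
    apply: ccontM; last exact: ccontX.
    by apply: ccont_real; apply: der_cont (is_derive1_powR _ r0).
  by apply: ccontB; [exact: ccont_cst|apply: ccontM; [exact: ccont_cst|]].
- exact: dG_integrable.
- move=> r r0; rewrite /B !Normc.normcM normcN normc_i normc_expi !mul1r.
  rewrite normc_real ger0_norm ?powR_ge0// normcX mulrCA.
  rewrite ler_wpM2l ?powR_ge0// -exprMn.
  apply: lerXn2r; [by rewrite nnegrE normc_ge0| |exact: Vle (ltW r0)].
  rewrite nnegrE; apply: mulr_ge0; first exact: ltW.
  by rewrite invr_ge0; apply/ltW/addr_gt0.
- apply: (@squeeze_cvgr _ _ _ _ (fun=> 0) (fun r => K ^+ n.+1 * r `^ (n.+1%:R - a))).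
  + near=> r; have r0 : 0 < r by near: r; exact: nbhs_right_gt.
    have v0 : 0 <= (1 + r)^-1 by rewrite invr_ge0 addr_ge0// ltW.
    have k0 : 0 <= K ^+ n.+1 by apply: exprn_ge0; exact: ltW.
    have vn0 : 0 <= (1 + r)^-1 ^+ n.+1 by exact: exprn_ge0.
    apply/andP; split.
      by apply: mulr_ge0 => //; apply: mulr_ge0 => //; exact: powR_ge0.
    rewrite ler_wpM2l// ler_piMr ?powR_ge0//.
    by apply: exprn_ile1 => //; apply: inv1D_le1; exact: ltW.
  + exact: cvg_cst.
  + rewrite -[X in _ --> X](mulr0 (K ^+ n.+1)); apply: cvgM; first exact: cvg_cst.
    exact: powR_cvg0.
- apply: (@squeeze_cvgr _ _ _ _ (fun=> 0) (fun r => K ^+ n.+1 * (1 + r) `^ (- a))).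
  + near=> r; have r0 : 0 < r by near: r; exact: nbhs_pinfty_gt.
    have r1 : 0 < 1 + r by rewrite addr_gt0.
    have v0 : 0 <= (1 + r)^-1 by rewrite invr_ge0 ltW.
    have k0 : 0 <= K ^+ n.+1 by apply: exprn_ge0; exact: ltW.
    have vn0 : 0 <= (1 + r)^-1 ^+ n.+1 by exact: exprn_ge0.
    apply/andP; split.
      by apply: mulr_ge0 => //; apply: mulr_ge0 => //; exact: powR_ge0.
    rewrite ler_wpM2l//.
    have -> : (1 + r) `^ (- a) = (1 + r) `^ (n.+1%:R - a) * (1 + r)^-1 ^+ n.+1.
      rewrite exprVn -powR_invn ?(ltW r1)// -powRD ?(gt_eqF r1) ?implybT//.
      by congr (_ `^ _); ring.
    rewrite ler_wpM2r ?exprn_ge0// ge0_ler_powR ?nnegrE ?(ltW r0) ?(ltW r1) ?(ltW n1a)//.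
    by rewrite lerDr.
  + exact: cvg_cst.
  + rewrite -[X in _ --> X](mulr0 (K ^+ n.+1)); apply: cvgM; first exact: cvg_cst.
    exact: cvg_powRN1D.
Unshelve. all: by end_near. Qed.

End at_angle.

Variable beta : R.
Hypothesis mbeta : forall phi, - beta < phi < beta -> m <= rho * (1 + cos phi).

(** [pr] stands for the real or the imaginary part; its four properties are what the differentiation
    of a real parametric integral uses. *)
Let rotation_der (pr : R[i] -> R) :
  (forall (f : R -> R[i]) (t : R) l, cder f t l -> is_derive t 1 (fun x => pr (f x)) (pr l)) ->
  (forall z, `|pr z| <= Normc.normc z) ->
  (forall (f : R -> R[i]), cintegrable mu Rp f -> mu.-integrable Rp (EFin \o (fun x => pr (f x)))) ->
  (forall (f : R -> R[i]), cint mu Rp f = 0 -> \int[mu]_(x in Rp) pr (f x) = 0) ->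
  forall phi, - beta < phi < beta ->
    is_derive phi 1 (fun psi => \int[mu]_(r in Rp) pr (G psi r)) 0.
Proof.
move=> pr1 pr2 pr3 pr4 phi bphi.
have wr psi r : - beta < psi < beta -> 0 < r -> w psi + r%:C != 0.
  move=> /mbeta h r0; apply: (@slit_add_neq0 _ m rho) => //.
  - by rewrite gapw.
  - by rewrite normw.
  - exact: ltW.
have dpr psi r : - beta < psi < beta -> 0 < r ->
    is_derive psi 1 (fun x => pr (G x r)) (pr (dG psi r)).
  by move=> bpsi r0; apply: pr1; apply: cder_G; exact: wr.
have pdE psi r : - beta < psi < beta -> 0 < r ->
    partial1of2 (fun x r => pr (G x r)) psi r = pr (dG psi r).
  by move=> bpsi r0; rewrite partial1of2E; have := dpr psi r bpsi r0 => -[].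
have Ibeta (psi : R) : `]- beta, beta[%classic psi = (- beta < psi < beta) :> Prop.
  by rewrite /= in_itv.
have h1 : `]- beta, beta[%classic phi by rewrite Ibeta.
have h2 psi : `]- beta, beta[%classic psi -> mu.-integrable Rp (EFin \o (fun r => pr (G psi r))).
  by rewrite Ibeta => bpsi; apply: pr3; apply: rotation_integrable; exact: mbeta.
have h3 psi r : `]- beta, beta[%classic psi -> Rp r -> derivable (fun x => pr (G x r)) psi 1.
  by rewrite Ibeta Rp_gt0 => bpsi r0; have := dpr psi r bpsi r0 => -[].
have h4 : mu.-integrable Rp (EFin \o (fun r => `|bnd r|)).
  exact: (integrable_norm bnd_int).
have h5 psi r : `]- beta, beta[%classic psi -> Rp r ->
    `|partial1of2 (fun x r => pr (G x r)) psi r| <= `|bnd r|.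
  rewrite Ibeta Rp_gt0 => bpsi r0; rewrite pdE// (le_trans (pr2 _))//.
  by rewrite (le_trans _ (ler_norm _))// rotation_derivative_le ?(ltW r0)//; exact: mbeta.
have d1 := derivable_under_integral measurable_Rp h1 h2 h3 (fun r => normr_ge0 (bnd r)) h4 h5.
have d2 := differentiation_under_integral measurable_Rp h1 h2 h3 (fun r => normr_ge0 (bnd r)) h4 h5.
apply: DeriveDef; first exact: d1.
rewrite -derive1E d2 -[RHS](pr4 (dG phi)); last by apply: rotation_derivative_integral0; exact: mbeta.
by apply: eq_Rintegral => r /set_mem; rewrite Rp_gt0; exact: pdE.
Qed.

Let rotation_const (H : R -> R) :
  (forall phi, - beta < phi < beta -> is_derive phi 1 H 0) ->
  forall phi, - beta < phi < beta -> H phi = H 0.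
Proof.
move=> dH phi /andP[b1 b2].
have FTC (x y : R) : x < y -> - beta < x -> y < beta -> H y - H x = 0.
  move=> xy bx yb.
  have dHz z : x <= z <= y -> is_derive z 1 H 0.
    move=> /andP[xz zy]; apply: dH.
    by rewrite (lt_le_trans bx)// (le_lt_trans zy).
  have cHz z : x <= z <= y -> continuous_at z (fun=> 0 : R).
    by move=> _; exact: cst_continuous.
  by rewrite -(FTC_cc xy dHz cHz) Rintegral_cst// mul0r.
have [p0|p0|->//] := ltgtP 0 phi.
- by apply/eqP; rewrite -subr_eq0; apply/eqP; apply: FTC; lra.
- by apply/esym/eqP; rewrite -subr_eq0; apply/eqP; apply: FTC; lra.
Qed.

Lemma rotation_invariance phi : - beta < phi < beta ->
  cint mu Rp (G phi) = cint mu Rp (G 0).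
Proof.
move=> bphi; apply: complex_ext.
- have d := @rotation_der (@complex.Re R) (fun f t l => @proj1 _ _) (@abs_Re_le R)
    (fun f => @proj1 _ _) (fun f h => congr1 (@complex.Re R) h).
  exact: (rotation_const d bphi).
- have d := @rotation_der (@complex.Im R) (fun f t l => @proj2 _ _) (@abs_Im_le R)
    (fun f => @proj2 _ _) (fun f h => congr1 (@complex.Im R) h).
  exact: (rotation_const d bphi).
Qed.

End StieltjesIdentity.

Section StieltjesTheorem.
Context {R : realType}.
Notation mu := (@lebesgue_measure R).
Notation Rp := (`]0, +oo[%classic : set R).

Theorem stieltjes (a : R) (n : nat) (w : R[i]) : 0 < a -> a < n.+1%:R -> slit_plane w ->
  cint mu Rp (kern a n w) = (stieltjes_const a n)%:C * cpow (- a) w.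
Proof.
move=> a0 an sw; have rho0 := slit_normc_gt0 sw.
have [/andP[p1 p2] wE] := carg_polar sw.
set rho := Normc.normc w in rho0 wE; set phi := carg w in p1 p2 wE.
(* An angle strictly between [|phi|] and [pi]: on []- beta, beta[] the cosine stays above
   [cos beta > -1], so the gap to the cut is bounded below by [m], and the interval contains both 0
   and [phi]. *)
pose beta := (`|phi| + pi) / 2.
have pb : `|phi| < beta < pi.
  have : `|phi| < pi by rewrite ltr_norml p1.
  by rewrite /beta => h; apply/andP; split; lra.
have b0 : 0 < beta by case/andP: pb => + _; apply: le_lt_trans.
have cb : -1 < cos beta.
  rewrite -cospi ltr_cos ?in_itv/= ?lexx ?pi_ge0 ?(ltW b0)//=; first by case/andP: pb.
  by case/andP: pb => _ /ltW.
pose m := rho * (1 + cos beta).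
have m0 : 0 < m by rewrite mulr_gt0// -(opprK (cos beta)) subr_gt0 ltrNl.
have mb psi : - beta < psi < beta -> m <= rho * (1 + cos psi).
  move=> bpsi; rewrite ler_wpM2l ?(ltW rho0)// lerD2l.
  have : `|psi| < beta by rewrite ltr_norml.
  move=> pb'; have -> : cos psi = cos `|psi|.
    by have [|] := lerP 0 psi => h; [rewrite ger0_norm|rewrite ltr0_norm// cosN].
  case/andP: pb => _ bpi.
  by rewrite ltW// ltr_cos ?in_itv/= ?normr_ge0 ?(ltW b0) ?(ltW bpi) ?(ltW (lt_trans pb' bpi)).
have bphi : - beta < phi < beta by rewrite -ltr_norml; case/andP: pb.
have := rotation_invariance a0 an rho0 m0 mb bphi.
have sr : slit_plane (rho%:C) by rewrite /slit_plane /= => -[_]; rewrite leNgt rho0.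
have kr := kern_integrable a0 an sr; have kw := kern_integrable a0 an sw.
rewrite -wE cintZ//.
rewrite expi0 mulr1 mulr0 expi0.
have -> : cint mu Rp (fun r => 1 * kern a n rho%:C r) =
    (stieltjes_const a n * rho `^ (- a))%:C.
  have kE r : kern a n rho%:C r = (r `^ (n%:R - a) * (rho + r)^-1 ^+ n.+1)%:C.
    by rewrite /kern -rmorphD -fmorphV -rmorphXn -rmorphM.
  apply: complex_ext => /=.
  - have := stieltjes_real a0 an rho0; rewrite /Rintegral => /(congr1 fine) /= <-.
    by congr fine; apply: eq_integral => r _; rewrite mul1r kE.
  - rewrite -[RHS](mul0r (fine (mu Rp))) -Rintegral_cst; last exact: measurable_Rp.
    by apply: eq_Rintegral => r _; rewrite mul1r kE.
move=> e; rewrite cpow_polar// -/rho -/phi mulNr.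
have ee : expi (- (a * phi)) * expi (a * phi) = 1 by rewrite -expiD addNr expi0.
rewrite -[LHS]mul1r -ee -mulrA e rmorphM/=; ring.
Qed.

End StieltjesTheorem.

(** * Complex powers of matrices *)

Section ComplexFubini.
Context d1 d2 (T1 : measurableType d1) (T2 : measurableType d2) (R : realType).
Variable m1 : {sigma_finite_measure set T1 -> \bar R}.
Variable m2 : {sigma_finite_measure set T2 -> \bar R}.
Variables (D1 : set T1) (D2 : set T2).
Hypotheses (mD1 : measurable D1) (mD2 : measurable D2).
Hypothesis D1oo : (m1 D1 < +oo)%E.
Variables (K : T1 * T2 -> R[i]) (h : T2 -> R).
Hypothesis mK : cmeas K.
Hypothesis hi : m2.-integrable D2 (EFin \o h).
Hypothesis Kh : forall x y, D1 x -> D2 y -> Normc.normc (K (x, y)) <= h y.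

Section component.
Variable k : T1 * T2 -> R.
Hypothesis mk : measurable_fun setT k.
Hypothesis kK : forall z, `|k z| <= Normc.normc (K z).

Let kh x y : D1 x -> D2 y -> `|k (x, y)| <= h y.
Proof. by move=> D1x D2y; exact: le_trans (kK _) (Kh D1x D2y). Qed.

Let h0 x y : D1 x -> D2 y -> 0 <= h y.
Proof. by move=> D1x D2y; exact: le_trans (normr_ge0 _) (kh D1x D2y). Qed.

Let mk1 x : measurable_fun setT (fun y => k (x, y)).
Proof. by apply: (measurableT_comp mk); exact: measurable_pair1. Qed.

Let mk2 y : measurable_fun setT (fun x => k (x, y)).
Proof. by apply: (measurableT_comp mk); exact: measurable_pair2. Qed.

Let k1 x : D1 x -> m2.-integrable D2 (fun y => (k (x, y))%:E).
Proof.
move=> D1x; apply: le_integrable hi => //.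
  by apply/measurable_EFinP; exact: measurable_funTS.
by move=> y D2y; rewrite /= lee_fin (le_trans (kh D1x D2y))// ler_norm.
Qed.

Let k2 y : D2 y -> m1.-integrable D1 (fun x => (k (x, y))%:E).
Proof.
move=> D2y; have ic : m1.-integrable D1 (fun=> (h y)%:E).
  apply/integrableP; split; first exact: measurable_cst.
  by rewrite integral_cst//= lte_mul_pinfty// lee_fin normr_ge0.
apply: le_integrable ic => //.
  by apply/measurable_EFinP; exact: measurable_funTS.
by move=> x D1x; rewrite /= lee_fin (le_trans (kh D1x D2y))// ler_norm.
Qed.

Let Ihoo : (\int[m2]_(y in D2) `|h y|%:E < +oo)%E.
Proof. by have /integrableP[_] := hi. Qed.

Let mh : measurable_fun D2 (fun y => `|h y|%:E).
Proof.
by have := measurable_int _ hi; move/measurable_EFinP => h1; apply/measurable_EFinP; exact: measurableT_comp.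
Qed.

Let k12 : (\int[m1]_(x in D1) \int[m2]_(y in D2) `|k (x, y)|%:E < +oo)%E.
Proof.
apply: (@le_lt_trans _ _ (\int[m1]_(x in D1) \int[m2]_(y in D2) `|h y|%:E)%E).
  apply: ge0_le_integral => //.
  - by move=> x _; apply: integral_ge0 => y _; rewrite lee_fin.
  - pose kk (z : T1 * T2) : \bar R := (((fun z => `|k z|%:E) \_ (setT `*` D2)) z)%E.
    have mkk : measurable_fun setT kk.
      apply/(measurable_restrictT _ (measurableX measurableT mD2)).
      by apply: measurable_funTS; apply/measurable_EFinP; exact: measurableT_comp.
    have kk0 z : (0 <= kk z)%E.
      by rewrite /kk patchE; case: ifPn => //; rewrite lee_fin.
    have := measurable_fun_fubini_tonelli_F (m2 := m2) kk mkk kk0.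
    move/(@measurable_funTS _ _ _ _ D1); apply: eq_measurable_fun => x _.
    rewrite /fubini_F [RHS]integral_mkcond; apply: eq_integral => y _.
    rewrite /kk !patchE; case: ifPn => [/set_mem[_ /= D2y]|/negP n2]; first by rewrite mem_set.
    by case: ifPn => // /set_mem D2y; case: n2; rewrite mem_set.
  - move=> x D1x; apply: ge0_le_integral => //.
    + by apply/measurable_EFinP; apply: measurable_funTS; exact: measurableT_comp.
    + by move=> y D2y; rewrite lee_fin (le_trans (kh D1x D2y))// ler_norm.
have I0 : (0 <= \int[m2]_(y in D2) `|h y|%:E)%E.
  by apply: integral_ge0 => y _; rewrite lee_fin.
have If : (\int[m2]_(y in D2) `|h y|%:E)%E \is a fin_num by rewrite ge0_fin_numE.
by rewrite integral_cst//; exact: lte_mul_pinfty.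
Qed.

(** Stated for a real [k] dominated by [K], so that it applies to both parts of a complex kernel
    and, in the probabilistic part, to real kernels. *)
Lemma bounded_fubini :
  \int[m1]_(x in D1) (\int[m2]_(y in D2) k (x, y)) =
  \int[m2]_(y in D2) (\int[m1]_(x in D1) k (x, y)).
Proof. exact: (fubini_on mD1 mD2 mk k1 k2 k12). Qed.

Lemma bounded_fubini_integrable1 :
  m1.-integrable D1 (fun x => (\int[m2]_(y in D2) k (x, y))%:E).
Proof. exact: (fubini_on_integrable mD1 mD2 mk k1 k12). Qed.

Lemma bounded_fubini_integrable2 :
  m2.-integrable D2 (fun y => (\int[m1]_(x in D1) k (x, y))%:E).
Proof.
have mks : measurable_fun setT (fun z : T2 * T1 => k (z.2, z.1)).
  by apply: (measurableT_comp mk); exact: measurable_swap.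
apply: (fubini_on_integrable mD2 mD1 mks k2).
have mka : measurable_fun setT (fun z : T1 * T2 => (`|k z|%:E)%E).
  by apply/measurable_EFinP; exact: measurableT_comp.
have k0 x y : D1 x -> D2 y -> (0 <= (`|k (x, y)|)%:E)%E by rewrite lee_fin.
by rewrite -(tonelli_on m1 m2 mD1 mD2 mka k0).
Qed.

End component.

Let mRe : measurable_fun setT (fun z => complex.Re (K z)). Proof. by case: mK. Qed.
Let mIm : measurable_fun setT (fun z => complex.Im (K z)). Proof. by case: mK. Qed.
Let bRe z : `|complex.Re (K z)| <= Normc.normc (K z). Proof. exact: abs_Re_le. Qed.
Let bIm z : `|complex.Im (K z)| <= Normc.normc (K z). Proof. exact: abs_Im_le. Qed.

Lemma cfubini : cint m1 D1 (fun x => cint m2 D2 (fun y => K (x, y))) =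
  cint m2 D2 (fun y => cint m1 D1 (fun x => K (x, y))).
Proof.
apply: complex_ext.
- exact: (bounded_fubini mRe bRe).
- exact: (bounded_fubini mIm bIm).
Qed.

Lemma cfubini_integrable1 : cintegrable m1 D1 (fun x => cint m2 D2 (fun y => K (x, y))).
Proof.
split.
- exact: (bounded_fubini_integrable1 mRe bRe).
- exact: (bounded_fubini_integrable1 mIm bIm).
Qed.

Lemma cfubini_integrable2 : cintegrable m2 D2 (fun y => cint m1 D1 (fun x => K (x, y))).
Proof.
split.
- exact: (bounded_fubini_integrable2 mRe bRe).
- exact: (bounded_fubini_integrable2 mIm bIm).
Qed.

End ComplexFubini.

(** * Interchanging a contour integral with Stieltjes' integral *)

Section PathStieltjes.
Context {R : realType}.
Notation mu := (@lebesgue_measure R).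
Notation Rp := (`]0, +oo[%classic : set R).

Lemma ccont_measurable (f : R -> R[i]) : (forall t, ccont f t) ->
  cmeas (f : measurableTypeR R -> R[i]).
Proof.
by move=> cf; split; apply: continuous_measurable_fun => t; case: (cf t).
Qed.

Variables (g : R -> R[i]) (n : nat) (s : nat -> R) (q : nat -> R -> R[i]).
Hypothesis dec : decomposition g n s q.
Hypothesis gslit : forall z, on_path g z -> slit_plane z.

Section piece.
Variable k : nat.
Hypothesis kn : (k < n)%N.

Let sk : s k <= s k.+1. Proof. by rewrite ltW// (decomp_lt dec). Qed.

Let qslit t : s k <= t <= s k.+1 -> slit_plane (q k t).
Proof. by move=> tk; apply: gslit; apply: (decomp_on_path dec kn). Qed.

Let cq t : ccont (q k) t. Proof. exact: C1_cont (decomp_C1 dec kn). Qed.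

(** A piece is compact and avoids the cut, so the continuous functions [|w| + Re w] and [|w|] attain
    a positive minimum and a maximum on it. *)
Lemma piece_gap : exists m, [/\ 0 < m & exists M, 0 < M /\
  forall t, s k <= t <= s k.+1 -> m <= Normc.normc (q k t) + complex.Re (q k t) /\
    Normc.normc (q k t) <= M].
Proof.
have cN t : continuous_at t (fun t => Normc.normc (q k t)) by exact: continuous_normc.
have cG t : continuous_at t (fun t => Normc.normc (q k t) + complex.Re (q k t)).
  by apply: cont_add => //; case: (cq t).
have [c1 c1k h1] := EVT_min sk (cont_within (fun t _ => cG t) (D := `[s k, s k.+1])).
have [c2 c2k h2] := EVT_max sk (cont_within (fun t _ => cN t) (D := `[s k, s k.+1])).
have s1 : slit_plane (q k c1) by apply: qslit; move: c1k; rewrite in_itv.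
have s2 : slit_plane (q k c2) by apply: qslit; move: c2k; rewrite in_itv.
eexists; split; first exact: slit_gap_gt0 s1.
exists (Normc.normc (q k c2)); split; first exact: slit_normc_gt0.
by move=> t tk; split; [apply: h1|apply: h2]; rewrite in_itv.
Qed.

Variables (a : R) (N : nat) (f : R[i] -> R[i]).
Hypotheses (a0 : 0 < a) (aN : a < N.+1%:R).
Hypothesis cf : forall t, s k <= t <= s k.+1 -> ccont (fun t => f (q k t)) t.
Hypothesis mf : cmeas (fun t : measurableTypeR R => f (q k t)).

Let K (z : measurableTypeR R * measurableTypeR R) : R[i] :=
  kern a N (q k z.1) z.2 * (f (q k z.1) * dpath (q k) z.1).

Let mdp : cmeas (fun t : measurableTypeR R => dpath (q k) t).
Proof. by apply: ccont_measurable => t; exact: C1_ccont (decomp_C1 dec kn). Qed.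

Let comp1 (u : R -> R[i]) : cmeas (u : measurableTypeR R -> R[i]) ->
  cmeas (fun z : measurableTypeR R * measurableTypeR R => u z.1).
Proof.
by move=> [u1 u2]; split; [exact: (measurableT_comp u1 measurable_fst)|
  exact: (measurableT_comp u2 measurable_fst)].
Qed.

Let mK : cmeas K.
Proof.
apply: cmeasM.
  apply: cmeas_kern; first exact: measurable_snd.
  by apply: comp1; exact: ccont_measurable.
apply: cmeasM; first exact: (comp1 mf).
exact: (comp1 mdp).
Qed.

Let Kbound : exists c : R, forall t r, `[s k, s k.+1]%classic t -> Rp r ->
  Normc.normc (K (t, r)) <= c * (r `^ (N%:R - a) * (1 + r)^-1 ^+ N.+1).
Proof.
have [m [m0 [M [M0 hmM]]]] := piece_gap.
have cN t : s k <= t <= s k.+1 ->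
    continuous_at t (fun t => Normc.normc (f (q k t) * dpath (q k) t)).
  move=> tk; apply: continuous_normc; apply: ccontM; first exact: cf.
  exact: C1_ccont (decomp_C1 dec kn).
have [c ck h] := EVT_max sk (cont_within (D := `[s k, s k.+1]) (fun t tk => cN t tk)).
exists ((gap_const m M)^-1 ^+ N.+1 * Normc.normc (f (q k c) * dpath (q k) c)).
move=> t r tk; rewrite Rp_gt0 => r0.
have tk' : s k <= t <= s k.+1 by move: tk; rewrite /= in_itv.
have [mq qM] := hmM t tk'.
rewrite /K Normc.normcM mulrAC; apply: ler_pM; rewrite ?normc_ge0//.
  by apply: kern_le => //; exact: ltW.
by apply: h; rewrite in_itv.
Qed.

Let seg_finite : (mu `[s k, s k.+1]%classic < +oo)%E.
Proof. by rewrite lebesgue_measure_itv/=; case: ifP => _; rewrite ?ltry// -EFinB ltry. Qed.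

Lemma piece_fubini :
  [/\ cint mu `[s k, s k.+1] (fun t => cint mu Rp (fun r => K (t, r))) =
        cint mu Rp (fun r => cint mu `[s k, s k.+1] (fun t => K (t, r))),
      cintegrable mu `[s k, s k.+1] (fun t => cint mu Rp (fun r => K (t, r))) &
      cintegrable mu Rp (fun r => cint mu `[s k, s k.+1] (fun t => K (t, r)))].
Proof.
have [c Kc] := Kbound.
have hi := kern_bound_integrable c a0 aN.
have ms : measurable (`[s k, s k.+1]%classic : set (measurableTypeR R)) by exact: measurable_itv.
split.
- exact: (cfubini (m1 := mu) (m2 := mu) ms measurable_Rp seg_finite mK hi Kc).
- exact: (cfubini_integrable1 (m1 := mu) (m2 := mu) ms measurable_Rp seg_finite mK hi Kc).
- exact: (cfubini_integrable2 (m1 := mu) (m2 := mu) ms measurable_Rp seg_finite mK hi Kc).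
Qed.

End piece.

Variables (a : R) (N : nat) (f : R[i] -> R[i]).
Hypotheses (a0 : 0 < a) (aN : a < N.+1%:R).
Hypothesis cf : path_cont n s q f.
Hypothesis mf : forall k, (k < n)%N -> cmeas (fun t : measurableTypeR R => f (q k t)).

Let C := (stieltjes_const a N)^-1%:C.

Let cpowE k t : (k < n)%N -> s k <= t <= s k.+1 ->
  C * cint mu Rp (fun r => kern a N (q k t) r * (f (q k t) * dpath (q k) t)) =
  cpow (- a) (q k t) * f (q k t) * dpath (q k) t.
Proof.
move=> kn tk; have sq : slit_plane (q k t) by apply: gslit; exact: (decomp_on_path dec kn).
transitivity (C * ((f (q k t) * dpath (q k) t) * cint mu Rp (kern a N (q k t)))).
  congr (_ * _); rewrite -cintZ//; last exact: kern_integrable.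
  by apply: eq_cint => r _; rewrite mulrC.
rewrite stieltjes//; have c0 : (stieltjes_const a N)%:C != 0.
  by rewrite fmorph_eq0 gt_eqF// stieltjes_const_gt0.
have -> : C = (stieltjes_const a N)%:C^-1 by rewrite /C -fmorphV.
move: (_%:C) c0 => c c0; move: (cpow _ _) (f _) (dpath _ _) => x y z.
by field; exact: c0.
Qed.

(** Integrability is read off the Stieltjes representation through Fubini, so that continuity of the
    principal branch along the path does not enter. *)
Lemma cpow_path_integrable : path_integrable n s q (fun w => cpow (- a) w * f w).
Proof.
move=> k kn; have [_ i1 _] := piece_fubini kn a0 aN (fun t => @cf k t kn) (mf kn).
apply: eq_cintegrable (cintegrableZ _ C i1) => //.
by move=> t; rewrite /= in_itv/=; exact: cpowE.
Qed.

Lemma contour_cpow :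
  contour_integral g (fun w => cpow (- a) w * f w) =
  C * cint mu Rp (fun r => (r `^ (N%:R - a))%:C *
    contour_integral g (fun w => (w + r%:C)^-1 ^+ N.+1 * f w)) /\
  cintegrable mu Rp (fun r => (r `^ (N%:R - a))%:C *
    contour_integral g (fun w => (w + r%:C)^-1 ^+ N.+1 * f w)).
Proof.
pose I k r : R[i] := cint mu `[s k, s k.+1]
  (fun t => kern a N (q k t) r * (f (q k t) * dpath (q k) t)).
have piF k (kn : (k < n)%N) := piece_fubini kn a0 aN (fun t => @cf k t kn) (mf kn).
have rE r : Rp r -> \sum_(k < n) I k r = (r `^ (N%:R - a))%:C *
    contour_integral g (fun w => (w + r%:C)^-1 ^+ N.+1 * f w).
  rewrite Rp_gt0 => r0.
  have ci : path_integrable n s q (fun w => (w + r%:C)^-1 ^+ N.+1 * f w).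
    apply: (path_cont_integrable dec); apply: path_contM => //; apply: path_contX.
    have -> : (fun w : R[i] => (w + r%:C)^-1) = (fun w => (w - (- r%:C))^-1).
      by apply/funext => w; rewrite opprK.
    apply: (path_contV dec) => /gslit; apply; split => /=; first by rewrite oppr0.
    by rewrite oppr_le0 ltW.
  rewrite (contour_sum dec)// mulr_sumr; apply: eq_bigr => -[k kn] _ /=.
  rewrite -cintZ//; last exact: ci.
  by apply: eq_cint => t _; rewrite /kern; ring.
have iI (k : 'I_n) : cintegrable mu Rp (I k) by have [] := piF k (ltn_ord k).
split; last first.
  apply: eq_cintegrable (cintegrable_sum measurable_Rp (index_enum 'I_n) iI).
    exact: measurable_Rp.
  exact: rE.
rewrite (contour_sum dec); last exact: cpow_path_integrable.
transitivity (C * \sum_(k < n) cint mu Rp (I k)).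
  rewrite mulr_sumr; apply: eq_bigr => -[k kn] _ /=.
  have [e i1 _] := piF k kn.
  have mseg : measurable (`[s k, s k.+1]%classic : set (measurableTypeR R)) by exact: measurable_itv.
  apply: etrans (congr1 (fun z => C * z) e); apply: etrans (cintZ mseg C i1).
  by apply: eq_cint => t; rewrite /= in_itv/= => tk; rewrite -cpowE.
congr (_ * _); rewrite -cint_sum//.
exact: eq_cint.
Qed.

End PathStieltjes.

Section MatrixPower.
Context {R : realType}.
Notation mu := (@lebesgue_measure R).
Notation Rp := (`]0, +oo[%classic : set R).

Lemma two_pi_i_neq0 : two_pi_i != 0 :> R[i].
Proof. by rewrite /two_pi_i eq_complex/= eqxx/= mulf_neq0// gt_eqF// pi_gt0. Qed.

(** Stieltjes' formula needs a positive exponent, which [theta + 1] is and [theta] may fail to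
    be. *)
Lemma cpowS (theta : R) (w : R[i]) : slit_plane w ->
  cpow (- theta) w = w * cpow (- (theta + 1)) w.
Proof.
move=> sw; have N0 := slit_normc_gt0 sw; have [_ wE] := carg_polar sw.
rewrite [X in X * _]wE !cpow_polar//.
have -> : (Normc.normc w) `^ (- theta) = Normc.normc w * Normc.normc w `^ (- (theta + 1)).
  have -> : - (theta + 1) = - theta - 1 by ring.
  rewrite powRB; last by rewrite (gt_eqF N0) implybT.
  by rewrite powRr1 ?ltW// mulrC divfK// gt_eqF.
have -> : - theta * carg w = carg w + - (theta + 1) * carg w by ring.
by rewrite expiD rmorphM/=; ring.
Qed.

Section admissible.
Variables (p : nat) (A : 'M[R[i]]_p.+1) (B : R -> 'M[R[i]]_p.+1).
Hypothesis AB : forall r, 0 < r -> B r * (A + (r%:C)%:M) = 1.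
Variable g : R -> R[i].
Hypothesis adm : admissible_contour slit_plane A g.

Let gslit z : on_path g z -> slit_plane z.
Proof. by move=> gz; apply: contrapT => h; have [_ /(_ z h)[]] := adm. Qed.

Lemma contour_mx_cpow (theta : R) (N : nat) (j k : 'I_p.+1) :
  0 < theta + 1 -> theta + 1 < N.+1%:R ->
  cintegrable mu Rp (fun r => (r `^ (N%:R - (theta + 1)))%:C * (A * B r ^+ N.+1) j k) /\
  contour_mx (cpow (- theta)) A g j k =
    (stieltjes_const (theta + 1) N)^-1%:C *
    cint mu Rp (fun r => (r `^ (N%:R - (theta + 1)))%:C * (A * B r ^+ N.+1) j k).
Proof.
move=> a0 aN; have [[pw g01 _] pin enc] := adm.
have [n [s [q dec]]] := piecewise_decomposition pw.
have [rs charA] := closed_field_poly_normal (char_poly A).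
rewrite (monicP (char_poly_monic A)) scale1r in charA.
have W z : winding g z = pole_int g z / two_pi_i by [].
have in_path z : z \in rs -> ~ on_path g z /\ pole_int g z = two_pi_i.
  move=> zrs; have [|gz Wz] := enc z.
    by rewrite eigenvalue_root_char charA root_prod_XsubC.
  split => //; move: Wz; rewrite W => /(canRL (divfK two_pi_i_neq0)) ->.
  by rewrite mul1r.
have gb r : 0 < r -> ~ on_path g (- r%:C) /\ pole_int g (- r%:C) = 0.
  move=> r0; have [|gz Wz] := pin (- r%:C).
    (* The pole [- r] lies on the cut, so [path_inside] puts it off the path with winding number
       0. *)
    by apply; split => /=; rewrite ?oppr0 // oppr_le0 ltW.
  split => //; move: Wz; rewrite W => /(canRL (divfK two_pi_i_neq0)) ->.
  by rewrite mul0r.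
set a := theta + 1 in a0 aN *.
(* The interchange is made on each term of the Newton expansion: every [f l] is an explicit rational
   function, continuous along the path and measurable in the parameter on the whole line. The terms
   are put together again afterwards. *)
pose P l := poles (take l.+1 rs).
pose c l : R[i] := horner_mx A (newton_poly rs l) j k.
pose f l (w : R[i]) := w * P l w.
have cP l : path_cont n s q (P l).
  by apply: (path_cont_poles dec) => z /mem_take/in_path[].
have cf l : path_cont n s q (f l) by apply: path_contM => //; exact: path_cont_id dec.
have mf l m : (m < n)%N -> cmeas (fun t : measurableTypeR R => f l (q m t)).
  move=> mn; have mq : cmeas (q m : measurableTypeR R -> R[i]).
    by apply: ccont_measurable => t; exact: C1_cont (decomp_C1 dec mn).
  apply: cmeasM => //; apply: cmeas_prod => z.
  by apply: cmeasV; apply: cmeasD => //; exact: cmeas_cst.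
have CC l := contour_cpow dec gslit a0 aN (cf l) (mf l).
have e r : Rp r -> \sum_(l < size rs) c l * ((r `^ (N%:R - a))%:C *
     contour_integral g (fun w => (w + r%:C)^-1 ^+ N.+1 * f l w)) =
    two_pi_i * ((r `^ (N%:R - a))%:C * (A * B r ^+ N.+1) j k).
  rewrite Rp_gt0 => r0; have [gr pr] := gb r r0.
  have AB' : B r * (A - (- r%:C)%:M) = 1 by rewrite raddfN opprK AB.
  have := contour_id_pole_resolvent dec g01 charA in_path (conj gr pr) AB' N j k.
  have inv l : path_integrable n s q (fun w => (w + r%:C)^-1 ^+ N.+1 * f l w).
    apply: (path_cont_integrable dec); apply: path_contM => //; apply: path_contX.
    have -> : (fun w : R[i] => (w + r%:C)^-1) = (fun w => (w - (- r%:C))^-1).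
      by apply/funext => w; rewrite opprK.
    exact: path_contV dec _ gr.
  have -> : contour_integral g (fun w => w * (w - (- r%:C))^-1 ^+ N.+1 *
      resolvent A rs w j k) = contour_integral g (fun w => \sum_(l < size rs)
      c l * ((w + r%:C)^-1 ^+ N.+1 * f l w)).
    apply: eq_contour => w gw; rewrite resolventE mulr_sumr opprK.
    by apply: eq_bigr => l _; rewrite /f /c /P; ring.
  rewrite (contour_bigsum dec); last by move=> l; exact: path_integrableZ.
  move=> e; rewrite mulrCA -e mulr_sumr; apply: eq_bigr => l _.
  by rewrite (contourZ dec)// mulrCA.
have ie : cintegrable mu Rp (fun r => two_pi_i * ((r `^ (N%:R - a))%:C * (A * B r ^+ N.+1) j k)).
  apply: (@eq_cintegrable _ _ _ mu Rp _ _ measurable_Rp e).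
  apply: cintegrable_sum => [|l]; first exact: measurable_Rp.
  by apply: cintegrableZ; [exact: measurable_Rp|exact: (CC l).2].
have ie' : cintegrable mu Rp (fun r => (r `^ (N%:R - a))%:C * (A * B r ^+ N.+1) j k).
  apply: eq_cintegrable (cintegrableZ _ (two_pi_i^-1) ie).
  - exact: measurable_Rp.
  - by move=> r _; rewrite mulrA mulVf ?mul1r// two_pi_i_neq0.
  - exact: measurable_Rp.
split; first exact: ie'.
rewrite /contour_mx mxE.
transitivity (contour_integral g (fun w => \sum_(l < size rs) c l * (cpow (- a) w * f l w))
    / two_pi_i).
  congr (_ / _); apply: eq_contour => w gw.
  rewrite (invmx_resolvent charA in_path gw) resolventE mulr_sumr.
  apply: eq_bigr => l _; rewrite /f (cpowS _ (gslit gw)) -/a /c /P; ring.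
have ci l := cpow_path_integrable dec gslit a0 aN (cf l) (mf l).
rewrite (contour_bigsum dec); last by move=> l; exact: path_integrableZ.
have -> : \sum_(l < size rs) contour_integral g (fun w => c l * (cpow (- a) w * f l w)) =
    (stieltjes_const a N)^-1%:C * \sum_(l < size rs) (c l * cint mu Rp (fun r =>
      (r `^ (N%:R - a))%:C * contour_integral g (fun w => (w + r%:C)^-1 ^+ N.+1 * f l w))).
  rewrite mulr_sumr; apply: eq_bigr => l _.
  by rewrite (contourZ dec)// (CC l).1; ring.
rewrite -mulrA; congr (_ * _).
transitivity (cint mu Rp (fun r => \sum_(l < size rs) c l * ((r `^ (N%:R - a))%:C *
     contour_integral g (fun w => (w + r%:C)^-1 ^+ N.+1 * f l w))) / two_pi_i).
  congr (_ / _); rewrite cint_sum; last 2 first.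
  - exact: measurable_Rp.
  - by move=> l; apply: cintegrableZ; [exact: measurable_Rp|exact: (CC l).2].
  by apply: eq_bigr => l _; rewrite cintZ//; exact: (CC l).2.
rewrite (eq_cint mu e).
rewrite (cintZ _ _ ie'); last exact: measurable_Rp.
by rewrite mulrC mulrA mulVf ?mul1r// two_pi_i_neq0.
Qed.

End admissible.
End MatrixPower.

(** * Circles as simple closed paths, and their winding numbers *)

Section CircleContour.
Context {R : realType}.
Notation mu := (@lebesgue_measure R).
Implicit Types (g : R -> R[i]) (z w : R[i]) (t : R).

Lemma C1_path_of_cder g (g' : R -> R[i]) :
  (forall t, cder g t (g' t)) -> (forall t, ccont g' t) ->
  C1_path g /\ dpath g = g'.
Proof.
move=> dg cg.
have e1 : derive1 (re_path g) = fun t => complex.Re (g' t).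
  by apply/funext => t; rewrite derive1E; have [d1 _] := dg t; exact: (@derive_val _ _ _ _ _ _ _ d1).
have e2 : derive1 (im_path g) = fun t => complex.Im (g' t).
  by apply/funext => t; rewrite derive1E; have [_ d2] := dg t; exact: (@derive_val _ _ _ _ _ _ _ d2).
split.
- split.
  + by move=> t; have [d1 _] := dg t; exact: (@ex_derive _ _ _ _ _ _ _ d1).
  + by move=> t; have [_ d2] := dg t; exact: (@ex_derive _ _ _ _ _ _ _ d2).
  + by rewrite e1 => t; have [] := cg t.
  + by rewrite e2 => t; have [] := cg t.
- by apply/funext => t; rewrite /dpath e1 e2; case: (g' t).
Qed.

(** The principal logarithm on the right half-plane. Along a closed path that stays there it is a
    single-valued primitive of the logarithmic derivative, whose integral is therefore 0. *)
Definition log_right z : R[i] := (ln (sqnorm z) / 2) +i* atan (complex.Im z / complex.Re z).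

Lemma cder_log_right (v : R -> R[i]) t l : cder v t l -> 0 < complex.Re (v t) ->
  cder (fun x => log_right (v x)) t (l / v t).
Proof.
move=> dv v0; have v1 : complex.Re (v t) != 0 by rewrite gt_eqF.
have n0 : 0 < sqnorm (v t).
  by rewrite sqnorm_gt0; apply: contraNneq v1 => ->.
have [d1 d2] := dv; split.
- have dl := @is_derive1_comp _ (@ln R) (fun x => sqnorm (v x)) _ _ _ (is_derive1_ln n0) (cder_sqnorm dv).
  apply: (der_eq (der_mul dl (is_derive_cst (2^-1 : R) t (1:R)))).
  rewrite cReM cReV cImV /=.
  by field; rewrite gt_eqF.
- have dV := @der_inv _ (fun x => complex.Re (v x)) _ _ v1 d1.
  have da := @is_derive1_comp _ (@atan R) (fun x => complex.Im (v x) / complex.Re (v x)) _ _ _ (is_derive1_atan _) (der_mul d2 dV).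
  apply: (der_eq da).
  rewrite cImM cReV cImV /= /sqnorm.
  have n1 : complex.Re (v t) ^+ 2 + complex.Im (v t) ^+ 2 != 0 by rewrite gt_eqF.
  have -> : 1 + (complex.Im (v t) / complex.Re (v t)) ^+ 2 =
     (complex.Re (v t) ^+ 2 + complex.Im (v t) ^+ 2) / complex.Re (v t) ^+ 2.
    by field.
  by field; rewrite n1 v1.
Qed.

Lemma log_derivative_integral0 (v v' : R -> R[i]) :
  (forall t, cder v t (v' t)) -> (forall t, ccont v' t) ->
  (forall t, 0 < complex.Re (v t)) -> v 0 = v 1 ->
  cint mu `[0, 1] (fun t => v' t / v t) = 0.
Proof.
move=> dv cv v0 v01.
rewrite (@cFTC _ (fun t => log_right (v t))) ?v01 ?subrr//.
- by move=> t _; apply: cder_log_right.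
- move=> t _; apply: ccontM; first exact: cv.
  apply: ccontV; first exact: cder_ccont (dv t).
  by apply: contraTneq (v0 t) => ->; rewrite ltxx.
Qed.

Lemma cos_eq1 (x : R) : cos x = 1 -> `|x| < 2 * pi -> x = 0.
Proof.
have half (y : R) : cos y = 1 -> 0 < y < 2 * pi -> False.
  move=> cy yb; have : 0 < sin (y / 2) by apply: sin_gt0_pi; lra.
  have e : cos y = 1 - 2 * sin (y / 2) ^+ 2.
    rewrite {1}(_ : y = y / 2 + y / 2); last by field.
    rewrite cosD -expr2 cos2sin2 -expr2; ring.
  move: e; rewrite cy => e s0.
  by have : 0 < sin (y / 2) ^+ 2 by [rewrite exprn_gt0]; lra.
move=> cx; rewrite ltr_norml => /andP[x1 x2]; have [x0|x0|//] := ltgtP 0 x.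
- by case: (half x cx); rewrite x0.
- by case: (half (- x)); rewrite ?cosN//; lra.
Qed.

Variables (c rho : R).
Hypotheses (rho0 : 0 < rho).

Definition circle t : R[i] := c%:C + rho%:C * expi (2 * pi * t).

Let circle' t : R[i] := (0 +i* (2 * pi)) * (rho%:C * expi (2 * pi * t)).

Let cder_angle t : is_derive t 1 (fun t : R => 2 * pi * t) (2 * pi).
Proof.
apply: (der_eq (der_mul (is_derive_cst (2 * pi) t (1:R)) (is_derive_id t (1:R)))).
by rewrite mul0r add0r mulr1.
Qed.

Let ccont_expi t : ccont (fun t : R => expi (2 * pi * t)) t.
Proof. exact: cder_ccont (cder_expi (cder_angle t)). Qed.

Let cder_circle t : cder circle t (circle' t).
Proof.
apply: (cder_eq (cderD (cder_cst _ _) (cderM (cder_cst _ _) (cder_expi (cder_angle t))))).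
by apply: complex_ext; rewrite ?(cReD, cImD) !(cReM, cImM) /=; ring.
Qed.

Let ccont_circle' t : ccont circle' t.
Proof.
by apply: ccontM; [exact: ccont_cst|apply: ccontM; [exact: ccont_cst|]].
Qed.

Lemma dpath_circle t : dpath circle t = (0 +i* (2 * pi)) * (circle t - c%:C).
Proof.
rewrite (C1_path_of_cder cder_circle ccont_circle').2 /circle' /circle.
by congr (_ * _); rewrite addrC addKr.
Qed.

Lemma circle_C1 : C1_path circle.
Proof. exact: (C1_path_of_cder cder_circle ccont_circle').1. Qed.

Lemma circle01 : circle 0 = circle 1.
Proof.
by rewrite /circle mulr0 mulr1 mulr_natl /expi cos0 sin0 cos2pi sin2pi.
Qed.

Lemma normc_circle t : Normc.normc (circle t - c%:C) = rho.
Proof.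
by rewrite /circle addrC addKr Normc.normcM normc_expi mulr1 normc_real gtr0_norm.
Qed.

Lemma circle_simple_closed : simple_closed_path circle.
Proof.
split.
- exists 1%N, (fun k => k%:R), (fun=> circle); split => // -[|//] _; split => //.
    exact: circle_C1.
- exact: circle01.
- move=> t u t01 u01 e.
  have e2 : expi (2 * pi * t) = expi (2 * pi * u).
    move: e; rewrite /circle => /addrI; apply: mulfI.
    by rewrite fmorph_eq0 gt_eqF.
  have e3 : expi (2 * pi * (t - u)) = 1.
    rewrite mulrBr expiD e2 -expiD subrr expi0//.
  have : cos (2 * pi * (t - u)) = 1 by have := congr1 (@complex.Re R) e3.
  move=> /cos_eq1 h; have p0 := pi_gt0 R.
  have : 2 * pi * (t - u) = 0.
    apply: h; rewrite normrM gtr0_norm; last by rewrite mulr_gt0.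
    by rewrite gtr_pMr ?mulr_gt0// ltr_norml; lra.
  move=> /eqP; rewrite mulf_eq0 mulf_eq0 (gt_eqF p0) pnatr_eq0/= subr_eq0.
  by move=> /eqP.
Qed.

Lemma circle_contour f : contour_integral circle f =
  cint mu `[0, 1] (fun t => f (circle t) * dpath circle t).
Proof. by []. Qed.

Let far (z : R[i]) t : Normc.normc z < 1 -> 0 < complex.Re (1 - z * expi t).
Proof.
move=> z1; rewrite cReB subr_gt0 /=; apply: le_lt_trans z1.
by rewrite (le_trans (ler_norm _))// (le_trans (abs_Re_le _))// Normc.normcM normc_expi mulr1.
Qed.

(** With [q = rho / (z - c)], of modulus below 1, [circle t - z = - (z - c) (1 - q e ^ (2 i pi t))].
    The last factor has positive real part, so its logarithmic derivative integrates to 0. *)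
Lemma circle_outside z : rho < Normc.normc (z - c%:C) ->
  ~ on_path circle z /\ winding circle z = 0.
Proof.
move=> rz; split.
  by move=> [t _ e]; move: rz; rewrite -e normc_circle ltxx.
have z0 : z - c%:C != 0 by rewrite -normc_gt0 (lt_trans rho0).
pose q := rho%:C / (z - c%:C).
have q1 : Normc.normc q < 1.
  rewrite Normc.normcM Normc.normcV normc_real gtr0_norm//.
  by rewrite ltr_pdivrMr ?mul1r// normc_gt0.
pose v t := 1 - q * expi (2 * pi * t).
pose v' t := - (q * ((0 +i* 1) * (2 * pi)%:C * expi (2 * pi * t))).
have dv t : cder v t (v' t).
  apply: (cder_eq (cderB (cder_cst _ _) (cderM (cder_cst _ _) (cder_expi (cder_angle t))))).
  by rewrite mul0r !add0r.
rewrite /winding circle_contour.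
rewrite (_ : cint _ _ _ = cint mu `[0, 1] (fun t => v' t / v t)).
  rewrite log_derivative_integral0 ?mul0r//.
  - move=> t; apply: ccontN; apply: ccontM; first exact: ccont_cst.
    by apply: ccontM; [exact: ccont_cst|].
  - by move=> t; apply: far.
  - by rewrite /v mulr0 mulr1 mulr_natl /expi cos0 sin0 cos2pi sin2pi.
apply: eq_cint => t _; rewrite dpath_circle.
have v0 : v t != 0.
  by have : 0 < complex.Re (v t) by [exact: far]; apply: contraTneq => ->; rewrite ltxx.
have -> : circle t - z = - (z - c%:C) * v t.
  by rewrite /circle /v /q; field.
have -> : circle t - c%:C = (z - c%:C) * (q * expi (2 * pi * t)).
  by rewrite /circle /q; field.
rewrite /v'; have -> : 0 +i* (2 * pi) = (0 +i* 1) * (2 * pi)%:C :> R[i].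
  by apply: complex_ext; rewrite ?(cReM, cImM) /=; ring.
by field; rewrite z0 v0.
Qed.

(** With [q = (z - c) / rho], of modulus below 1, [circle t - z = rho e ^ (2 i pi t) (1 - q e ^ (- 2
    i pi t))]. The exponential contributes [two_pi_i] to the logarithmic derivative, the factor in
    parentheses integrates to 0. *)
Lemma circle_inside z : Normc.normc (z - c%:C) < rho -> encloses circle z.
Proof.
move=> rz; split.
  by move=> [t _ e]; move: rz; rewrite -e normc_circle ltxx.
have r0 : rho%:C != 0 by rewrite fmorph_eq0 gt_eqF.
pose q := (z - c%:C) / rho%:C.
have q1 : Normc.normc q < 1.
  rewrite Normc.normcM Normc.normcV normc_real gtr0_norm//.
  by rewrite ltr_pdivrMr ?mul1r.
pose v t := 1 - q * expi (- (2 * pi * t)).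
pose v' t := (q * ((0 +i* 1) * (2 * pi)%:C * expi (- (2 * pi * t)))).
have dv t : cder v t (v' t).
  apply: (cder_eq (cderB (cder_cst _ _) (cderM (cder_cst _ _) (cder_expi (der_opp (cder_angle t)))))).
  by rewrite mul0r !add0r /v' raddfN; ring.
have cv t : ccont v t := cder_ccont (dv t).
have v0 t : 0 < complex.Re (v t) by exact: far.
have v1 t : v t != 0 by apply: contraTneq (v0 t) => ->; rewrite ltxx.
have cv' t : ccont v' t.
  apply: ccontM; first exact: ccont_cst.
  apply: ccontM; first exact: ccont_cst.
  exact: cder_ccont (cder_expi (der_opp (cder_angle t))).
rewrite /winding circle_contour.
have -> : cint mu `[0, 1] (fun t => (circle t - z)^-1 * dpath circle t) =
   cint mu `[0, 1] (fun t => two_pi_i + v' t / v t).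
  apply: eq_cint => t _; rewrite dpath_circle.
  have ee : expi (2 * pi * t) * expi (- (2 * pi * t)) = 1 by rewrite -expiD subrr expi0.
  have e0 : expi (2 * pi * t) != 0 by rewrite -normc_gt0 normc_expi.
  have -> : circle t - z = rho%:C * expi (2 * pi * t) * v t.
    rewrite /circle /v; have -> : rho%:C * expi (2 * pi * t) * (1 - q * expi (- (2 * pi * t))) =
      rho%:C * expi (2 * pi * t) - rho%:C * q * (expi (2 * pi * t) * expi (- (2 * pi * t))) by ring.
    by rewrite ee mulr1 /q [rho%:C * (_ / _)]mulrC divfK//; ring.
  have -> : circle t - c%:C = rho%:C * expi (2 * pi * t) by rewrite /circle addrC addKr.
  have -> : v' t = two_pi_i * (1 - v t).
    rewrite /v' /v /two_pi_i opprB addrC subrK.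
    have -> : 0 +i* (2 * pi) = (0 +i* 1) * (2 * pi)%:C :> R[i].
      by apply: complex_ext; rewrite ?(cReM, cImM) /=; ring.
    by ring.
  rewrite -/two_pi_i; move: (two_pi_i) => P; move: e0 (v1 t).
  move: (expi _) (v t) => E V e0 V0.
  by field; rewrite r0 e0 V0.
rewrite cintD//; last 2 first.
- by apply: ccont_integrable => t _; exact: ccont_cst.
- by apply: ccont_integrable => t _; apply: ccontM; [|apply: ccontV].
rewrite log_derivative_integral0//; last first.
  by rewrite /v mulr0 mulr1 oppr0 mulr_natl /expi cos0 sin0 cosN sinN cos2pi sin2pi oppr0.
rewrite addr0.
have -> : cint mu `[0, 1] (fun=> two_pi_i) = two_pi_i :> R[i].
  rewrite (@cFTC _ (fun t => t%:C * two_pi_i)) ?mul1r ?mul0r ?subr0//.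
  - move=> t _; apply: (cder_eq (cderM (cder_real (is_derive_id t (1:R))) (cder_cst _ _))).
    by rewrite mul1r mulr0 addr0.
  - by move=> t _; exact: ccont_cst.
by rewrite divff// two_pi_i_neq0.
Qed.

End CircleContour.

(** * Location of the eigenvalues and choice of a contour *)

Section AdmissibleContour.
Context {R : realType}.

Lemma normc_sum (I : Type) (r : seq I) (Q : pred I) (F : I -> R[i]) :
  Normc.normc (\sum_(i <- r | Q i) F i) <= \sum_(i <- r | Q i) Normc.normc (F i).
Proof.
elim/big_rec2: _ => [|i y z _ h]; first by rewrite Normc.normc0.
by rewrite (le_trans (le_normcD _ _))// lerD2l.
Qed.

Lemma gershgorin (p : nat) (A : 'M[R[i]]_p) (z : R[i]) : eigenvalue A z ->
  exists k, Normc.normc (z - A k k) <= \sum_(j | j != k) Normc.normc (A k j).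
Proof.
(* [eigenvalue] is about row vectors and would give column sums; transposing gives the row sums,
   which a sub-intensity matrix controls. *)
move=> ez; have : eigenvalue A^T z.
  by move: ez; rewrite !eigenvalue_root_char /char_poly -det_tr /char_poly_mx raddfB/=
    tr_scalar_mx -map_trmx.
move=> /eigenvalueP[x xA x0].
have [k0 xk0] : exists k, x 0 k != 0 by apply/rV0Pn.
have [k _ kmax] := @Order.TotalTheory.arg_maxP _ _ _ k0 predT (fun k => Normc.normc (x 0 k)) isT.
have xk : 0 < Normc.normc (x 0 k).
  by apply: lt_le_trans (kmax k0 isT); rewrite normc_gt0.
exists k; rewrite -(ler_pM2r xk) -Normc.normcM.
have -> : (z - A k k) * x 0 k = \sum_(j | j != k) A k j * x 0 j.
  have := congr1 (fun y : 'rV_p => y 0 k) xA; rewrite !mxE (bigD1 k)//= mxE => e.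
  rewrite mulrBl -e [X in X + _ - _]mulrC addrC addKr.
  by apply: eq_bigr => j _; rewrite mxE mulrC.
rewrite (le_trans (normc_sum _ _ _))// mulr_suml ler_sum// => j _.
by rewrite Normc.normcM ler_wpM2l ?normc_ge0//; exact: kmax.
Qed.

(** A Gershgorin disk of [- T] has centre [- T k k > 0] and, the row sums of [T] being nonpositive,
    at most this radius: it meets the closed left half-plane at most at 0, which invertibility
    excludes. *)
Lemma subintensity_eigenvalue (p : nat) (T : 'M[R]_p) (z : R[i]) :
  subintensity T -> T \in unitmx ->
  eigenvalue (map_mx (real_complex R) (- T)) z -> 0 < complex.Re z.
Proof.
move=> [off diag rows] uT ez.
have z0 : z != 0.
  apply/eqP => z0; have /eigenvalueP[x] := ez; rewrite z0 scale0r map_mxN mulmxN.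
  move=> /eqP; rewrite oppr_eq0 => /eqP xT /eqP[].
  by rewrite -[x]mulmx1 -(map_mx1 (real_complex R)) -(mulmxV uT) map_mxM mulmxA xT mul0mx.
have [k] := gershgorin ez.
have -> : \sum_(j | j != k) Normc.normc (map_mx (real_complex R) (- T) k j) =
    \sum_(j | j != k) T k j.
  by apply: eq_bigr => j jk; rewrite !mxE normc_real normrN ger0_norm// off// eq_sym.
have h : \sum_(j | j != k) T k j <= - T k k.
  by have := rows k; rewrite (bigD1 k)//= -lerBrDl sub0r.
move=> /le_trans/(_ h); rewrite !mxE.
have t0 := diag k.
have sz : 0 < sqnorm z by rewrite sqnorm_gt0.
rewrite normcE -[leRHS]ger0_norm; last by rewrite oppr_ge0 ltW.
rewrite -sqrtr_sqr ler_sqrt ?sqr_ge0//.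
rewrite /sqnorm cReB cImB /= subr0; move: sz; rewrite /sqnorm.
move: (complex.Re z) (complex.Im z) (T k k) t0 => x y t t0 sz le.
rewrite -(pmulr_rgt0 _ (_ : 0 < - (2 * t))); last by lra.
by nra.
Qed.

(** The circle has centre [c] on the positive axis and radius [c - c^-1]. The whole cut stays
    outside, at distance at least [c] from the centre, and for large [c] such disks contain any
    given point of the right half-plane. *)
Lemma exists_admissible_contour (p : nat) (A : 'M[R[i]]_p.+1) :
  (forall z, eigenvalue A z -> 0 < complex.Re z) ->
  exists g, admissible_contour slit_plane A g.
Proof.
move=> Apos.
have [rs charA] := closed_field_poly_normal (char_poly A).
rewrite (monicP (char_poly_monic A)) scale1r in charA.
have eig z : eigenvalue A z = (z \in rs).
  by rewrite eigenvalue_root_char charA root_prod_XsubC.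
(* Squaring, [|z - c| < c - c^-1] means [sqnorm z + 2 < 2 c Re z + c ^ (- 2)], for which [b z < c]
   is enough. *)
pose b (z : R[i]) := (sqnorm z + 2) / (2 * complex.Re z).
have b0 z : z \in rs -> 0 < b z.
  rewrite -eig => /Apos z0; apply: divr_gt0; last by rewrite mulr_gt0.
  by apply: ltr_wpDl => //; exact: sqnorm_ge0.
(* Exceeds every [b z], and is at least 2 so that the radius is positive. *)
pose c := 2 + \sum_(z <- rs) b z.
have bc z : z \in rs -> b z + 2 <= c.
  move=> zrs; rewrite /c addrC lerD2l (perm_big _ (perm_to_rem zrs)) big_cons/=.
  rewrite lerDl big_seq sumr_ge0// => y /mem_rem yrs.
  by rewrite ltW// b0.
have c2 : 2 <= c by rewrite /c lerDl big_seq sumr_ge0// => y yrs; rewrite ltW// b0.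
pose rho := c - c^-1.
have c0 : 0 < c by rewrite (lt_le_trans _ c2).
have ci : c^-1 <= 2^-1 by rewrite lef_pV2 ?posrE.
have ci0 : 0 < c^-1 by rewrite invr_gt0.
have cc : c * c^-1 = 1 by rewrite divff// gt_eqF.
have rho0 : 0 < rho by rewrite /rho; lra.
exists (circle c rho); split.
- exact: circle_simple_closed.
- move=> z nz; apply: circle_outside => //.
  have {nz}[im0 re0] : complex.Im z = 0 /\ complex.Re z <= 0 by apply: contrapT.
  apply: (@lt_le_trans _ _ `|complex.Re (z - c%:C)|); last exact: abs_Re_le.
  by rewrite cReB /= ler0_norm; rewrite /rho; lra.
- move=> z zA; have zrs : z \in rs by rewrite -eig.
  apply: circle_inside => //; have z0 := Apos z zA.
  have hb := bc z zrs.
  rewrite normcE -[ltRHS](ger0_norm (ltW rho0)) -sqrtr_sqr ltr_sqrt ?exprn_gt0//.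
  have : sqnorm z + 2 < 2 * complex.Re z * c.
    rewrite -ltr_pdivrMl; last by rewrite mulr_gt0.
    by rewrite mulrC; move: hb; rewrite /b; lra.
  have -> : rho ^+ 2 = c ^+ 2 - 2 + c^-1 ^+ 2.
    by rewrite /rho sqrrB cc.
  have : 0 <= c^-1 ^+ 2 by exact: sqr_ge0.
  rewrite /sqnorm cReB cImB /= subr0.
  by lra.
Qed.

End AdmissibleContour.

(** * Absorption times of Markov jump processes *)

Lemma big_option (V : nmodType) (I : finType) (F : option I -> V) :
  \sum_x F x = F None + \sum_i F (Some i).
Proof.
rewrite (bigD1 None)//=; congr (_ + _).
rewrite (reindex_omap Some id) => [|[i|]]//=.
by apply: eq_bigl => i; rewrite eqxx.
Qed.

Section Survival.
Context {R : realType} {p : nat}.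
Variables (T : 'M[R]_p) (Q : R -> option 'I_p -> option 'I_p -> R).
Hypotheses (tQ : transition_function Q) (iQ : has_intensities Q (intensity T)).

Let Q_ge0 t x y : 0 <= t -> 0 <= Q t x y. Proof. by case: tQ => h _ _ _; exact: h. Qed.
Let Q_sum t x : 0 <= t -> \sum_y Q t x y = 1. Proof. by case: tQ => _ h _ _; exact: h. Qed.
Let Q0 x y : Q 0 x y = (x == y)%:R. Proof. by case: tQ. Qed.
Let QD s t x y : 0 <= s -> 0 <= t -> Q (s + t) x y = \sum_z Q s x z * Q t z y.
Proof. by case: tQ => _ _ _ h; exact: h. Qed.

Let Q_le1 t x y : 0 <= t -> Q t x y <= 1.
Proof.
move=> t0; rewrite -(Q_sum x t0) (bigD1 y)//= lerDl sumr_ge0// => z _.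
exact: Q_ge0.
Qed.

Let leave t := 1 - Q t None None.

Let leaveD s t : 0 <= s -> 0 <= t -> leave (s + t) <= leave s + leave t.
Proof.
move=> s0 t0; have h : Q s None None * Q t None None <= Q (s + t) None None.
  by rewrite QD// (bigD1 None)//= lerDl sumr_ge0// => z _; rewrite mulr_ge0 ?Q_ge0.
have h1 := Q_le1 None None s0; have h2 := Q_le1 None None t0.
have : 0 <= (1 - Q s None None) * (1 - Q t None None) by rewrite mulr_ge0 ?subr_ge0.
by rewrite /leave; nra.
Qed.

(* [leave] is subadditive with vanishing derivative at 0. *)
Lemma absorbing t : 0 <= t -> Q t None None = 1.
Proof.
move=> t0; have le0 : 0 <= leave t by rewrite subr_ge0 Q_le1.
apply/esym/eqP; rewrite -subr_eq0 -[_ - _]/(leave t) eq_le le0 andbT.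
have leaveM n s : 0 <= s -> leave (n%:R * s) <= n%:R * leave s.
  move=> s0; elim: n => [|n ih]; first by rewrite !mul0r /leave Q0 eqxx subrr.
  rewrite -natr1 !mulrDl !mul1r; apply: le_trans (leaveD _ s0) _; last by rewrite lerD2r.
  by rewrite mulr_ge0.
have [t1|t1] := eqVneq t 0; first by rewrite t1 /leave Q0 eqxx subrr.
have {t1}t1 : 0 < t by rewrite lt_def t1.
have nE n : n.+1%:R * (t / n.+1%:R) = t by rewrite mulrC divfK// pnatr_eq0.
have iN : (Q h None None - (None == None :> option 'I_p)%:R) / h @[h --> 0^'+] --> (0 : R).
  move: iQ; rewrite /has_intensities => /(_ None None). exact.
have /((cvg_at_rightP _ _ _).1 iN) :
    (forall n, 0 < t / n.+1%:R) /\ t / n.+1%:R @[n --> \oo] --> 0.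
  split => [n|]; first by rewrite divr_gt0.
  by rewrite -[X in _ --> X](mulr0 t); apply: cvgM; [exact: cvg_cst|exact: cvg_harmonic].
move=> /(cvgM (cvg_cst (- t))); rewrite mulr0 => h.
apply: (ler_cvg_to (cvg_cst (leave t)) h); apply: nearW => n.
have n0 : n.+1%:R != 0 :> R by rewrite pnatr_eq0.
rewrite -[in leLHS](nE n) (le_trans (leaveM n.+1 _ _))//; first by rewrite divr_ge0.
rewrite /leave eqxx mulr1n le_eqVlt; apply/orP; left; apply/eqP.
by rewrite /=; move: (Q _ _ _) => x; move: n.+1%:R n0 => m n0; field; rewrite n0 gt_eqF.
Qed.

Let Q_None t k : 0 <= t -> Q t None (Some k) = 0.
Proof.
move=> t0; have := Q_sum None t0; rewrite big_option absorbing// => /(canRL (addKr _)).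
rewrite addNr => /eqP; rewrite psumr_eq0 => [/allP/(_ k)|i _]; last exact: Q_ge0.
by rewrite mem_index_enum => /(_ isT)/eqP.
Qed.

Definition survival j t : R := 1 - Q t (Some j) None.

Lemma survivalE j t : 0 <= t -> survival j t = \sum_k Q t (Some j) (Some k).
Proof.
by move=> t0; rewrite /survival -(Q_sum (Some j) t0) big_option addrAC subrr add0r.
Qed.

Lemma survival_itv j t : 0 <= t -> 0 <= survival j t <= 1.
Proof. by move=> t0; rewrite subr_ge0 Q_le1//= gerBl Q_ge0. Qed.

Lemma survival0 j : survival j 0 = 1.
Proof. by rewrite /survival Q0 subr0. Qed.

Lemma survivalD j s t : 0 <= s -> 0 <= t ->
  survival j (s + t) = \sum_k Q s (Some j) (Some k) * survival k t.
Proof.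
move=> s0 t0; rewrite survivalE ?addr_ge0//.
under eq_bigr do rewrite QD// big_option Q_None// mulr0 add0r.
rewrite exchange_big/=; apply: eq_bigr => k _.
by rewrite -mulr_sumr -survivalE.
Qed.

Lemma survival_nonincreasing j s t : 0 <= s -> s <= t -> survival j t <= survival j s.
Proof.
move=> s0 st; have ts : 0 <= t - s by rewrite subr_ge0.
rewrite lerD2l lerN2 -[t](subrK s) addrC QD//.
rewrite (bigD1 None)//= absorbing// mulr1 lerDl sumr_ge0// => z _.
by rewrite mulr_ge0 ?Q_ge0.
Qed.

Let M j k h : R := (Q h (Some j) (Some k) - (j == k)%:R) / h.

Let M_cvg j k : M j k h @[h --> 0^'+] --> T j k.
Proof. move: iQ; rewrite /has_intensities => /(_ (Some j) (Some k)); exact. Qed.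

(** Kolmogorov's backward equation before the passage to the limit. Continuity, the derivative and
    the limit at infinity are all read off it, by letting [h] tend to 0 or [t] to infinity. *)
Let survival_diff j h t : 0 < h -> 0 <= t ->
  survival j (h + t) - survival j t = h * \sum_k M j k h * survival k t.
Proof.
move=> h0 t0; rewrite survivalD ?(ltW h0)// mulr_sumr.
rewrite -[survival j t](_ : \sum_k (j == k)%:R * survival k t = _); last first.
  rewrite (bigD1 j)//= eqxx mul1r big1 ?addr0// => k; rewrite eq_sym => /negPf ->.
  by rewrite mul0r.
rewrite -sumrB; apply: eq_bigr => k _; rewrite /M -mulrBl.
by field; rewrite gt_eqF.
Qed.

Let M_sum_cvg j (f : 'I_p -> R -> R) (l : 'I_p -> R) :
  (forall k, f k h @[h --> 0^'+] --> l k) ->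
  \sum_k M j k h * f k h @[h --> 0^'+] --> \sum_k T j k * l k.
Proof.
move=> fl; apply: cvg_big => [|k _]; first exact: add_continuous.
by apply: cvgM; [exact: M_cvg|exact: fl].
Qed.

Let h_cvg0 : (h : R) @[h --> (0:R)^'+] --> (0:R).
Proof. by apply: cvg_at_right_filter; exact: cvg_id. Qed.

Lemma survival_cvg0 (j : 'I_p) : survival j t @[t --> 0^'+] --> (1 : R).
Proof.
have h : h * (\sum_k M j k h * survival k 0) + 1 @[h --> 0^'+] --> (1 : R).
  rewrite -[X in _ --> X]add0r -[X in X + _](mul0r (\sum_k T j k * survival k 0)).
  apply: cvgD; last exact: cvg_cst.
  apply: cvgM; first exact: h_cvg0.
  by apply: M_sum_cvg => k; exact: cvg_cst.
apply: cvg_trans h; apply: near_eq_cvg; near=> t.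
have t0 : 0 < t by near: t; exact: nbhs_right_gt.
by have := survival_diff j t0 (lexx 0); rewrite addr0 survival0 => <-; rewrite subrK.
Unshelve. all: by end_near. Qed.

(** The increment from [t - h] to [t] is [h] times a sum that is bounded near [h = 0], as the
    quotients [M j k h] converge and survival is at most 1. *)
Let survival_left (j : 'I_p) (t : R) : 0 < t -> survival j (t - h) @[h --> 0^'+] --> survival j t.
Proof.
move=> t0; apply/cvgrPdist_lt => e e0.
pose B := \sum_k `|T j k| + 1.
have B0 : 0 < B by rewrite ltr_wpDl// sumr_ge0.
have hM : \sum_k `|M j k h| @[h --> 0^'+] --> \sum_k `|T j k|.
  apply: cvg_big => [|k _]; first exact: add_continuous.
  by apply: cvg_norm; exact: M_cvg.
have hMB : \forall h \near 0^'+, \sum_k `|M j k h| < B.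
  by apply: (cvgr_lt _ hM); rewrite /B ltrDl.
near=> h.
have h0 : 0 < h by near: h; exact: nbhs_right_gt.
have ht : h < t by near: h; exact: nbhs_right_lt.
have he : h < e / B by near: h; apply: nbhs_right_lt; rewrite divr_gt0.
have th : 0 <= t - h by rewrite subr_ge0 ltW.
have := survival_diff j h0 th; rewrite [h + _]addrC subrK => ->.
rewrite normrM gtr0_norm//.
have : `|\sum_k M j k h * survival k (t - h)| <= B.
  rewrite (le_trans (ler_norm_sum _ _ _))//.
  apply: (@le_trans _ _ (\sum_k `|M j k h|)); last by rewrite ltW//; near: h.
  apply: ler_sum => k _; rewrite normrM ler_piMr//.
  by have /andP[a b] := survival_itv k th; rewrite ger0_norm.
move=> /(ler_wpM2l (ltW h0)) /le_lt_trans; apply.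
by rewrite -ltr_pdivlMr.
Unshelve. all: by end_near. Qed.

(** Intensities are limits from the right at time 0 only. The right quotient at [t] is
    [survival_diff] at time [t]; the left quotient is [survival_diff] at time [t - h], where left
    continuity is needed to pass to the limit. *)
Lemma is_derive_survival (j : 'I_p) (t : R) : 0 < t ->
  is_derive t 1 (survival j) (\sum_k T j k * survival k t).
Proof.
move=> t0; pose q (h : R) : R := h^-1 * (survival j (h + t) - survival j t).
have cr : q h @[h --> (0 : R)^'+] --> (\sum_k T j k * survival k t : R).
  have c : \sum_k M j k h * survival k t @[h --> 0^'+] --> \sum_k T j k * survival k t.
    by apply: M_sum_cvg => k; exact: cvg_cst.
  apply: cvg_trans c; apply: near_eq_cvg; near=> h.
  have h0 : 0 < h by near: h; exact: nbhs_right_gt.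
  by rewrite /q survival_diff ?(ltW t0)// mulKf// gt_eqF.
have cl : q h @[h --> (0 : R)^'-] --> (\sum_k T j k * survival k t : R).
  apply/cvg_at_leftNP; rewrite oppr0.
  have c : \sum_k M j k h * survival k (t - h) @[h --> 0^'+] --> \sum_k T j k * survival k t.
    by apply: M_sum_cvg => k; exact: survival_left.
  apply: cvg_trans c; apply: near_eq_cvg; near=> h.
  have h0 : 0 < h by near: h; exact: nbhs_right_gt.
  have ht : h < t by near: h; exact: nbhs_right_lt.
  have th : 0 <= t - h by rewrite subr_ge0 ltW.
  have := survival_diff j h0 th; rewrite [h + _]addrC subrK => e.
  by rewrite /= /q [- h + t]addrC -[_ - survival j t]opprB e invrN mulNr mulrN opprK mulKf// gt_eqF.
have cv : q h @[h --> (0 : R)^'] --> (\sum_k T j k * survival k t : R).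
  exact: (@cvg_at_right_left_dnbhs _ R^o).
have qE : (fun h : R => h^-1 *: ((survival j \o shift t) (h *: (1 : R)) - survival j t)) = q.
  by apply/funext => h; rewrite /q /= /GRing.scale /= mulr1.
apply: DeriveDef; first by apply/cvg_ex; exists (\sum_k T j k * survival k t); rewrite qE.
by rewrite /derive qE; exact: cvg_lim cv.
Unshelve. all: by end_near. Qed.

Hypothesis uT : T \in unitmx.

(** Monotonicity provides a limit vector [l]. Letting [t] tend to infinity in [survival_diff] gives
    that [M h] annihilates [l] for every [h > 0]; then [h] to 0 gives [T l = 0], so [l = 0] by
    invertibility. *)
Lemma survival_cvg_pinfty (j : 'I_p) : survival j t @[t --> +oo] --> (0 : R).
Proof.
(* Negative times are frozen at 0 to have monotonicity on the whole line. *)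
pose w k t := survival k (Num.max t 0).
have wmon k : {homo (fun t => - w k t) : x y / x <= y}.
  move=> x y xy; rewrite /w lerN2; apply: survival_nonincreasing.
    by rewrite le_max lexx orbT.
  by rewrite ge_max !le_max xy lexx !orbT.
have wub k : has_ubound (range (fun t => - w k t)).
  exists 0 => _ [t _ <-]; rewrite oppr_le0.
  have t0 : 0 <= Num.max t 0 by rewrite le_max lexx orbT.
  by case/andP: (survival_itv k t0).
have wcvg k := nondecreasing_cvgr (@wmon k) (wub k).
pose l : 'cV[R]_p := \col_k (- sup (range (fun t => - w k t))).
have scvg k : survival k t @[t --> +oo] --> l k 0.
  have c : - (- w k t) @[t --> +oo] --> l k 0 by rewrite mxE; exact: cvgN (wcvg k).
  apply: cvg_trans c; apply: near_eq_cvg; near=> t.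
  have t0 : 0 < t by near: t; exact: nbhs_pinfty_gt.
  by rewrite opprK /w max_l// ltW.
have inv h k : 0 < h -> \sum_i M k i h * l i 0 = 0.
  move=> h0; apply: (mulfI (lt0r_neq0 h0)); rewrite mulr0.
  have c1 : survival k (h + t) - survival k t @[t --> +oo] --> l k 0 - l k 0.
    apply: cvgB; last exact: scvg.
    have c : survival k (t + h) @[t --> +oo] --> l k 0 by rewrite (cvg_shiftr h (survival k)); exact: scvg.
    apply: cvg_trans c; apply: near_eq_cvg.
    by apply: nearW => t /=; rewrite addrC.
  have c2 : h * (\sum_i M k i h * survival i t) @[t --> +oo] --> h * (\sum_i M k i h * l i 0).
    apply: cvgM; first exact: cvg_cst.
    apply: cvg_big => [|i _]; first exact: add_continuous.
    by apply: cvgM; [exact: cvg_cst|exact: scvg].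
  rewrite subrr in c1; apply: (cvg_unique _ _ c1) => //.
  apply: cvg_trans c2; apply: near_eq_cvg; near=> t.
  have t0 : 0 < t by near: t; exact: nbhs_pinfty_gt.
  by rewrite survival_diff// ltW.
have Tl : T *m l = 0.
  apply/colP => k; rewrite !mxE.
  have c3 : \sum_i M k i h * l i 0 @[h --> 0^'+] --> \sum_i T k i * l i 0.
    by apply: M_sum_cvg => i; exact: cvg_cst.
  apply: (cvg_unique _ c3) => //.
  have c : (0 : R) @[h --> (0:R)^'+] --> (0 : R) by exact: cvg_cst.
  apply: cvg_trans c; apply: near_eq_cvg; near=> h.
  by rewrite inv//; near: h; exact: nbhs_right_gt.
have l0 : l = 0 by rewrite -[l]mul1mx -(mulVmx uT) -mulmxA Tl mulmx0.
by have := scvg j; rewrite l0 mxE.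
Unshelve. all: by end_near. Qed.

End Survival.

(** * The functions [t ^ N e ^ (- u t)] *)

Section ExpMonomial.
Context {R : realType}.
Notation mu := (@lebesgue_measure R).
Notation Rp := (`]0, +oo[%classic : set R).
Implicit Types (N : nat) (u t : R).

Definition expmono N u t : R := t ^+ N * expR (- (u * t)).

Lemma expmono_ge0 N u t : 0 <= t -> 0 <= expmono N u t.
Proof. by move=> t0; rewrite mulr_ge0 ?exprn_ge0 ?expR_ge0. Qed.

Lemma expmono_at0 N u : expmono N u 0 = (N == 0%N)%:R.
Proof. by rewrite /expmono mulr0 oppr0 expR0 mulr1 expr0n. Qed.

(** At [N = 0] the truncated predecessor does no harm, its coefficient being 0. *)
Definition expmono' N u t : R := N%:R * expmono N.-1 u t - u * expmono N u t.

Lemma is_derive_expmono N u t : is_derive t 1 (expmono N u) (expmono' N u t).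
Proof.
have d1 : is_derive t 1 (fun t : R => expR (- (u * t))) (- u * expR (- (u * t))).
  have d2 : is_derive t 1 (fun t : R => - (u * t)) (- u).
    apply: (der_eq (der_opp (der_mul (is_derive_cst u t (1:R)) (is_derive_id t (1:R))))).
    by rewrite mul0r add0r mulr1.
  apply: (der_eq (@is_derive1_comp _ (@expR R) (fun t => - (u * t)) _ _ _ (is_derive_expR _) d2)).
  by rewrite mulrC.
case: N => [|N].
  rewrite /expmono' /expmono mul0r add0r mul1r.
  by under eq_fun do rewrite mul1r; apply: (der_eq d1); rewrite mulNr.
have d3 : is_derive t 1 (fun t : R => t ^+ N.+1) (N.+1%:R * t ^+ N).
  elim: N => [|N ih].
    by under eq_fun do rewrite expr1; apply: (der_eq (is_derive_id t (1:R))); rewrite mulr1.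
  under eq_fun do rewrite exprS.
  apply: (der_eq (der_mul (is_derive_id t (1:R)) ih)).
  by rewrite -(natr1 N.+1) exprS; ring.
apply: (der_eq (der_mul d3 d1)); rewrite /expmono' /expmono /=; ring.
Qed.

Lemma continuous_expmono N u t : continuous_at t (expmono N u).
Proof. exact: der_cont (is_derive_expmono N u t). Qed.

Lemma continuous_expmono' N u t : continuous_at t (expmono' N u).
Proof.
apply: cont_add; last apply: cont_opp;
  by apply: cont_mul; [exact: cst_continuous|exact: continuous_expmono].
Qed.

Lemma expmono_bounded N u : 0 < u -> exists2 C, 0 < C & forall t, 0 <= t -> expmono N u t <= C.
Proof.
move=> u0; have [C C0 hC] := pow_exp_bound (N%:R : R).
exists (u^-1 ^+ N * C); first by rewrite mulr_gt0// exprn_gt0// invr_gt0.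
move=> t t0; have ut : 0 <= u * t by rewrite mulr_ge0// ltW.
apply: le_trans (ler_wpM2l _ (hC _ ut)); last by rewrite exprn_ge0// invr_ge0 ltW.
rewrite powR_mulrn ?addr_ge0// mulrA -exprMn.
apply: ler_wpM2r; first exact: expR_ge0.
apply: lerXn2r; rewrite ?nnegrE ?mulr_ge0 ?addr_ge0 ?invr_ge0 ?(ltW u0)//.
by rewrite mulrDr mulr1 mulKf ?gt_eqF// lerDr invr_ge0 ltW.
Qed.

Lemma cont_sum (T : topologicalType) (I : Type) (r : seq I) (F : I -> T -> R) (x : T) :
  (forall i, continuous_at x (F i)) -> continuous_at x (fun y => \sum_(i <- r) F i y).
Proof.
move=> cF; elim: r => [|i r ih].
  by under eq_fun do rewrite big_nil; exact: cst_continuous.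
by under eq_fun do rewrite big_cons; exact: cont_add.
Qed.

Lemma measurable_expmono N u : measurable_fun setT (expmono N u).
Proof.
by apply: continuous_measurable_fun => t; exact: continuous_expmono.
Qed.

Lemma measurable_expmono' N u : measurable_fun setT (expmono' N u).
Proof.
by apply: continuous_measurable_fun => t; exact: continuous_expmono'.
Qed.

Lemma expmono_integrable N u : 0 < u -> mu.-integrable Rp (EFin \o expmono N u).
Proof.
move=> u0; apply/integrableP; split.
  by apply/measurable_EFinP; apply: measurable_funTS; exact: measurable_expmono.
rewrite [ltLHS](_ : _ = \int[mu]_(t in Rp) (t ^+ N * expR (- (u * t)))%:E)%E.
  by rewrite exp_moment// ltry.
by apply: eq_integral => t /set_mem; rewrite Rp_gt0 => t0 /=; rewrite ger0_norm// expmono_ge0// ltW.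
Qed.

Lemma integrable_lin a b (f g : R -> R) : mu.-integrable Rp (EFin \o f) ->
  mu.-integrable Rp (EFin \o g) -> mu.-integrable Rp (EFin \o (fun x => a * f x + b * g x)).
Proof.
move=> fi gi; have fi' := integrableZl measurable_Rp a fi.
have gi' := integrableZl measurable_Rp b gi.
exact: (integrableD measurable_Rp fi' gi').
Qed.

Lemma Rintegral_lin a b (f g : R -> R) : mu.-integrable Rp (EFin \o f) ->
  mu.-integrable Rp (EFin \o g) -> \int[mu]_(x in Rp) (a * f x + b * g x) =
  a * \int[mu]_(x in Rp) f x + b * \int[mu]_(x in Rp) g x.
Proof.
move=> fi gi; have fi' := integrableZl measurable_Rp a fi.
have gi' := integrableZl measurable_Rp b gi.
by rewrite RintegralD// ?RintegralZl//; exact: measurable_Rp.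
Qed.

Lemma integrable_sumZ (I : Type) (r : seq I) (c : I -> R) (f : I -> R -> R) :
  (forall i, mu.-integrable Rp (EFin \o f i)) ->
  mu.-integrable Rp (EFin \o (fun x => \sum_(i <- r) c i * f i x)) /\
  \int[mu]_(x in Rp) (\sum_(i <- r) c i * f i x) =
  \sum_(i <- r) c i * \int[mu]_(x in Rp) f i x.
Proof.
move=> fi; elim: r => [|i r [ih1 ih2]].
  have e x : \sum_(i <- [::]) c i * f i x = 0 by rewrite big_nil.
  rewrite (_ : (fun x => _) = cst 0); last exact/funext.
  rewrite big_nil; split.
    by rewrite (_ : EFin \o _ = cst 0%E)//; apply: integrable0; exact: measurable_Rp.
  by rewrite /Rintegral integral0.
have e x : \sum_(k <- i :: r) c k * f k x = c i * f i x + 1 * \sum_(k <- r) c k * f k x.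
  by rewrite big_cons mul1r.
rewrite (_ : (fun x => _) = (fun x => c i * f i x + 1 * \sum_(k <- r) c k * f k x)); last exact/funext.
by split; [exact: integrable_lin|rewrite Rintegral_lin// ih2 big_cons mul1r].
Qed.

End ExpMonomial.

Section SurvivalMoments.
Context {R : realType} {p : nat}.
Notation mu := (@lebesgue_measure R).
Notation Rp := (`]0, +oo[%classic : set R).
Variables (T : 'M[R]_p) (Q : R -> option 'I_p -> option 'I_p -> R).
Hypotheses (tQ : transition_function Q) (iQ : has_intensities Q (intensity T)).
Hypothesis uT : T \in unitmx.
Variable u : R.
Hypothesis u0 : 0 < u.
Implicit Types (N : nat) (j k : 'I_p).

Notation v := (survival Q).

Lemma continuous_survival j (t : R) : 0 < t -> continuous_at t (v j).
Proof. by move=> t0; exact: der_cont (is_derive_survival tQ iQ j t0). Qed.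

Lemma measurable_survival j : measurable_fun Rp (v j).
Proof.
apply: open_continuous_measurable_fun; first exact: interval_open.
by move=> x /set_mem; rewrite Rp_gt0 => x0; exact: continuous_survival.
Qed.

Lemma expmono_survival_integrable N j : mu.-integrable Rp (EFin \o (fun t => expmono N u t * v j t)).
Proof.
apply: le_integrable (expmono_integrable N u0); first exact: measurable_Rp.
  apply/measurable_EFinP; apply: measurable_funM; last exact: measurable_survival.
  by apply: measurable_funTS; exact: measurable_expmono.
move=> t; rewrite Rp_gt0 => t0; have /andP[v0 v1] := survival_itv tQ j (ltW t0).
by rewrite /= lee_fin normrM [`|v j t|]ger0_norm// ler_piMr.
Qed.

Definition survival_moment N : 'cV[R]_p :=
  \col_j \int[mu]_(t in Rp) (expmono N u t * v j t).

Lemma survival_moment' N j :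
  mu.-integrable Rp (EFin \o (fun t => expmono' N u t * v j t)) /\
  \int[mu]_(t in Rp) (expmono' N u t * v j t) =
    N%:R * survival_moment N.-1 j 0 - u * survival_moment N j 0.
Proof.
have e t : expmono' N u t * v j t =
    N%:R * (expmono N.-1 u t * v j t) + (- u) * (expmono N u t * v j t).
  by rewrite /expmono'; ring.
rewrite (_ : (fun t => expmono' N u t * v j t) =
  (fun t => N%:R * (expmono N.-1 u t * v j t) + (- u) * (expmono N u t * v j t))); last exact/funext.
rewrite !mxE -mulNr.
have i1 := expmono_survival_integrable N j; have i2 := expmono_survival_integrable N.-1 j.
by split; [exact: integrable_lin|rewrite Rintegral_lin].
Qed.

(* Integration by parts, as [v' = T v]. *)
Lemma survival_moment_rec N :
  (u%:M - T) *m survival_moment N = (N == 0%N)%:R *: evec + N%:R *: survival_moment N.-1.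
Proof.
apply/colP => j.
have [iD eD] := survival_moment' N j.
have [iS eS] := @integrable_sumZ R 'I_p (index_enum 'I_p) (T j)
  (fun k t => expmono N u t * v k t) (expmono_survival_integrable N).
pose f t := 1 * (expmono' N u t * v j t) + 1 * (\sum_k T j k * (expmono N u t * v k t)).
have cv k (t : R) : 0 < t -> continuous_at t (v k) by exact: continuous_survival.
have [C C0 hC] := expmono_bounded N u0.
have := @FTC_0y_integrable R (fun t => expmono N u t * v j t) f (N == 0%N)%:R 0.
rewrite Rintegral_lin// eD eS => FTC.
have {}FTC : 1 * (N%:R * survival_moment N.-1 j 0 - u * survival_moment N j 0) +
  1 * \sum_k T j k * survival_moment N k 0 = 0 - (N == 0%N)%:R.
  apply: etrans (FTC _ _ _ _ _).
  - by under [in LHS]eq_bigr do rewrite mxE.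
  - move=> t t0; apply: (der_eq (der_mul (is_derive_expmono N u t) (is_derive_survival tQ iQ j t0))).
    rewrite /f !mul1r; congr (_ + _); rewrite mulr_sumr.
    by apply: eq_bigr => k _; rewrite mulrCA.
  - move=> t t0; rewrite /f; apply: cont_add; (apply: cont_mul; first exact: cst_continuous).
      by apply: cont_mul; [exact: continuous_expmono'|exact: cv].
    apply: cont_sum => k; apply: cont_mul; first exact: cst_continuous.
    by apply: cont_mul; [exact: continuous_expmono|exact: cv].
  - rewrite -[X in _ --> X]mulr1 -(expmono_at0 N u); apply: cvgM; last exact: survival_cvg0.
    by apply: cvg_at_right_filter; exact: continuous_expmono.
  - apply: (@squeeze_cvgr _ _ _ _ (fun=> 0) (fun t => C * v j t)).
    + near=> t; have t0 : 0 <= t by near: t; exact: nbhs_pinfty_ge.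
      have /andP[v0 v1] := survival_itv tQ j t0.
      by rewrite mulr_ge0 ?expmono_ge0//= ler_wpM2r// hC.
    + exact: cvg_cst.
    + rewrite -[X in _ --> X](mulr0 C); apply: cvgM; first exact: cvg_cst.
      exact: survival_cvg_pinfty.
  - exact: integrable_lin.
rewrite mulmxBl mul_scalar_mx !mxE.
have eT : (\sum_k T j k * survival_moment N k 0) = (T *m survival_moment N) j 0 by rewrite mxE.
move: FTC; rewrite !mul1r eT !mxE; lra.
Unshelve. all: by end_near. Qed.

End SurvivalMoments.

(** * Measurability of the absorption time *)

Section AbsorptionTimeMeasurability.
Context {R : realType} {dO : measure_display} {Om : measurableType dO} {p : nat}.
Variable J : R -> Om -> option 'I_p.
Hypothesis pJ : jump_paths J.
Implicit Types (t : R) (w : Om).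

Notation X := (absorption_time J).

Let absorbed_lb w : has_lbound [set t | 0 < t /\ J t w = None].
Proof. by exists 0 => t [/ltW]. Qed.

Lemma absorption_time_ge0 w : 0 <= X w.
Proof.
rewrite /absorption_time.
have [ne|/nonemptyPn ->] := pselect ([set t | 0 < t /\ J t w = None] !=set0).
  by apply: lb_le_inf => // t [/ltW].
by rewrite inf0.
Qed.

Lemma absorption_time_le w t : 0 < t -> J t w = None -> X w <= t.
Proof. by move=> t0 Jt; apply: ge_inf. Qed.

(* Right continuity lets rational times detect the visits of the process. *)
Lemma rational_visit w x s t : 0 <= s -> s < t -> J s w = x ->
  exists r : rat, s < ratr r < t /\ J (ratr r) w = x.
Proof.
move=> s0 st Js; have [/(_ s s0) [d /= d0 hd] _] := pJ w.
have sm : s < Num.min t (s + d) by rewrite lt_min st ltrDl.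
have [r] := rat_in_itvoo sm.
rewrite in_itv/= lt_min => /andP[sr /andP[rt rd]]; exists r; rewrite sr rt; split => //.
rewrite -Js; apply: hd => //=.
by rewrite distrC gtr0_norm ?subr_gt0// ltrBlDl.
Qed.

Definition visits_before t : set Om :=
  \bigcup_(r : rat) (if (0 : R) < ratr r < t then [set w | J (ratr r) w = None] else set0).

Definition never_absorbed : set Om :=
  ~` \bigcup_(r : rat) (if (0 : R) < ratr r then [set w | J (ratr r) w = None] else set0).

(** The infimum of the empty set is 0, so the paths that are never absorbed count as [X < t]. Both
    sets on the right are built from countably many visits at rational times. *)
Lemma absorption_time_lt_preimage t : 0 < t -> [set w | X w < t] = never_absorbed `|` visits_before t.
Proof.
move=> t0; apply/seteqP; split => w /=.
- have [ne|/nonemptyPn S0] := pselect ([set t | 0 < t /\ J t w = None] !=set0); last first.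
    move=> _; left => -[r _]; case: ifPn => // r0 /= Jr.
    by have : [set t | 0 < t /\ J t w = None] (ratr r) by []; rewrite S0.
  move=> /(inf_lt ne)[s [s0 Js] st]; right.
  have [r [/andP[sr rt] Jr]] := rational_visit (ltW s0) st Js.
  by exists r => //; rewrite rt (lt_trans s0 sr).
- move=> [nev|[r _]]; last first.
    by case: ifPn => // /andP[r0 rt] /= Jr; apply: le_lt_trans rt; exact: absorption_time_le.
  suff -> : X w = 0 by [].
  rewrite /absorption_time -[RHS](inf0 R); congr inf.
  apply/seteqP; split => // s [s0 Js]; apply: nev.
  have s1 : s < s + 1 by rewrite ltrDl.
  have [r [/andP[sr rt] Jr]] := rational_visit (ltW s0) s1 Js.
  by exists r => //; rewrite (lt_trans s0 sr).
Qed.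

Notation sJ := (g_sigma_algebraType [set A | exists t x, 0 <= t /\ A = [set w | J t w = x]]).

Let measurable_visit (C : pred R) : (forall r, C r -> 0 <= r) ->
  measurable (\bigcup_(r : rat) (if C (ratr r) then [set w | J (ratr r) w = None] else set0) : set sJ).
Proof.
move=> C0; apply: bigcupT_measurable_rat => r; case: ifPn => Cr; last exact: measurable0.
by apply: sub_sigma_algebra; exists (ratr r), None; split => //; exact: C0.
Qed.

(** Measurability is with respect to the sigma-algebra generated by [J] alone, because conditional
    independence is given for such sigma-algebras. *)
Lemma measurable_absorption_time : measurable_fun setT (X : sJ -> R).
Proof.
apply: (measurability (@RGenCInfty.G R)) => [|/= _ [_] [t] -> <-].
  exact: RGenCInfty.measurableE.
rewrite setTI -[X in measurable X]setCK; apply: measurableC.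
have -> : ~` (X @^-1` `[t, +oo[) = [set w | X w < t].
  by apply/seteqP; split => w /=; rewrite in_itv/= andbT; [move=> /negP; rewrite -ltNge|move=> h; apply/negP; rewrite -ltNge].
have [t0|t0] := ltP 0 t; last first.
  suff -> : [set w | X w < t] = set0 by exact: (@measurable0 _ sJ).
  by apply/seteqP; split => // w /=; rewrite ltNge (le_trans t0)// absorption_time_ge0.
rewrite absorption_time_lt_preimage//; apply: measurableU.
  apply: measurableC; apply: (@measurable_visit (fun r => 0 < r)) => r; exact: ltW.
by apply: (@measurable_visit (fun r => 0 < r < t)) => r /andP[/ltW].
Qed.

Lemma process_sigma_algebra_absorption_time (B : set R) : measurable B ->
  process_sigma_algebra J (X @^-1` B).
Proof.
move=> mB; have := measurable_absorption_time measurableT mB.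
by rewrite setTI.
Qed.

Lemma process_sigma_algebra_measurable (A : set Om) :
  (forall t x, 0 <= t -> measurable [set w | J t w = x]) ->
  process_sigma_algebra J A -> measurable A.
Proof.
move=> mJ; apply: smallest_sub; first exact: sigma_algebra_measurable.
by move=> _ [t [x [t0 ->]]]; exact: mJ.
Qed.

End AbsorptionTimeMeasurability.

Section EventProbabilities.
Context {R : realType} {dO : measure_display} {Om : measurableType dO}.
Variable P : probability Om R.
Implicit Types A B N : set Om.

Definition pr A : R := fine (P A).

Lemma prE A : measurable A -> P A = (pr A)%:E.
Proof. by move=> mA; rewrite fineK// fin_num_measure. Qed.

Lemma pr_ge0 A : 0 <= pr A.
Proof. exact/fine_ge0/measure_ge0. Qed.

Lemma le_pr A B : measurable A -> measurable B -> A `<=` B -> pr A <= pr B.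
Proof.
move=> mA mB AB; rewrite -lee_fin -!prE//.
by apply: le_measure => //; rewrite inE.
Qed.

Lemma pr_DI A B : measurable A -> measurable B -> pr A = pr (A `&` B) + pr (A `&` ~` B).
Proof.
move=> mA mB; have mAB := measurableI _ _ mA mB.
have mAD : measurable (A `&` ~` B) by apply: measurableI => //; exact: measurableC.
apply: EFin_inj; rewrite EFinD -!prE// addeC -setDE.
exact: measureDI.
Qed.

Lemma le_pr_negligible A B N : measurable A -> measurable B -> P.-negligible N ->
  A `<=` B `|` N -> pr A <= pr B.
Proof.
move=> mA mB [M [mM M0 NM]] AB; rewrite -lee_fin -!prE// -(measureU0 mB mM M0).
apply: le_measure; rewrite ?inE//; first exact: measurableU.
by move=> w /AB[|/NM]; [left|right].
Qed.

Lemma negligible_bigcup_rat (F : rat -> set Om) : (forall r, P.-negligible (F r)) ->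
  P.-negligible (\bigcup_r F r).
Proof.
move=> F0; pose G n := if unpickle n is Some r then F r else set0.
apply: (@negligibleS _ _ _ _ (\bigcup_n G n)).
  move=> w [r _ Frw]; have e : G (pickle r) = F r by rewrite /G pickleK.
  by exists (pickle r); [exact: I|rewrite e].
apply: negligible_bigcup => n; rewrite /G; case: unpickle => [r|]; first exact: F0.
exact: negligible_set0.
Qed.

End EventProbabilities.

(** * The law of the absorption time *)

Section AbsorptionTimeLaw.
Context {R : realType} {dO : measure_display} {Om : measurableType dO} {p : nat}.
Variables (P : probability Om R) (J : R -> Om -> option 'I_p) (T : 'M[R]_p).
Variable Q : R -> option 'I_p -> option 'I_p -> R.
Hypothesis mJ : forall t x, 0 <= t -> measurable [set w | J t w = x].
Hypothesis pJ : jump_paths J.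
Hypotheses (tQ : transition_function Q) (iQ : has_intensities Q (intensity T)).
Hypothesis JQ : markov_property P J Q.
Hypothesis uT : T \in unitmx.
Implicit Types (s t : R) (j : 'I_p).

Notation X := (absorption_time J).
Notation v := (survival Q).

Lemma pr_two_times s t x y : 0 <= s -> s < t ->
  pr P ([set w | J s w = x] `&` [set w | J t w = y]) = pr P [set w | J s w = x] * Q (t - s) x y.
Proof.
(* The Markov property with [n = 0] looks at the times of index 0 and 1 only; the rest of the
   sequence is filler. *)
move=> s0 st; pose tt k : R := if k == 0%N then s else if k == 1%N then t else t + k%:R.
pose xx k := if k == 0%N then x else y.
have tt1 k : (k <= 0)%N -> tt k < tt k.+1 by rewrite leqn0 => /eqP->.
have := @JQ 0%N tt xx s0 tt1; rewrite /tt /xx /= => e.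
rewrite /pr; transitivity (fine (P [set w | forall k, (k <= 1)%N -> J (tt k) w = xx k])).
  congr (fine (P _)); apply/seteqP; split => w /=.
    by move=> [a b] [|[|]].
  by move=> h; split; [exact: (h 0%N)|exact: (h 1%N)].
rewrite e; congr (fine (P _) * _); apply/seteqP; split => w /=.
  by move=> /(_ 0%N); apply.
by move=> h k; rewrite leqn0 => /eqP->.
Qed.

Let mX (B : set R) : measurable B -> measurable (X @^-1` B).
Proof.
move=> mB; apply: (process_sigma_algebra_measurable mJ).
exact: process_sigma_algebra_absorption_time.
Qed.

Variable j : 'I_p.
Let D : set Om := [set w | J 0 w = Some j].

Let mD : measurable D. Proof. exact: mJ. Qed.

Let mNone t : 0 <= t -> measurable [set w | J t w = None]. Proof. by move=> t0; exact: mJ. Qed.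

Let pr_None t : 0 < t -> pr P (D `&` [set w | J t w = None]) = pr P D * (1 - v j t).
Proof.
by move=> t0; rewrite pr_two_times// subr0 /survival subKr.
Qed.

(** Being absorbed for good holds for each fixed pair of times up to a null set, not path by path.
    Hence the comparison of [X] with the state at a fixed time goes through countably many rational
    times. *)
Let leaves_negligible s t : 0 <= s -> s < t ->
  P.-negligible ([set w | J s w = None] `&` ~` [set w | J t w = None]).
Proof.
move=> s0 st; have t0 : 0 <= t by rewrite (le_trans s0)// ltW.
have m1 := mNone s0; have m2 := mNone t0.
have m3 : measurable ([set w | J s w = None] `&` ~` [set w | J t w = None]).
  by apply: measurableI => //; exact: measurableC.
apply/(negligibleP _ m3); apply: (etrans (prE P m3)).
have := pr_DI P m1 m2; rewrite pr_two_times// (absorbing tQ iQ) ?subr_ge0 ?(ltW st)// mulr1.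
by move=> /(canLR (addKr _)); rewrite addNr => <-.
Qed.

(** Such a path is unabsorbed at each time [n + 1], an event of probability [pr P D * v j n.+1%:R],
    which tends to 0. *)
Let never_negligible : P.-negligible (D `&` never_absorbed J).
Proof.
pose E n := D `&` ~` [set w | J n.+1%:R w = None].
have mE n : measurable (E n) by apply: measurableI => //; apply: measurableC; exact: mNone.
have prEn n : pr P (E n) = pr P D * v j n.+1%:R.
  have := pr_DI P mD (mNone (ler0n R n.+1)); rewrite -/(E n) pr_None//.
  by move=> e; rewrite -[LHS](addKr (pr P D * (1 - v j n.+1%:R))) -e; ring.
have mI : measurable (\bigcap_n E n) by exact: bigcapT_measurable.
exists (\bigcap_n E n); split => //.
- rewrite prE//; congr EFin; apply/eqP; rewrite eq_le pr_ge0 andbT.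
  have c : pr P D * v j n.+1%:R @[n --> \oo] --> (0 : R).
    rewrite -[X in _ --> X](mulr0 (pr P D)); apply: cvgM; first exact: cvg_cst.
    have /cvg_pinftyP := survival_cvg_pinfty tQ iQ uT j; apply.
    apply/cvgryPge => A; near=> n.
    have : n.+1%:R >= n%:R :> R by rewrite ler_nat.
    by apply: le_trans; near: n; exact: nbhs_infty_ger.
  apply: (ler_cvg_to (cvg_cst (pr P (\bigcap_n E n))) c); apply: nearW => n.
  rewrite -prEn; apply: le_pr => //.
  by move=> w /(_ n); apply.
- move=> w [Dw nev] n _; split => // Jn; apply: nev.
  by exists n.+1%:R => //; rewrite ratr_nat ltr0n /=.
Unshelve. all: by end_near. Qed.

(** As [X w <= s < t], either there is a rational visit to [None] before [t], and outside a null set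
    the process is still there at [t], or the path is never absorbed. The strict gap between [s] and
    [t] makes room for the rational time. *)
Let pr_le_upper s t : 0 < s -> s < t -> pr P (D `&` [set w | X w <= s]) <= pr P D * (1 - v j t).
Proof.
move=> s0 st; have t0 : 0 < t by rewrite (lt_trans s0).
rewrite -pr_None//.
pose N := (D `&` never_absorbed J) `|` \bigcup_(r : rat)
  (if (0 : R) < ratr r < t then [set w | J (ratr r) w = None] `&` ~` [set w | J t w = None] else set0).
apply: (@le_pr_negligible _ _ _ _ _ _ N).
- by apply: measurableI => //; exact: (mX (measurable_itv `]-oo, s])).
- by apply: measurableI => //; exact: mNone (ltW t0).
- apply: negligibleU; first exact: never_negligible.
  apply: negligible_bigcup_rat => r; case: ifPn => [/andP[r0 rt]|_]; last exact: negligible_set0.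
  by apply: leaves_negligible => //; exact: ltW.
- move=> w [Dw /= Xs]; have Xt : [set w | X w < t] w by exact: le_lt_trans st.
  move: Xt; rewrite absorption_time_lt_preimage// => -[nev|[r _]].
    by right; left.
  case: ifPn => // rt Jr; have [Jt|Jt] := pselect (J t w = None); first by left.
  by right; right; exists r => //; rewrite rt.
Qed.

(** Being in [None] at time [t] implies [X <= t], which gives one inequality. The other is
    [pr_le_upper] at times decreasing to [t], by continuity of [v]. *)
Lemma absorption_time_law t : 0 < t ->
  pr P (D `&` [set w | t < X w]) = pr P D * v j t.
Proof.
move=> t0; have mle : measurable [set w | X w <= t] by exact: (mX (measurable_itv `]-oo, t])).
have -> : D `&` [set w | t < X w] = D `&` ~` [set w | X w <= t].
  by congr (_ `&` _); apply/seteqP; split => w /=; [move=> ?; apply/negP; rewrite -ltNge|move=> /negP; rewrite -ltNge].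
suff e : pr P (D `&` [set w | X w <= t]) = pr P D * (1 - v j t).
  have := pr_DI P mD mle; rewrite e => /(canLR (addKr _)) <-; ring.
apply/eqP; rewrite eq_le; apply/andP; split; last first.
  rewrite -pr_None//; apply: le_pr.
  - by apply: measurableI => //; exact: mNone (ltW t0).
  - exact: measurableI.
  - by move=> w [Dw Jt]; split => //; exact: absorption_time_le.
have c : pr P D * (1 - v j s) @[s --> t^'+] --> pr P D * (1 - v j t).
  apply: cvgM; first exact: cvg_cst.
  apply: cvgB; first exact: cvg_cst.
  by apply: cvg_at_right_filter; exact: continuous_survival.
apply: (ler_cvg_to (cvg_cst (pr P (D `&` [set w | X w <= t]))) c); near=> s.
by apply: pr_le_upper => //; near: s; exact: nbhs_right_gt.
Unshelve. all: by end_near. Qed.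

End AbsorptionTimeLaw.

(** * Moments with an exponential factor, from the tails *)

Section ExpMonomialMoments.
Context {R : realType}.
Notation mu := (@lebesgue_measure R).
Notation Rp := (`]0, +oo[%classic : set R).
Implicit Types (N : nat) (u t x : R).

Lemma measurable_lt_indicator d (S : measurableType d) (f g : S -> R) :
  measurable_fun setT f -> measurable_fun setT g ->
  measurable_fun setT (fun z => (g z < f z)%R%:R : R).
Proof.
move=> mf mg; have mlt : measurable_fun setT (fun z => (g z < f z)%R).
  exact: measurable_fun_ltr.
exact: (measurableT_comp (f := fun b : bool => b%:R : R)).
Qed.

Lemma expmono'_integrable N u : 0 < u -> mu.-integrable Rp (EFin \o expmono' N u).
Proof.
move=> u0; have e : expmono' N u = fun t => N%:R * expmono N.-1 u t + (- u) * expmono N u t.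
  by apply/funext => t; rewrite /expmono' mulNr.
by rewrite e; apply: integrable_lin; exact: expmono_integrable.
Qed.

(** The fundamental theorem on [[0, x]], written over the half-line with an indicator so that the
    domain no longer depends on [x] and Fubini applies. *)
Lemma expmono_layers N u x : 0 <= x ->
  \int[mu]_(t in Rp) ((t < x)%R%:R * expmono' N u t) = expmono N u x - (N == 0%N)%:R.
Proof.
rewrite le_eqVlt => /predU1P[<-|x0].
  rewrite expmono_at0 subrr /Rintegral integral0_eq// => t; rewrite Rp_gt0 => t0.
  by rewrite ltNge (ltW t0)/= mul0r.
rewrite -(expmono_at0 N u) -(FTC_cc x0 (fun t _ => is_derive_expmono N u t)
  (fun t _ => @continuous_expmono' _ N u t)).
rewrite /Rintegral; congr fine.
have mE : measurable_fun (`]0, x[ : set R) (EFin \o expmono' N u).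
  by apply/measurable_EFinP; apply: measurable_funTS; exact: measurable_expmono'.
rewrite (integral_itv_bndoo true false mE).
rewrite -(@setIidr _ Rp `]0, x[); last by move=> t; rewrite Rp_gt0 /= in_itv/= => /andP[].
rewrite integral_mkcondr; apply: eq_integral => t /set_mem; rewrite Rp_gt0 => t0.
rewrite patchE; case: ifPn => [/set_mem|/negP h].
  by rewrite /= in_itv/= => /andP[_ ->]; rewrite mul1r.
rewrite [t < x](_ : _ = false) ?mul0r//; apply/negP => tx; apply: h.
by rewrite inE/= in_itv/= t0.
Qed.

Context {dO : measure_display} {Om : measurableType dO}.
Variables (P : probability Om R) (D : set Om) (X : Om -> R) (v : R -> R).
Hypotheses (mD : measurable D) (mX : measurable_fun setT X).
Hypothesis X0 : forall w, 0 <= X w.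
Hypothesis tail : forall t, 0 < t -> pr P (D `&` [set w | t < X w]) = pr P D * v t.
Variable u : R.
Hypothesis u0 : 0 < u.

Let D_finite : (P D < +oo)%E.
Proof. by rewrite (le_lt_trans (probability_le1 P mD))// ltry. Qed.

Lemma bounded_integrable (f : Om -> R) C : measurable_fun setT f ->
  (forall w, `|f w| <= C) -> P.-integrable D (EFin \o f).
Proof.
move=> mf fC; have ic : P.-integrable D (EFin \o (fun=> C)).
  apply/integrableP; split; first exact: measurable_cst.
  by rewrite integral_cst//= lte_mul_pinfty// lee_fin normr_ge0.
apply: le_integrable ic => //; first by apply/measurable_EFinP; exact: measurable_funTS.
by move=> w _; rewrite /= lee_fin (le_trans (fC w))// ler_norm.
Qed.

Lemma tail_indicator_integral t : 0 < t ->
  \int[P]_(w in D) ((t < X w)%R%:R : R) = pr P D * v t.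
Proof.
move=> t0; rewrite -tail// /Rintegral /pr; congr fine.
have mt : measurable [set w | t < X w].
  by have := mX measurableT (measurable_itv `]t, +oo[); rewrite setTI preimage_itvoy.
rewrite setIC; apply: etrans (integral_indic P mD mt); apply: eq_integral => w _; rewrite indicE.
by have -> : (w \in [set w | t < X w]) = (t < X w) by apply/idP/idP => [/set_mem//|h]; apply/mem_set.
Qed.

(** Fubini for the layers of [expmono N u (X w)]. As [expmono'] may change sign, Tonelli is not
    enough; the domination by its absolute value, integrable in [t] and independent of [w], is. *)
Lemma expmono_moment N : mu.-integrable Rp (EFin \o (fun t => expmono' N u t * v t)) ->
  (\int[P]_(w in D) (expmono N u (X w))%:E =
  (pr P D * ((N == 0%N)%:R + \int[mu]_(t in Rp) (expmono' N u t * v t)))%:E)%E.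
Proof.
move=> iv; have [C C0 hC] := expmono_bounded N u0.
have mphi : measurable_fun setT (fun w => expmono N u (X w)).
  exact: (measurableT_comp (measurable_expmono N u)).
have iphi : P.-integrable D (EFin \o (fun w => expmono N u (X w))).
  by apply: (@bounded_integrable _ C) => // w; rewrite ger0_norm ?expmono_ge0// hC.
have -> : (\int[P]_(w in D) (expmono N u (X w))%:E =
    (\int[P]_(w in D) expmono N u (X w))%:E)%E.
  by rewrite /Rintegral fineK//; apply: integrable_fin_num => //; exact: iphi.
congr EFin.
pose k (z : Om * measurableTypeR R) : R := (z.2 < X z.1)%R%:R * expmono' N u z.2.
have mk : measurable_fun setT k.
  apply: measurable_funM.
    apply: measurable_lt_indicator; first exact: (measurableT_comp mX measurable_fst).
    exact: measurable_snd.
  exact: (measurableT_comp (measurable_expmono' N u) measurable_snd).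
have hi : mu.-integrable Rp (EFin \o (fun t => `|expmono' N u t|)).
  exact: (integrable_norm (expmono'_integrable N u0)).
have kh w t : D w -> Rp t -> Normc.normc (k (w, t))%:C <= `|expmono' N u t|.
  move=> _ _; rewrite normc_real /k/= normrM.
  by case: (t < X w); rewrite ?normr1 ?mul1r// normr0 mul0r.
have kk z : `|k z| <= Normc.normc (k z)%:C by rewrite normc_real.
have F := bounded_fubini (m1 := P) (m2 := mu) mD measurable_Rp D_finite hi kh mk kk.
have i1 : P.-integrable D (EFin \o (fun=> (N == 0%N)%:R : R)).
  apply: (@bounded_integrable _ 1); first exact: measurable_cst.
  by move=> _; case: (N == 0%N); rewrite ?normr1// normr0.
have i2 : P.-integrable D (EFin \o (fun w => expmono N u (X w) - (N == 0%N)%:R)).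
  exact: (integrableB mD iphi i1).
have -> : \int[P]_(w in D) expmono N u (X w) = \int[P]_(w in D) ((N == 0%N)%:R +
    (expmono N u (X w) - (N == 0%N)%:R)).
  by apply: eq_Rintegral => w _; rewrite addrC subrK.
rewrite (RintegralD mD i1 i2) Rintegral_cst// mulrDr; congr (_ + _); first exact: mulrC.
transitivity (\int[P]_(w in D) \int[mu]_(t in Rp) k (w, t)).
  by apply: eq_Rintegral => w _; rewrite /k/= expmono_layers.
rewrite F; transitivity (\int[mu]_(t in Rp) (pr P D * (expmono' N u t * v t))).
  apply: eq_Rintegral => t /set_mem; rewrite Rp_gt0 => t0.
  rewrite mulrCA -tail_indicator_integral//= /k/= -RintegralZl//.
    by apply: eq_Rintegral => w _; rewrite mulrC.
  apply: (@bounded_integrable _ 1); first exact: measurable_lt_indicator.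
  by move=> w; case: (_ < _); rewrite ?normr1// normr0.
by rewrite RintegralZl//; exact: measurable_Rp.
Qed.

End ExpMonomialMoments.

Section FractionalMoments.
Context {R : realType}.
Notation mu := (@lebesgue_measure R).
Notation Rp := (`]0, +oo[%classic : set R).
Context {dO : measure_display} {Om : measurableType dO}.
Variables (P : probability Om R) (D : set Om) (X : Om -> R).
Hypotheses (mD : measurable D) (mX : measurable_fun setT X).
Hypothesis X0 : forall w, 0 <= X w.
Hypothesis Xpos : P.-negligible (D `&` [set w | X w = 0]).
Variables (s : R) (N : nat) (m : R -> R).
Hypotheses (sN : s < N.+1%:R).
Hypothesis expmono_m : forall r, 0 < r ->
  (\int[P]_(w in D) (expmono N r (X w))%:E = (m r)%:E)%E.
Hypothesis im : mu.-integrable Rp (EFin \o (fun r => r `^ (N%:R - s) * m r)).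

Let G := Gamma_fun (N.+1%:R - s).

Let G0 : 0 < G. Proof. by rewrite Gamma_fun_gt0// subr_gt0. Qed.

Lemma fractional_moment : (\int[P]_(w in D) (X w `^ (s - 1))%:E =
  (G^-1 * \int[mu]_(r in Rp) (r `^ (N%:R - s) * m r))%:E)%E.
Proof.
pose f (z : Om * measurableTypeR R) : R := z.2 `^ (N%:R - s) * expmono N z.2 (X z.1).
have mXz : measurable_fun setT (fun z : Om * measurableTypeR R => X z.1).
  exact: (measurableT_comp mX measurable_fst).
have mf : measurable_fun setT (EFin \o f).
  apply/measurable_EFinP; apply: measurable_funM.
    exact: (measurableT_comp (measurable_powR _) measurable_snd).
  apply: measurable_funM; first exact: measurable_funX.
  apply: (measurableT_comp (@measurable_expR _)); apply: measurable_funN.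
  by apply: measurable_funM => //; exact: measurable_snd.
have f0 w r : D w -> Rp r -> (0 <= (EFin \o f) (w, r))%E.
  by move=> _ _; rewrite lee_fin mulr_ge0 ?powR_ge0 ?expmono_ge0.
have H := tonelli_on P mu mD measurable_Rp mf f0.
have inner w : (0 < X w) -> (\int[mu]_(r in Rp) (EFin \o f) (w, r) = (G * X w `^ (s - 1))%:E)%E.
  move=> Xw; have sN' : 0 < N.+1%:R - s by rewrite subr_gt0.
  transitivity ((X w ^+ N)%:E * \int[mu]_(r in Rp) (r `^ (N.+1%:R - s - 1) * expR (- (X w * r)))%:E)%E.
    rewrite -(@ge0_integralZl_EFin _ _ _ mu Rp measurable_Rp _ _ _ _ (exprn_ge0 N (X0 w))).
    - apply: eq_integral => r _; rewrite -EFinM /f /expmono /=; congr EFin.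
      have -> : N.+1%:R - s - 1 = N%:R - s by rewrite -natr1; ring.
      by rewrite [r * X w]mulrC; ring.
    - by move=> r _; rewrite lee_fin; apply: mulr_ge0; [exact: powR_ge0|exact: expR_ge0].
    - exact: measurable_gamma_scaled.
  rewrite (gamma_scale sN' Xw) -EFinM -/G; congr EFin.
  rewrite mulrCA; congr (_ * _).
  rewrite -(powR_mulrn N (X0 w)) -powRD; last by rewrite (gt_eqF Xw) implybT.
  by congr (_ `^ _); rewrite -natr1; ring.
(* The inner formula holds for [X w > 0] and may fail at [X w = 0]; [Xpos] makes the integrands
   agree almost everywhere. *)
have inner' : (\int[P]_(w in D) \int[mu]_(r in Rp) (EFin \o f) (w, r) =
    \int[P]_(w in D) (G * X w `^ (s - 1))%:E)%E.
  apply: ae_eq_integral => //.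
  - pose F := (EFin \o f) \_ (setT `*` Rp).
    have mF : measurable_fun setT F.
      apply/(measurable_restrictT _ (measurableX measurableT measurable_Rp)).
      exact: measurable_funTS.
    have F0 z : (0 <= F z)%E.
      by rewrite /F patchE; case: ifPn => // _; rewrite lee_fin mulr_ge0 ?powR_ge0 ?expmono_ge0.
    have := measurable_fun_fubini_tonelli_F (m2 := mu) F mF F0.
    move/(@measurable_funTS _ _ _ _ D); apply: eq_measurable_fun => w _.
    rewrite /fubini_F [RHS]integral_mkcond; apply: eq_integral => r _; rewrite /F !patchE.
    case: ifPn => [/set_mem[_ /= Rr]|/negP h]; first by rewrite mem_set.
    by case: ifPn => // /set_mem Rr; case: h; rewrite mem_set.
  - apply/measurable_EFinP; apply: measurable_funTS; apply: measurable_funM => //.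
    exact: (measurableT_comp (measurable_powR _) mX).
  - apply: negligibleS Xpos => w /= /not_implyP[Dw nw]; split => //.
    apply/eqP; rewrite eq_le X0 andbT leNgt; apply/negP => Xw; apply: nw.
    exact: inner.
have outer : (\int[mu]_(r in Rp) \int[P]_(w in D) (EFin \o f) (w, r) =
    (\int[mu]_(r in Rp) (r `^ (N%:R - s) * m r))%:E)%E.
  rewrite [in RHS]/Rintegral fineK; last exact: (integrable_fin_num measurable_Rp im).
  apply: eq_integral => r /set_mem; rewrite Rp_gt0 => r0.
  rewrite [RHS]EFinM -expmono_m// -ge0_integralZl_EFin ?powR_ge0//.
  - by move=> w _; rewrite lee_fin expmono_ge0.
  - apply/measurable_EFinP; apply: measurable_funTS.
    exact: (measurableT_comp (measurable_expmono N r) mX).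
move: H; rewrite inner' outer.
rewrite (eq_integral (fun w => G%:E * (X w `^ (s - 1))%:E)%E); last by move=> w _; rewrite EFinM.
rewrite ge0_integralZl_EFin ?(ltW G0)//; last 2 first.
- by move=> w _; rewrite lee_fin powR_ge0.
- apply/measurable_EFinP; apply: measurable_funTS.
  exact: (measurableT_comp (measurable_powR _) mX).
move: (\int[P]_(w in D) _)%E => I e.
by rewrite EFinM -e muleA -EFinM mulVf ?gt_eqF// mul1e.
Qed.

End FractionalMoments.

(** * Mixtures of products *)

Section ProductFormula.
Context {R : realType}.
Notation mu := (@lebesgue_measure R).
Notation Rp := (`]0, +oo[%classic : set R).
Context {dO : measure_display} {Om : measurableType dO}.
Variables (P : probability Om R) (D : set Om).
Hypothesis mD : measurable D.

Lemma integral_lt_indicator (y : R) : 0 <= y ->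
  (\int[mu]_(t in Rp) ((t < y)%R%:R : R)%:E = y%:E)%E.
Proof.
move=> y0; have mi : measurable (`]-oo, y[%classic : set (measurableTypeR R)) by exact: measurable_itv.
transitivity (\int[mu]_(t in Rp) (\1_(`]-oo, y[%classic : set R) t)%:E)%E.
  by apply: eq_integral => t _; rewrite indicE mem_setE in_itv.
apply: etrans (integral_indic mu measurable_Rp mi) _.
rewrite (_ : _ `&` _ = `]0, y[%classic); last first.
  apply/seteqP; split => t /=; rewrite !in_itv/= ?andbT.
    by move=> [-> ->].
  by move=> /andP[-> ->].
apply: etrans (lebesgue_measure_itv `]0, y[) _; rewrite /= lte_fin.
have [->|y1] := eqVneq y 0; first by rewrite ltxx.
by rewrite lt_def y1 y0 -EFinB subr0.
Qed.

Lemma tail_integral (Y : Om -> R) : measurable_fun setT Y -> (forall w, 0 <= Y w) ->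
  (\int[P]_(w in D) (Y w)%:E = \int[mu]_(t in Rp) (pr P (D `&` [set w | t < Y w]))%:E)%E.
Proof.
move=> mY Y0; pose f (z : Om * measurableTypeR R) : \bar R := ((z.2 < Y z.1)%R%:R)%:E.
have mf : measurable_fun setT f.
  apply/measurable_EFinP; apply: measurable_lt_indicator; last exact: measurable_snd.
  exact: (measurableT_comp mY measurable_fst).
have f0 w t : D w -> Rp t -> (0 <= f (w, t))%E by rewrite lee_fin.
have := tonelli_on P mu mD measurable_Rp mf f0.
have -> : (\int[P]_(w in D) \int[mu]_(t in Rp) f (w, t) = \int[P]_(w in D) (Y w)%:E)%E.
  apply: eq_integral => w _. have Z := integral_lt_indicator (Y0 w). exact: Z.
move=> ->; apply: eq_integral => t _.
have mt : measurable [set w | t < Y w].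
  by have := mY measurableT _ (measurable_itv `]t, +oo[); rewrite setTI preimage_itvoy.
rewrite -prE; last exact: measurableI.
rewrite setIC; apply: etrans (integral_indic P mD mt); apply: eq_integral => w _.
rewrite indicE /f /=.
by have -> : (w \in [set w | t < Y w]) = (t < Y w) by apply/idP/idP => [/set_mem//|h]; apply/mem_set.
Qed.

Variables (d : nat) (Y : 'I_d -> Om -> R) (e : 'I_d -> R).
Hypothesis mY : forall i, measurable_fun setT (Y i).
Hypothesis Y0 : forall i w, 0 <= Y i w.
Hypothesis D0 : 0 < pr P D.
Hypothesis indep : forall r : 'I_d -> R,
  pr P (D `&` \bigcap_i [set w | r i < Y i w]) =
  pr P D * \prod_i (pr P (D `&` [set w | r i < Y i w]) / pr P D).
Hypothesis eY : forall i, (\int[P]_(w in D) (Y i w)%:E = (pr P D * e i)%:E)%E.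

Let q i t : R := pr P (D `&` [set w | t < Y i w]) / pr P D.

Let q0 i t : 0 <= q i t.
Proof. by rewrite divr_ge0 ?pr_ge0. Qed.

Let mlt i t : measurable [set w | t < Y i w].
Proof. by have := mY i measurableT (measurable_itv `]t, +oo[); rewrite setTI preimage_itvoy. Qed.

Let measurable_q i : measurable_fun Rp (q i).
Proof.
apply: nonincreasing_measurable => // t u tu.
rewrite ler_pM2r ?invr_gt0//; apply: le_pr; [exact: measurableI|exact: measurableI|].
by move=> w [Dw]; split => //=; exact: le_lt_trans tu _.
Qed.

Let integral_q i : (\int[mu]_(t in Rp) (q i t)%:E = (e i)%:E)%E.
Proof.
have := eY i; rewrite (tail_integral (mY i) (Y0 i)).
have -> : (\int[mu]_(t in Rp) (pr P (D `&` [set w | t < Y i w]))%:E =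
    \int[mu]_(t in Rp) ((pr P D)%:E * (q i t)%:E))%E.
  by apply: eq_integral => t _; rewrite -EFinM /q mulrC divfK// gt_eqF.
rewrite (@ge0_integralZl_EFin _ _ _ mu Rp measurable_Rp _ _ _ _ (ltW D0)); last 2 first.
- by move=> t _; rewrite lee_fin.
- by apply/measurable_EFinP; exact: measurable_q.
move: (\int[mu]_(t in Rp) _)%E => I eI.
have -> : I = ((pr P D)^-1%:E * ((pr P D)%:E * I))%E.
  by rewrite muleA -EFinM mulVf ?mul1e// gt_eqF.
by rewrite eI -EFinM mulKf// gt_eqF.
Qed.

Let factor k (r : 'I_d -> R) (i : 'I_d) (w : Om) : R := if (i < k)%N then Y i w else (r i < Y i w)%R%:R.

Let factor0 k r i w : 0 <= factor k r i w.
Proof. by rewrite /factor; case: ifP. Qed.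

Let mfactor k r i : measurable_fun setT (factor k r i).
Proof.
rewrite /factor; case: (i < k)%N; first exact: mY.
by apply: measurable_lt_indicator => //; exact: measurable_cst.
Qed.

Let value k (r : 'I_d -> R) (i : 'I_d) : R := if (i < k)%N then e i else q i (r i).

Let update (r : 'I_d -> R) (i0 : 'I_d) (t : R) (i : 'I_d) : R := if i == i0 then t else r i.

(** Interpolates between [k = 0], a product of indicators, where independence of tail events is the
    statement, and [k = d], the product of the [Y i]. Integrating over the threshold [r k] turns the
    indicator of [r k < Y k] into [Y k], so the thresholds have to stay general. *)
Let mixed_product k : (k <= d)%N -> forall r : 'I_d -> R,
  (\int[P]_(w in D) (\prod_i factor k r i w)%:E = (pr P D * \prod_i value k r i)%:E)%E.
Proof.
elim: k => [_ r|k ih kd r].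
  rewrite /value /= -indep -prE; last first.
    by apply: measurableI => //; apply: fin_bigcap_measurable => //; exact: mlt.
  have mI : measurable (\bigcap_i [set w | r i < Y i w]).
    by apply: fin_bigcap_measurable => //; exact: mlt.
  rewrite setIC; apply: etrans (integral_indic P mD mI); apply: eq_integral => w _.
  rewrite indicE; congr EFin.
  have [h|h] := pselect ((\bigcap_i [set w | r i < Y i w]) w).
    by rewrite mem_set// big1// => i _; rewrite /factor/= (h i).
  rewrite memNset//; have [i hi] : exists i, ~ (r i < Y i w).
    by apply/existsNP => h'; apply: h => i _; exact: h'.
  by rewrite (bigD1 i)//= /factor/=; move/negP/negbTE: hi => ->; rewrite mul0r.
pose i0 : 'I_d := Ordinal kd.
(* The steps [k] and [k.+1] differ at the index [i0] only, where the former has the indicator with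
   threshold [t]. *)
have fE t w i : factor k (update r i0 t) i w = if i == i0 then (t < Y i0 w)%R%:R else factor k.+1 r i w.
  rewrite /factor /update; case: eqVneq => [->|ne]; first by rewrite /= ltnn.
  by rewrite ltnS [(i <= k)%N]leq_eqVlt -[k]/(val i0) val_eqE (negPf ne).
have vE t i : value k (update r i0 t) i = if i == i0 then q i0 t else value k.+1 r i.
  rewrite /value /update; case: eqVneq => [->|ne]; first by rewrite /= ltnn.
  by rewrite ltnS [(i <= k)%N]leq_eqVlt -[k]/(val i0) val_eqE (negPf ne).
pose rest w : R := \prod_(i | i != i0) factor k.+1 r i w.
have rest0 w : 0 <= rest w by apply: prodr_ge0.
have mrest : measurable_fun setT rest.
  by rewrite /rest; under eq_fun do rewrite -big_filter; exact: measurable_prod.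
pose f (z : Om * measurableTypeR R) : \bar R := ((z.2 < Y i0 z.1)%R%:R * rest z.1)%:E.
have mf : measurable_fun setT f.
  apply/measurable_EFinP; apply: measurable_funM.
    apply: measurable_lt_indicator; last exact: measurable_snd.
    exact: (measurableT_comp (mY i0) measurable_fst).
  exact: (measurableT_comp mrest measurable_fst).
have f0 w t : D w -> Rp t -> (0 <= f (w, t))%E by rewrite lee_fin mulr_ge0.
have H := tonelli_on P mu mD measurable_Rp mf f0.
transitivity (\int[P]_(w in D) \int[mu]_(t in Rp) f (w, t))%E.
  apply: eq_integral => w _; rewrite (bigD1 i0)//= -/(rest w) {1}/factor ltnSn EFinM.
  rewrite muleC -(integral_lt_indicator (Y0 i0 w)) -ge0_integralZl_EFin//.
  - by apply: eq_integral => t _; rewrite -EFinM mulrC.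
  - apply/measurable_EFinP; apply: measurable_funTS.
    by apply: measurable_lt_indicator; [exact: measurable_cst|exact: measurable_id].
rewrite H; transitivity (\int[mu]_(t in Rp) ((pr P D * \prod_(i | i != i0) value k.+1 r i)%:E * (q i0 t)%:E))%E.
  apply: eq_integral => t _; have := ih (ltnW kd) (update r i0 t).
  rewrite (bigD1 i0)//= vE eqxx (eq_bigr (value k.+1 r)); last by move=> i /negPf ne; rewrite vE ne.
  rewrite mulrCA mulrC -EFinM => <-; apply: eq_integral => w _.
  rewrite (bigD1 i0)//= fE eqxx (eq_bigr (fun i => factor k.+1 r i w))//.
  by move=> i /negPf ne; rewrite fE ne.
have v0 : 0 <= pr P D * \prod_(i | i != i0) value k.+1 r i.
  apply: mulr_ge0; first exact: ltW.
  apply: prodr_ge0 => i _; rewrite /value; case: ifP => // _.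
  rewrite -(pmulr_rge0 _ D0) -lee_fin -eY; apply: integral_ge0 => w _.
  by rewrite lee_fin.
rewrite (@ge0_integralZl_EFin _ _ _ mu Rp measurable_Rp _ _ _ _ v0); last 2 first.
- by move=> t _; rewrite lee_fin.
- by apply/measurable_EFinP; exact: measurable_q.
rewrite integral_q.
by rewrite -EFinM [in RHS](bigD1 i0)//= {2}/value ltnSn; congr EFin; ring.
Qed.

Lemma expectation_product :
  (\int[P]_(w in D) (\prod_i Y i w)%:E = (pr P D * \prod_i e i)%:E)%E.
Proof.
have := mixed_product (leqnn d) (fun=> 0); rewrite /factor /value.
under eq_integral do under eq_bigr do rewrite ltn_ord.
by under [in RHS]eq_bigr do rewrite ltn_ord.
Qed.

End ProductFormula.

(** * Moments of the survival functions and matrix powers *)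

Section MatrixMoments.
Context {R : realType} {p : nat}.
Notation mu := (@lebesgue_measure R).
Notation Rp := (`]0, +oo[%classic : set R).
Variable T : 'M[R]_p.+1.
Hypotheses (sT : subintensity T) (uT : T \in unitmx).

(** Otherwise [- u < 0] would be an eigenvalue of [- T]. *)
Lemma shifted_unitmx u : 0 < u -> u%:M - T \in unitmx.
Proof.
move=> u0; apply/negPn/negP => nu.
have : eigenvalue (map_mx (real_complex R) (- T)) (- u%:C).
  rewrite /eigenvalue /eigenspace kermx_eq0 row_free_unit.
  rewrite (_ : _ - _ = map_mx (real_complex R) (u%:M - T)) ?map_unitmx//.
  by rewrite map_mxD map_scalar_mx addrC -rmorphN /= -raddfN /= opprK.
by move=> /(subintensity_eigenvalue sT uT) /=; rewrite oppr_gt0 ltNge ltW.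
Qed.

Definition shifted_inv u : 'M[R]_p.+1 := invmx (u%:M - T).

Lemma shifted_invK u : 0 < u -> shifted_inv u * (- T + u%:M) = 1.
Proof. by move=> u0; rewrite [- T + _]addrC; exact: mulVmx (shifted_unitmx u0). Qed.

(** [T] commutes with its resolvent; this links the exit rates of the Laplace transform to the form
    [A (A + u)^-1 e] that integration by parts yields. *)
Lemma shifted_inv_exit u : 0 < u ->
  shifted_inv u *m exit_rates T = - T * shifted_inv u *m evec.
Proof.
move=> u0; have uS := shifted_unitmx u0.
have e : shifted_inv u *m (u%:M - T) = (u%:M - T) *m shifted_inv u by rewrite mulVmx// mulmxV.
rewrite mulmxBr mulmxBl mul_mx_scalar mul_scalar_mx in e.
have {}e : shifted_inv u *m T = T *m shifted_inv u by move: e => /addrI/oppr_inj.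
by rewrite /exit_rates mulmxN mulmxA e -[RHS]mulmxA mulNmx -mulmxA.
Qed.

Section survival_moments.
Variable Q : R -> option 'I_p.+1 -> option 'I_p.+1 -> R.
Hypotheses (tQ : transition_function Q) (iQ : has_intensities Q (intensity T)).

Lemma survival_momentE u N : 0 < u ->
  survival_moment Q u N = N`!%:R *: (shifted_inv u ^+ N.+1 *m evec).
Proof.
move=> u0; have K M : M = shifted_inv u *m ((u%:M - T) *m M) :> 'cV_p.+1.
  by rewrite mulKmx// shifted_unitmx.
elim: N => [|N ih]; rewrite [LHS]K (survival_moment_rec tQ iQ uT u0).
  by rewrite scale1r scale0r addr0 fact0 scale1r expr1.
rewrite /= scale0r add0r ih scalerA -natrM -factS -scalemxAr mulmxA.
by rewrite [shifted_inv u ^+ N.+2]exprS.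
Qed.

Lemma expmono_survival u N j : 0 < u ->
  (N == 0%N)%:R + \int[mu]_(t in Rp) (expmono' N u t * survival Q j t) =
  N`!%:R * (- T * shifted_inv u ^+ N.+1 *m evec) j 0.
Proof.
move=> u0; rewrite (survival_moment' tQ iQ u0 N j).2.
transitivity ((- T *m survival_moment Q u N) j 0); last first.
  by rewrite survival_momentE// -scalemxAr mulmxA mxE.
have := survival_moment_rec tQ iQ uT u0 N.
move: (survival_moment Q u N) (survival_moment Q u N.-1) => V V' rec.
have -> : - T *m V = (u%:M - T) *m V - u *: V by rewrite mulmxBl mul_scalar_mx mulNmx addrAC subrr add0r.
rewrite rec !mxE; ring.
Qed.

End survival_moments.

Section power.
Variables (theta : R) (N : nat).
Hypotheses (a0 : 0 < theta + 1) (aN : theta + 1 < N.+1%:R).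

Let entry j k r : R := r `^ (N%:R - (theta + 1)) * (- T * shifted_inv r ^+ N.+1) j k.

Let A := map_mx (real_complex R) (- T).
Let B r := map_mx (real_complex R) (shifted_inv r).

Let AB r : 0 < r -> B r * (A + (r%:C)%:M) = 1.
Proof.
move=> r0; have := congr1 (map_mx (real_complex R)) (shifted_invK r0).
by rewrite map_mxM map_mxD map_scalar_mx map_mx1.
Qed.

Let entryE j k r : (r `^ (N%:R - (theta + 1)))%:C * (A * B r ^+ N.+1) j k = (entry j k r)%:C.
Proof.
have -> : A * B r ^+ N.+1 = map_mx (real_complex R) (- T * shifted_inv r ^+ N.+1).
  by rewrite rmorphM rmorphXn.
by rewrite mxE -rmorphM.
Qed.

(** The entries are real although the contour integrals are complex: after Stieltjes' formula only
    the real matrices [shifted_inv T r] remain. *)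
Lemma matpow_entry j k : mu.-integrable Rp (EFin \o entry j k) /\
  matpow (- T) (- theta) j k =
  ((stieltjes_const (theta + 1) N)^-1 * \int[mu]_(r in Rp) entry j k r)%:C.
Proof.
have [g adm] := exists_admissible_contour (fun z => subintensity_eigenvalue sT uT (z := z)).
pose M : 'M[R[i]]_p.+1 := \matrix_(j, k) ((stieltjes_const (theta + 1) N)^-1 *
  \int[mu]_(r in Rp) entry j k r)%:C.
have C g' : admissible_contour slit_plane A g' -> contour_mx (cpow (- theta)) A g' = M.
  move=> adm'; apply/matrixP => a b; rewrite [RHS]mxE.
  have [_ ->] := contour_mx_cpow AB adm' a b a0 aN.
  rewrite rmorphM /=; congr (_ * _); apply: complex_ext => /=.
  - by apply: eq_Rintegral => r _; rewrite entryE.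
  - rewrite (_ : (fun r => _) = fun=> 0); last by apply/funext => r; rewrite entryE.
    by rewrite /Rintegral integral0.
split.
  have [[i1 _] _] := contour_mx_cpow AB adm j k a0 aN.
  apply: eq_integrable i1 => [|r _]; first exact: measurable_Rp.
  by rewrite /= entryE.
have -> : matpow (- T) (- theta) = M; last by rewrite mxE.
(* A contour exists and all contours give [M], so the default value is excluded and the chosen
   matrix can only be [M]. *)
rewrite /matpow /matfun; case: xgetP => [M' _ [_ h]|h].
  by rewrite -(h g adm) C.
by case: (h M); split; [exists g|exact: C].
Qed.

End power.
End MatrixMoments.

Section Mixture.
Context {R : realType} {dO : measure_display} {Om : measurableType dO} {p : nat}.
Variables (P : probability Om R) (J0 : Om -> option 'I_p) (piv : 'rV[R]_p).
Hypothesis mJ0 : forall x, measurable [set w | J0 w = x].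
Hypothesis PJ0 : forall j, P [set w | J0 w = Some j] = (piv 0 j)%:E.
Hypothesis sum_piv : \sum_j piv 0 j = 1.

Let integral_partition (f : Om -> \bar R) : measurable_fun setT f -> (forall w, 0 <= f w)%E ->
  (\int[P]_w f w = \sum_(x : option 'I_p) \int[P]_(w in [set w | J0 w = x]) f w)%E.
Proof.
move=> mf f0; transitivity (\int[P]_w \sum_(x : option 'I_p) (f \_ [set w | J0 w = x]) w)%E.
  apply: eq_integral => w _; rewrite (bigD1 (J0 w))//= patchE mem_set// big1 ?adde0// => x xw.
  by rewrite patchE memNset//= => e; move: xw; rewrite e eqxx.
rewrite ge0_integral_sum//.
- by apply: eq_bigr => x _; rewrite -integral_mkcond.
- by move=> x; apply/(measurable_restrictT _ (mJ0 x)); exact: measurable_funTS.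
- by move=> x w _; rewrite patchE; case: ifP.
Qed.

Lemma integral_mixture (f : Om -> \bar R) : measurable_fun setT f -> (forall w, 0 <= f w)%E ->
  (\int[P]_w f w = \sum_j \int[P]_(w in [set w | J0 w = Some j]) f w)%E.
Proof.
move=> mf f0; rewrite integral_partition// big_option.
(* The weights of the states [Some j] already sum to 1, so starting in the absorbing state has
   probability 0. *)
suff N0 : P [set w | J0 w = None] = 0%E.
  by rewrite null_set_integral ?add0e//; exact: measurable_funTS.
have P1 (D : set Om) : measurable D -> (\int[P]_(w in D) cst 1%E w = P D)%E.
  by move=> mD; rewrite integral_cst// mul1e.
have h := @integral_partition (cst 1%E) (measurable_cst _) (fun=> lee01).
rewrite P1// big_option P1// in h.
rewrite (eq_bigr (fun j => (piv 0 j)%:E)) in h; last by move=> j _; rewrite P1// PJ0.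
have {}h : (1 = P [set w | J0 w = None] + 1%:E)%E by rewrite -{1}(probability_setT P) h sumEFin sum_piv.
rewrite (prE P (mJ0 None)) -EFinD in h *.
by have := EFin_inj h => {}h; congr EFin; lra.
Qed.

Context {d : nat}.
Variables (X : 'I_d -> Om -> R) (phi : 'I_d -> R -> R) (e : 'I_d -> 'I_p -> R).
Hypothesis mX : forall i, measurable_fun setT (X i).
Hypothesis mphi : forall i, measurable_fun setT (phi i).
Hypothesis phi0 : forall i w, 0 <= phi i (X i w).
Hypothesis indep : forall j (B : 'I_d -> set R), (forall i, measurable (B i)) ->
  P [set w | J0 w = Some j] != 0%E ->
  cond_prob P (\bigcap_i (X i @^-1` B i)) [set w | J0 w = Some j] =
  \prod_(i < d) cond_prob P (X i @^-1` B i) [set w | J0 w = Some j].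
Hypothesis phi_e : forall i j,
  (\int[P]_(w in [set w | J0 w = Some j]) (phi i (X i w))%:E = (piv 0 j * e i j)%:E)%E.

Lemma expectation_mixture :
  ('E_P[(fun w => \prod_(i < d) phi i (X i w))%R] = (\sum_j piv 0 j * \prod_i e i j)%:E)%E.
Proof.
have mY i : measurable_fun setT (fun w => phi i (X i w)) by exact: measurableT_comp.
rewrite unlock integral_mixture; last 2 first.
- by apply/measurable_EFinP; exact: measurable_prod.
- by move=> w; rewrite lee_fin prodr_ge0.
rewrite -sumEFin; apply: eq_bigr => j _.
have prD : pr P [set w | J0 w = Some j] = piv 0 j by rewrite /pr PJ0.
(* Conditional independence is available for states of positive mass only; the others contribute 0
   on both sides. *)
have [D0|D0] := eqVneq (P [set w | J0 w = Some j]) 0%E.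
  rewrite null_set_integral//; last first.
    by apply: measurable_funTS; apply/measurable_EFinP; exact: measurable_prod.
  by move: D0; rewrite PJ0 => -[->]; rewrite mul0r.
have pi0 : 0 < piv 0 j by rewrite lt_neqAle -{2}prD pr_ge0 andbT eq_sym -eqe -PJ0.
have ind (r : 'I_d -> R) : pr P ([set w | J0 w = Some j] `&` \bigcap_i [set w | r i < phi i (X i w)]) =
    pr P [set w | J0 w = Some j] *
    \prod_i (pr P ([set w | J0 w = Some j] `&` [set w | r i < phi i (X i w)]) /
             pr P [set w | J0 w = Some j]).
  have mB i : measurable (phi i @^-1` `]r i, +oo[).
    by have := mphi i measurableT (measurable_itv `]r i, +oo[); rewrite setTI.
  have XB i : [set w | r i < phi i (X i w)] = X i @^-1` (phi i @^-1` `]r i, +oo[).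
    by apply/seteqP; split => w /=; rewrite in_itv/= andbT.
  have := indep mB D0; rewrite /cond_prob -/(pr P _) -/(pr P [set w | J0 w = Some j]) prD => h.
  rewrite (eq_bigcapr (fun i _ => XB i)) setIC.
  rewrite -[LHS](divfK (lt0r_neq0 pi0)) [LHS]mulrC h; congr (_ * _).
  by apply: eq_bigr => i _; rewrite XB setIC.
rewrite -prD; apply: (expectation_product (mJ0 (Some j)) mY phi0 _ ind); first by rewrite prD.
by move=> i; rewrite prD phi_e.
Qed.

End Mixture.

(** * Laplace transforms and fractional moments of one absorption time *)

Section AbsorptionTimeMoments.
Context {R : realType} {dO : measure_display} {Om : measurableType dO} {p : nat}.
Notation mu := (@lebesgue_measure R).
Notation Rp := (`]0, +oo[%classic : set R).
Variables (P : probability Om R) (J : R -> Om -> option 'I_p.+1) (T : 'M[R]_p.+1).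
Hypotheses (sT : subintensity T) (uT : T \in unitmx).
Hypothesis JT : markov_jump_process P J (intensity T).

Notation X := (absorption_time J).

Let mJ t x : 0 <= t -> measurable [set w | J t w = x].
Proof. by case: JT => + _ _; exact. Qed.

Let pJ : jump_paths J. Proof. by case: JT. Qed.

Lemma measurable_fun_absorption_time : measurable_fun setT X.
Proof.
move=> _ B mB; rewrite setTI; apply: (process_sigma_algebra_measurable mJ).
exact: process_sigma_algebra_absorption_time.
Qed.

Variable j : 'I_p.+1.
Let D : set Om := [set w | J 0 w = Some j].
Let mD : measurable D. Proof. exact: mJ. Qed.

Let mlt t : measurable [set w | t < X w].
Proof.
have := measurable_fun_absorption_time measurableT (measurable_itv `]t, +oo[).
by rewrite setTI preimage_itvoy.
Qed.

Lemma expmono_absorption_time u N : 0 < u ->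
  (\int[P]_(w in D) (expmono N u (X w))%:E =
  (pr P D * (N`!%:R * (- T * shifted_inv T u ^+ N.+1 *m evec) j 0))%:E)%E.
Proof.
move=> u0; have [_ _ [Q [tQ iQ JQ]]] := JT.
rewrite -(expmono_survival sT uT tQ iQ N j u0).
apply: (expmono_moment mD measurable_fun_absorption_time (absorption_time_ge0 J)) => //.
  by move=> t t0; exact: (absorption_time_law mJ pJ tQ iQ JQ uT).
exact: (survival_moment' tQ iQ u0 N j).1.
Qed.

(** The probability of [X > 0] within [D] is at least [pr P D] times the survival function at any
    [t > 0], which tends to 1 as [t] decreases to 0. *)
Let absorption_time_pos : P.-negligible (D `&` [set w | X w = 0]).
Proof.
have [_ _ [Q [tQ iQ JQ]]] := JT.
have mN : measurable (D `&` ~` [set w | 0 < X w]).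
  by apply: measurableI => //; apply: measurableC; exact: mlt.
exists (D `&` ~` [set w | 0 < X w]); split => //; last first.
  by move=> w [Dw /= X0]; split => //=; rewrite X0 ltxx.
apply: (etrans (prE P mN)); congr EFin.
have := pr_DI P mD (mlt 0) => /(canLR (addKr _)) <-.
apply/eqP; rewrite addrC subr_eq0 eq_le; apply/andP; split; last first.
  by apply: le_pr; [exact: measurableI|exact: mD|exact: subIsetl].
have c : pr P D * survival Q j t @[t --> 0^'+] --> pr P D * 1.
  by apply: cvgM (survival_cvg0 tQ iQ j); exact: cvg_cst.
rewrite -[leLHS]mulr1; apply: (ler_cvg_to c (cvg_cst _)); near=> t.
have t0 : 0 < t by near: t; exact: nbhs_right_gt.
rewrite -(absorption_time_law mJ pJ tQ iQ JQ uT j t0); apply: le_pr.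
- exact: measurableI.
- exact: measurableI.
- by move=> w [Dw /= tX]; split => //=; exact: lt_trans tX.
Unshelve. all: by end_near. Qed.

(** [matpow] is complex-valued, so the moment is a real [e] whose embedding is compared with the
    matrix expression; it is kept multiplied by [pr P D], which may be 0. *)
Lemma power_absorption_time theta : -1 < theta -> exists2 e : R,
  (\int[P]_(w in D) (X w `^ theta)%:E = (pr P D * e)%:E)%E &
  e%:C = (Gamma_fun (theta + 1))%:C * ((delta_mx j 0 : 'cV[R[i]]_p.+1)^T *m
    matpow (- T) (- theta) *m (const_mx 1 : 'cV[R[i]]_p.+1)) 0 0.
Proof.
move=> theta1; set s := theta + 1.
have s0 : 0 < s by rewrite /s; lra.
pose N := Num.bound s.
have sN : s < N.+1%:R.
  by apply: lt_le_trans (archi_boundP (ltW s0)) _; rewrite ler_nat.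
pose h k r : R := r `^ (N%:R - s) * (- T * shifted_inv T r ^+ N.+1) j k.
have M k := matpow_entry sT uT s0 sN j k.
have ih k : mu.-integrable Rp (EFin \o h k) by have [] := M k.
pose m r : R := pr P D * (N`!%:R * (- T * shifted_inv T r ^+ N.+1 *m evec) j 0).
have mE r : r `^ (N%:R - s) * m r = \sum_k (pr P D * N`!%:R) * h k r.
  rewrite -mulr_sumr /m mxE mulrCA -[in RHS]mulrA; congr (_ * _).
  rewrite mulrCA; congr (_ * _).
  by rewrite mulr_sumr; apply: eq_bigr => k _; rewrite [evec _ _]mxE mulr1.
have [im1 im2] := integrable_sumZ (index_enum 'I_p.+1) (fun=> pr P D * N`!%:R) ih.
have im : mu.-integrable Rp (EFin \o (fun r => r `^ (N%:R - s) * m r)).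
  by apply: eq_integrable im1 => [|r _]; [exact: measurable_Rp|rewrite /= mE].
have F := fractional_moment mD measurable_fun_absorption_time (absorption_time_ge0 J)
  absorption_time_pos sN (fun r r0 => expmono_absorption_time N r0) im.
pose G : R := Gamma_fun (N.+1%:R - s).
(* The constants fit: [N! / Gamma(N + 1 - s) = Gamma(s) / stieltjes_const s N], so the auxiliary [N]
   disappears and [Gamma(theta + 1)] remains. *)
exists (G^-1 * N`!%:R * \sum_k \int[mu]_(r in Rp) h k r).
  move: F; rewrite /s addrK -/s => ->; congr EFin.
  have -> : \int[mu]_(r in Rp) (r `^ (N%:R - s) * m r) =
     \int[mu]_(r in Rp) (\sum_k (pr P D * N`!%:R) * h k r) by apply: eq_Rintegral => r _.
  by rewrite im2 -mulr_sumr; ring.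
rewrite -mulmxA trmx_delta -rowE mxE [X in _ = _ * X]mxE.
rewrite [X in _ = _ * X](eq_bigr (matpow (- T) (- theta) j)); last by move=> k _; rewrite [const_mx _ _ _]mxE mulr1.
rewrite (eq_bigr _ (fun k _ => (M k).2)) -rmorph_sum -rmorphM; congr (_%:C).
rewrite -mulr_sumr mulrA; congr (_ * _).
rewrite /stieltjes_const -/s -/G.
have G0 : G != 0 by rewrite gt_eqF// Gamma_fun_gt0// subr_gt0.
have g0 : Gamma_fun s != 0 by rewrite gt_eqF// Gamma_fun_gt0.
have n0 : N`!%:R != 0 :> R by rewrite pnatr_eq0 -lt0n fact_gt0.
move: (Gamma_fun s) (N`!%:R : R) G0 g0 n0; move: G => x y z x0 y0 z0.
by field; rewrite x0 y0 z0.
Qed.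

End AbsorptionTimeMoments.

Theorem theorem2p6 (R : realType) (dO : measure_display)
    (Om : measurableType dO) (P : probability Om R) (d p : nat)
    (X : 'I_d -> Om -> R) (piv : 'rV[R]_p) (T : 'I_d -> 'M[R]_p)
    (hX : mPH P X piv T) :
  (forall u : 'I_d -> R, (forall i, 0 < u i) ->
     ('E_P[(fun w => expR (- \sum_(i < d) u i * X i w))%R])%E =
     (\sum_(j < p) piv 0 j *
        \prod_(i < d) ((delta_mx j 0 : 'cV[R]_p)^T *m
                       invmx ((u i)%:M - T i) *m exit_rates (T i)) 0 0)%:E)
  /\
  (forall theta : 'I_d -> R, (forall i, -1 < theta i) ->
     exists2 m : R,
       ('E_P[(fun w => \prod_(i < d) (X i w `^ theta i))%R])%E = m%:E &
       m%:C =
       \sum_(j < p) (piv 0 j)%:C *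
         \prod_(i < d) ((Gamma_fun (theta i + 1))%:C *
           ((delta_mx j 0 : 'cV[R[i]]_p)^T *m
             matpow (- T i) (- theta i) *m (const_mx 1 : 'cV[R[i]]_p)) 0 0)).
Proof.
case: hX => -[piv0 sum_piv] sT uT [J0 [J [[mJ0 PJ0] JT JJ0 indJ XJ]]].
(* An empty state space is excluded by the total mass 1; a successor dimension gives square matrices
   their ring structure. *)
case: p piv T piv0 sum_piv sT uT J0 J mJ0 PJ0 JT JJ0 indJ XJ => [|p'] piv' T' piv0 sum_piv sT uT
  J0 J mJ0 PJ0 JT JJ0 indJ XJ.
  by move: sum_piv; rewrite big_ord0 => /eqP; rewrite eq_sym oner_eq0.
have XE i : X i = absorption_time (J i) by apply/funext => w; exact: XJ.
have mX i : measurable_fun setT (X i).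
  by rewrite XE; exact: (measurable_fun_absorption_time (JT i)).
have X0 i w : 0 <= X i w by rewrite XE absorption_time_ge0.
have D0E i j : [set w | J i 0 w = Some j] = [set w | J0 w = Some j].
  by apply/seteqP; split => w /=; rewrite JJ0.
have prD j : pr P [set w | J0 w = Some j] = piv' 0 j by rewrite /pr PJ0.
have ind j (B : 'I_d -> set R) : (forall i, measurable (B i)) ->
    P [set w | J0 w = Some j] != 0%E ->
    cond_prob P (\bigcap_i (X i @^-1` B i)) [set w | J0 w = Some j] =
    \prod_(i < d) cond_prob P (X i @^-1` B i) [set w | J0 w = Some j].
  move=> mB PD; apply: indJ => // i; rewrite XE.
  by apply: process_sigma_algebra_absorption_time => //; case: (JT i).
split => [u u0|theta theta1].
- pose e i j := (- T' i * shifted_inv (T' i) (u i) ^+ 1 *m evec) j 0.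
  rewrite (_ : (fun w => _) = (fun w => \prod_(i < d) expmono 0 (u i) (X i w))); last first.
    apply/funext => w; rewrite -sumrN expR_sum; apply: eq_bigr => i _.
    by rewrite /expmono expr0 mul1r.
  rewrite (expectation_mixture mJ0 PJ0 sum_piv (phi := fun i => expmono 0 (u i)) (e := e) mX) //.
  + congr EFin; apply: eq_bigr => j _; congr (_ * _); apply: eq_bigr => i _.
    by rewrite /e expr1 -mulmxA trmx_delta -rowE [RHS]mxE -shifted_inv_exit.
  + by move=> i; exact: measurable_expmono.
  + by move=> i w; exact: expmono_ge0.
  + move=> i j; rewrite XE -(D0E i) (expmono_absorption_time (sT i) (uT i) (JT i) j 0 (u0 i)).
    by rewrite D0E prD fact0 mul1r.
- have E i j : exists e : R,
      (\int[P]_(w in [set w | J0 w = Some j]) (X i w `^ theta i)%:E = (piv' 0 j * e)%:E)%E /\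
      e%:C = (Gamma_fun (theta i + 1))%:C * ((delta_mx j 0 : 'cV[R[i]]_p'.+1)^T *m
        matpow (- T' i) (- theta i) *m (const_mx 1 : 'cV[R[i]]_p'.+1)) 0 0.
    have [e e1 e2] := power_absorption_time (sT i) (uT i) (JT i) j (theta1 i).
    by exists e; split => //; rewrite XE -(D0E i) e1 D0E prD.
  pose e i j := sval (cid (E i j)).
  have e1 i j := (svalP (cid (E i j))).1; have e2 i j := (svalP (cid (E i j))).2.
  exists (\sum_j piv' 0 j * \prod_i e i j).
    have mpow i : measurable_fun setT (fun x => x `^ theta i) by exact: measurable_powR.
    have pow0 i w : 0 <= X i w `^ theta i by exact: powR_ge0.
    exact: (expectation_mixture mJ0 PJ0 sum_piv mX mpow pow0 ind e1).
  rewrite rmorph_sum; apply: eq_bigr => j _; rewrite rmorphM rmorph_prod; congr (_ * _).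
  by apply: eq_bigr => i _; exact: e2.
Qed.
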